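(* Let $\Omega\subset\mathbb R^d$ be open and $\omega\in\mathcal W$. Let $T\in\mathcal D'^{(\omega)}(\Omega)$ be a Beurling ultradistribution strongly associated to a Beurling regular generalized ultradifferentiable function $g=[(g_\varepsilon)]\in\mathcal G^{(\omega),\infty}(\Omega)$. Then $T$ is a Beurling ultradifferentiable function: $T\in\mathcal E^{(\omega)}(\Omega)$.
   Context: $\mathbb R^+=[0,\infty)$. $\mathcal W$ is the set of all nondecreasing continuous functions $\omega:\mathbb R^+\to\mathbb R^+$ such that $\omega(0)=0$; $\omega(x+y)\le\omega(x)+\omega(y)$ for all $x,y\ge 0$; $\int_1^\infty \frac{\omega(t)}{t^2}\,dt<\infty$; and $\lim_{t\to\infty}\frac{\omega(t)}{\log(1+t)}=\infty$. For a compactly supported continuous $f$ on $\mathbb R^d$ and $l>0$: $\|f\|_l^{\omega}=\int|\hat f(\xi)|e^{l\omega(|\xi|)}d\xi\in[0,\infty]$. $\mathcal D^{(\omega)}(\Omega)$ is the set of continuous $f$ with compact support in $\Omega$ and $\|f\|_l^\omega<\infty$ for all $l>0$; for compact $K\subset\Omega$, $\mathcal D_K^{(\omega)}(\Omega)$ is the subspace of those supported in $K$, a Fréchet space for the norms $\|\cdot\|_l^\omega$, $l>0$. $\mathcal D'^{(\omega)}(\Omega)$ is the space of linear functionals on $\mathcal D^{(\omega)}(\Omega)$ whose restriction to each $\mathcal D_K^{(\omega)}(\Omega)$ is continuous. $\mathcal E^{(\omega)}(\Omega)$ is the set of smooth $f:\Omega\to\mathbb C$ with $\psi f\in\mathcal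 D^{(\omega)}(\Omega)$ for all $\psi\in\mathcal D^{(\omega)}(\Omega)$, regarded as a subspace of $\mathcal D'^{(\omega)}(\Omega)$ via $\langle f,\phi\rangle=\int f\phi$. For compact $K\subset\Omega$, $\|f\|_{K,l}^{\omega}=\inf\{\|\psi f\|_l^{\omega}:\psi\in\mathcal D^{(\omega)}(\Omega),\ \psi=1\text{ on }K\}$. Nets $(g_\varepsilon)$ in $\mathcal E^{(\omega)}(\Omega)$ are indexed by $\varepsilon\in(0,1)$, $o(\cdot)$ is as $\varepsilon\to0^+$, $K$ ranges over compact subsets of $\Omega$. Moderate: $\forall K\,\forall h>0\,\exists k>0$: $\|g_\varepsilon\|_{K,h}^\omega=o(e^{k\omega(1/\varepsilon)})$. Negligible: $\forall K\,\forall h>0\,\forall k>0$: $\|g_\varepsilon\|_{K,h}^\omega=o(e^{-k\omega(1/\varepsilon)})$. $\mathcal G^{(\omega)}(\Omega)$ is the quotient of moderate by negligible nets. $g\in\mathcal G^{(\omega),\infty}(\Omega)$ (regular) means $g\in\mathcal G^{(\omega)}(\Omega)$ has a representative with $\forall K\ \exists k>0\ \forall h>0$: $\|g_\varepsilon\|_{K,h}^\omega=o(e^{k\omega(1/\varepsilon)})$. $T$ is strongly associated to $g=[(g_\varepsilon)]$ if $\forall K\ \exists b>0\ \forall\phi\in\mathcal D_K^{(\omega)}(\Omega)$: $\langle g_\varepsilon-T,\phi\rangle=o(e^{-b\omega(1/\varepsilon)})$. *)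

(* Defs.v *)
From HB Require Import structures.
From mathcomp Require Import all_boot all_order all_algebra.
From mathcomp Require Import all_classical all_reals all_analysis.
From mathcomp Require Export complex.

Set Implicit Arguments.
Unset Strict Implicit.
Unset Printing Implicit Defensive.

Import Order.TTheory GRing.Theory Num.Theory.
Import numFieldNormedType.Exports.

Local Open Scope classical_set_scope.
Local Open Scope complex_scope.
Local Open Scope ring_scope.

Section PowerMeasure.
Context {R : realType} {disp : measure_display} {T : measurableType disp}.

(* The library has no Lebesgue measure on R^n; it is built on [n.-tuple R] by
   iterating the product measure along R^(n+1) = R x R^n. *)
Definition tuple_of_prod n (p : T * n.-tuple T) : n.+1.-tuple T :=
  [tuple of p.1 :: p.2].

Definition prod_of_tuple n (t : n.+1.-tuple T) : T * n.-tuple T :=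
  (tnth t ord0, [tuple of behead t]).

Lemma measurable_tuple_of_prod n :
  measurable_fun [set: T * n.-tuple T] (@tuple_of_prod n).
Proof. exact: measurable_cons. Qed.

Lemma measurable_prod_of_tuple n :
  measurable_fun [set: n.+1.-tuple T] (@prod_of_tuple n).
Proof.
apply: measurable_fun_pair; first exact: measurable_tnth.
exact: measurable_behead.
Qed.

Lemma tuple_of_prodK n : cancel (@tuple_of_prod n) (@prod_of_tuple n).
Proof. by case=> x t; rewrite /prod_of_tuple; congr pair; exact: val_inj. Qed.

Section Step.
Variables (n : nat) (mu1 : {sigma_finite_measure set T -> \bar R}).
Variable mun : {sigma_finite_measure set (n.-tuple T) -> \bar R}.

Definition power_step : set (n.+1.-tuple T) -> \bar R :=
  pushforward (mu1 \x mun)%E (@tuple_of_prod n).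

Let power_step0 : power_step set0 = 0%E.
Proof. by rewrite /power_step /pushforward preimage_set0 measure0. Qed.

Let power_step_ge0 A : (0 <= power_step A)%E.
Proof. by rewrite /power_step /pushforward measure_ge0. Qed.

Let power_step_sigma_additive : semi_sigma_additive power_step.
Proof.
move=> F mF tF mUF; rewrite /power_step /pushforward preimage_bigcup.
have mpre A : measurable A -> measurable (@tuple_of_prod n @^-1` A).
  by move=> mA; rewrite -[X in measurable X]setTI; exact: measurable_tuple_of_prod.
apply: measure_semi_sigma_additive.
- by move=> i; exact: mpre.
- apply/trivIsetP => /= i j _ _ ij; rewrite -preimage_setI.
  by move/trivIsetP : tF => /(_ _ _ _ _ ij) ->//; rewrite preimage_set0.
- by rewrite -preimage_bigcup; exact: mpre.
Qed.

HB.instance Definition _ := isMeasure.Build _ _ _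
  power_step power_step0 power_step_ge0 power_step_sigma_additive.

Lemma sigma_finite_power_step : sigma_finite setT power_step.
Proof.
have [F TF mF] : sigma_finite setT (mu1 \x mun)%E.
  have /sigma_finiteP[F [TF ndF Foo]] := sigma_finiteT mu1.
  have /sigma_finiteP[G [TG ndG Goo]] := sigma_finiteT mun.
  exists (fun k => F k `*` G k).
    rewrite -setXTT TF TG predeqE => -[x y]; split.
      move=> [/= [i _ Fix] [k _ Gky]]; exists (maxn i k) => //; split.
      - by move: x Fix; exact/subsetPset/ndF/leq_maxl.
      - by move: y Gky; exact/subsetPset/ndG/leq_maxr.
    by move=> [i _ []/= ? ?]; split; exists i.
  move=> k; have [? ?] := Foo k; have [? ?] := Goo k.
  split; first exact: measurableX.
  by rewrite product_measure1E// lte_mul_pinfty// ge0_fin_numE.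
exists (fun i => @prod_of_tuple n @^-1` F i).
  by rewrite -preimage_bigcup -TF preimage_setT.
move=> i; have [mFi muFi] := mF i; split.
  by rewrite -[X in measurable X]setTI; exact: measurable_prod_of_tuple.
rewrite /power_step /pushforward (_ : _ @^-1` _ = F i)//.
by apply/seteqP; split=> p /=; rewrite tuple_of_prodK.
Qed.

HB.instance Definition _ :=
  Measure_isSigmaFinite.Build _ _ _ power_step sigma_finite_power_step.

End Step.

Fixpoint power_measure (mu : {sigma_finite_measure set T -> \bar R}) n :
    {sigma_finite_measure set (n.-tuple T) -> \bar R} :=
  if n is m.+1 then power_step mu (power_measure mu m)
  else \d_ ([tuple] : 0.-tuple T).

End PowerMeasure.

Definition lebesgue_tuple {R : realType} (n : nat) :
    {sigma_finite_measure set (n.-tuple (measurableTypeR R)) -> \bar R} :=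
  power_measure (@lebesgue_measure R) n.

Section Euclidean.
Context {R : realType} {d : nat}.
Local Notation C := R[i].
Local Notation E := 'rV[R]_d.

Definition dotp (x y : E) : R := \sum_i x 0 i * y 0 i.

(* The norm of ['rV[R]_d] in the library is the sup norm. *)
Definition enorm (x : E) : R := Num.sqrt (dotp x x).

Definition cmod (z : C) : R := ComplexField.Normc.normc z.

Definition vec (t : d.-tuple (measurableTypeR R)) : E := \row_i tnth t i.

Definition integral_ereal (f : E -> \bar R) : \bar R :=
  (\int[lebesgue_tuple d]_t f (vec t))%E.

Definition integralC (f : E -> C) : C :=
  (\int[lebesgue_tuple d]_t complex.Re (f (vec t))) +i*
  (\int[lebesgue_tuple d]_t complex.Im (f (vec t))).

Definition expi (t : R) : C := cos t +i* sin t.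

(* Normalization: int f(x) exp(-i x.xi) dx *)
Definition fourier (f : E -> C) (xi : E) : C :=
  integralC (fun x => f x * expi (- dotp x xi)).

Definition supp (f : E -> C) : set E := closure [set x | f x != 0].

Definition iter_partial (s : seq 'I_d) (u : E -> R) : E -> R :=
  foldr (fun i v => 'D_(delta_mx 0 i) v) u s.

(* C^oo on [Om]: all iterated partial derivatives exist and are continuous. *)
Definition smooth_real (Om : set E) (u : E -> R) : Prop :=
  forall (s : seq 'I_d) (x : E), Om x ->
    {for x, continuous (iter_partial s u)} /\
    forall i, derivable (iter_partial s u) x (delta_mx 0 i).

Definition smooth (Om : set E) (f : E -> C) : Prop :=
  smooth_real Om (fun x => complex.Re (f x)) /\ smooth_real Om (fun x => complex.Im (f x)).

End Euclidean.

(* Functions on [0, +oo[ are total functions on [R] whose values at negative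
   reals are irrelevant. *)
Record weight_class {R : realType} (w : R -> R) : Prop := WeightClass {
  weight_ge0 : forall t, 0 <= t -> 0 <= w t;
  weight_nondecreasing : forall s t, 0 <= s -> s <= t -> w s <= w t;
  weight_continuous : {within `[0, +oo[, continuous w};
  weight0 : w 0 = 0;
  weight_subadditive : forall s t, 0 <= s -> 0 <= t -> w (s + t) <= w s + w t;
  weight_integral :
    (\int[@lebesgue_measure R]_(t in `[1%R, +oo[) (w t / t ^+ 2)%:E < +oo)%E;
  weight_log : w t / ln (1 + t) @[t --> +oo] --> +oo
}.

Section Beurling.
Context {R : realType} {d : nat}.
Variable w : R -> R.
Local Notation C := R[i].
Local Notation E := 'rV[R]_d.
Implicit Types (Om K : set E) (f phi psi : E -> C).

Definition wnorm (l : R) f : \bar R :=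
  integral_ereal (fun xi => (cmod (fourier f xi) * expR (l * w (enorm xi)))%:E).

(* The cast selects the topology of [R[i]] as a normed field. *)
Definition testfun Om f : Prop :=
  [/\ continuous (f : E -> (C : numFieldType)), compact (supp f), supp f `<=` Om &
      forall l, 0 < l -> (wnorm l f < +oo)%E].

Definition testfun_in Om K f : Prop := testfun Om f /\ supp f `<=` K.

(* A functional on the test functions is a total map whose values outside
   [testfun Om] are irrelevant.  Continuity on D_K is continuity for the
   locally convex topology generated by the norms [wnorm l], [l > 0]: the
   finite intersections of balls form a base of neighbourhoods. *)
Definition testfun_continuous Om K (T : (E -> C) -> C) : Prop :=
  forall phi0, testfun_in Om K phi0 -> forall e : R, 0 < e ->
  exists (L : seq R) (delta : R),
    [/\ {in L, forall l, 0 < l}, 0 < delta &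
        forall phi, testfun_in Om K phi ->
          {in L, forall l, (wnorm l (fun x => phi x - phi0 x)%R < delta%:E)%E} ->
          cmod (T phi - T phi0) < e].

Record ultradistribution Om (T : (E -> C) -> C) : Prop := Ultradistribution {
  ultradistribution_linear : forall (a : C) phi psi,
    testfun Om phi -> testfun Om psi ->
    T (fun x => a * phi x + psi x) = a * T phi + T psi;
  ultradistribution_continuous : forall K,
    compact K -> K `<=` Om -> testfun_continuous Om K T
}.

(* A function on [Om] is represented by a total function whose values outside
   [Om] are irrelevant; [psi * f] is its extension by zero. *)
Definition ultradiff Om f : Prop :=
  smooth Om f /\
  forall psi, testfun Om psi -> testfun Om (fun x => psi x * f x).

Definition pairing f phi : C := integralC (fun x => f x * phi x).

Definition in_ultradiff Om (T : (E -> C) -> C) : Prop :=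
  exists f, ultradiff Om f /\ forall phi, testfun Om phi -> T phi = pairing f phi.

Definition wnorm_on Om K (l : R) f : \bar R :=
  ereal_inf [set wnorm l (fun x => psi x * f x) | psi in
    [set psi | testfun Om psi /\ forall x, K x -> psi x = 1]].

(* [u e = o(v e)] as [e] tends to 0 from the right *)
Definition little_o (u : R -> \bar R) (v : R -> R) : Prop :=
  forall c : R, 0 < c -> \forall e \near 0^'+, (`|u e| <= (c * `|v e|)%:E)%E.

(* Only the values of a net at parameters in ]0, 1[ are relevant. *)
Definition net Om (g : R -> E -> C) : Prop :=
  forall e : R, 0 < e < 1 -> ultradiff Om (g e).

Definition moderate Om (g : R -> E -> C) : Prop :=
  net Om g /\
  forall K, compact K -> K `<=` Om -> forall h, 0 < h -> exists2 k, 0 < k &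
    little_o (fun e => wnorm_on Om K h (g e)) (fun e => expR (k * w e^-1)).

Definition negligible Om (g : R -> E -> C) : Prop :=
  net Om g /\
  forall K, compact K -> K `<=` Om -> forall h, 0 < h -> forall k, 0 < k ->
    little_o (fun e => wnorm_on Om K h (g e)) (fun e => expR (- k * w e^-1)).

Definition gclass Om (g : R -> E -> C) : set (R -> E -> C) :=
  [set g' | moderate Om g' /\ negligible Om (fun e x => g' e x - g e x)].

(* Elements of the quotient are the equivalence classes of moderate nets. *)
Definition generalized_ultradiff Om : set (set (R -> E -> C)) :=
  [set gclass Om g | g in moderate Om].

Definition regular Om (G : set (R -> E -> C)) : Prop :=
  generalized_ultradiff Om G /\
  exists2 g, G g &
    forall K, compact K -> K `<=` Om -> exists2 k, 0 < k & forall h, 0 < h ->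
      little_o (fun e => wnorm_on Om K h (g e)) (fun e => expR (k * w e^-1)).

Definition strongly_associated Om (T : (E -> C) -> C)
    (G : set (R -> E -> C)) : Prop :=
  exists2 g, G g &
    forall K, compact K -> K `<=` Om -> exists2 b, 0 < b &
      forall phi, testfun_in Om K phi ->
        little_o (fun e => (cmod (pairing (g e) phi - T phi))%:E)
                 (fun e => expR (- b * w e^-1)).

End Beurling.

(* Main.v *)
Require Import Defs.
From mathcomp Require Import all_boot all_order all_algebra.
From mathcomp Require Import all_classical all_reals all_analysis.
From mathcomp Require Import measurable_realfun.
From mathcomp Require Import ring lra.

(** Sample the net at [1 / (n + 2)], write [g_n] for the sampled terms and
    [a_n = w (n + 2)].  It is enough to show that [psi * g_n] converges in the space
    of test functions supported in [K], for each test function [psi] supported in a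
    compact set [K].  Indeed the limits glue to a function [f] such that [psi * f] is
    a test function for every [psi]; such an [f] is smooth by Fourier inversion
    ([smooth_testfun]), and [T phi], the limit of the integrals of [g_n * phi], is
    the integral of [f * phi] ([strongly_associated_regular]).

    Convergence comes from playing the two hypotheses against each other.

    Strong association gives a decay at a rate [b] that is the same for all test
    functions supported in [K], but weakly: the functionals given by
    [exp (b a_n) (g_(n+1) - g_n)] are bounded at each test function.  By a uniform
    boundedness principle ([uniform_boundedness]) they are bounded by one of the
    norms; evaluated on [x |-> psi x exp (- i x.xi)], this bounds the Fourier
    transform of [psi (g_(n+1) - g_n)] at [xi] by
    [A exp (- b a_n) exp (l w |xi|)], for some fixed [l].

    Regularity bounds the norm of index [h] of [psi * g_n] by [C_h exp (k a_n)],
    where [k] does not depend on [h].  At low frequencies, where [w |xi|] is at most a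
    small multiple of [a_n], the first bound absorbs any exponential of [w |xi|]; at
    high frequencies, the second one, used for [h] large in terms of [k], gains
    more than [exp (k a_n)] ([wnorm_interpolation]).  So every norm of
    [psi (g_(n+1) - g_n)] is [O (exp (- b a_n / 2))], which is summable because [w]
    grows faster than the logarithm ([weight_decay]): the sequence [psi * g_n] is
    Cauchy ([localized_cauchy]), and the space of test functions supported in [K] is
    complete ([testfun_in_complete]).

    These arguments rest on three facts about the norms.  Fourier inversion, proved
    by damping with the Poisson kernel ([fourier_inversion]), shows that they
    dominate the uniform norm.  The Fourier transform of a product is a convolution,
    so subadditivity of [w] makes the norms submultiplicative ([wnormM]).  Modulation
    translates the Fourier transform, so it multiplies the norm of index [l] by at
    most [exp (l w |xi|)] ([wnorm_modulation]); this is what lets a gliding hump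
    built from modulations of a single [psi] prove uniform boundedness
    ([gliding_hump]). *)

Set Implicit Arguments.
Unset Strict Implicit.
Unset Printing Implicit Defensive.
Import Order.TTheory GRing.Theory Num.Theory.
Import numFieldNormedType.Exports.
Local Open Scope classical_set_scope.
Local Open Scope complex_scope.
Local Open Scope ring_scope.

Arguments cmod : simpl never.

(** * The modulus *)

Section Modulus.
Context {R : realType}.
Implicit Types (z : R[i]) (r : R).

Lemma cmodE z : cmod z = Num.sqrt (complex.Re z ^+ 2 + complex.Im z ^+ 2).
Proof. by case: z. Qed.

Lemma cmod_ge0 z : 0 <= cmod z.
Proof. by rewrite cmodE sqrtr_ge0. Qed.

Lemma cmodM z1 z2 : cmod (z1 * z2) = cmod z1 * cmod z2.
Proof. exact: ComplexField.Normc.normcM. Qed.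

Lemma cmodD z1 z2 : cmod (z1 + z2) <= cmod z1 + cmod z2.
Proof. exact: (@le_normcD R). Qed.

Lemma cmodN z : cmod (- z) = cmod z.
Proof. exact: (@normcN R). Qed.

Lemma cmodB z1 z2 : cmod (z1 - z2) <= cmod z1 + cmod z2.
Proof. by rewrite (le_trans (cmodD _ _))// cmodN. Qed.

Lemma cmod_distC z1 z2 : cmod (z1 - z2) = cmod (z2 - z1).
Proof. by rewrite -cmodN opprB. Qed.

Lemma cmod_dist z1 z2 : `|cmod z1 - cmod z2| <= cmod (z1 - z2).
Proof.
rewrite ler_norml; apply/andP; split.
- rewrite lerNl opprB lerBlDr cmod_distC -{1}(subrK z1 z2).
  exact: cmodD.
- by rewrite lerBlDr -{1}(subrK z2 z1); exact: cmodD.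
Qed.

Lemma cmod0 : cmod (0 : R[i]) = 0.
Proof. exact: ComplexField.Normc.normc0. Qed.

Lemma cmod1 : cmod (1 : R[i]) = 1.
Proof. exact: ComplexField.Normc.normc1. Qed.

Lemma cmod_eq0 z : cmod z = 0 -> z = 0.
Proof. exact: ComplexField.Normc.eq0_normc. Qed.

Lemma cmod_real r : cmod r%:C = `|r|.
Proof. by rewrite cmodE/= expr0n/= addr0 sqrtr_sqr. Qed.

Lemma sqr_cmod z : cmod z ^+ 2 = complex.Re z ^+ 2 + complex.Im z ^+ 2.
Proof. by rewrite cmodE sqr_sqrtr// addr_ge0 ?sqr_ge0. Qed.

Lemma Re_le_cmod z : `|complex.Re z| <= cmod z.
Proof.
rewrite -(ler_pXn2r (_ : 0 < 2)%N) ?nnegrE ?cmod_ge0 ?normr_ge0//.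
by rewrite sqr_cmod real_normK ?num_real// lerDl sqr_ge0.
Qed.

Lemma Im_le_cmod z : `|complex.Im z| <= cmod z.
Proof.
rewrite -(ler_pXn2r (_ : 0 < 2)%N) ?nnegrE ?cmod_ge0 ?normr_ge0//.
by rewrite sqr_cmod real_normK ?num_real// lerDr sqr_ge0.
Qed.

Lemma cmod_le_ReIm z : cmod z <= `|complex.Re z| + `|complex.Im z|.
Proof.
case: z => a b; have -> : a +i* b = a%:C + 0 +i* b.
  by apply/eqP; rewrite eq_complex/= addr0 add0r !eqxx.
have cmodi : cmod (0 +i* b) = `|b|.
  by rewrite cmodE expr0n/= add0r sqrtr_sqr.
by rewrite (le_trans (cmodD _ _))// cmod_real cmodi/= addr0 add0r.
Qed.

Lemma Re_mul z1 z2 : complex.Re (z1 * z2) =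
  complex.Re z1 * complex.Re z2 - complex.Im z1 * complex.Im z2.
Proof. by case: z1 => a b; case: z2. Qed.

Lemma Im_mul z1 z2 : complex.Im (z1 * z2) =
  complex.Re z1 * complex.Im z2 + complex.Im z1 * complex.Re z2.
Proof. by case: z1 => a b; case: z2. Qed.

Lemma Re_add z1 z2 : complex.Re (z1 + z2) = complex.Re z1 + complex.Re z2.
Proof. by case: z1 => a b; case: z2. Qed.

Lemma Im_add z1 z2 : complex.Im (z1 + z2) = complex.Im z1 + complex.Im z2.
Proof. by case: z1 => a b; case: z2. Qed.

Lemma Re_sub z1 z2 : complex.Re (z1 - z2) = complex.Re z1 - complex.Re z2.
Proof. by case: z1 => a b; case: z2. Qed.

Lemma Im_sub z1 z2 : complex.Im (z1 - z2) = complex.Im z1 - complex.Im z2.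
Proof. by case: z1 => a b; case: z2. Qed.

Lemma complex_ext z1 z2 : complex.Re z1 = complex.Re z2 ->
  complex.Im z1 = complex.Im z2 -> z1 = z2.
Proof. by case: z1 => a b; case: z2 => c e /= -> ->. Qed.

Lemma expiD (s t : R) : expi (s + t) = expi s * expi t.
Proof.
apply: complex_ext; rewrite ?Re_mul ?Im_mul/= ?cosD ?sinD//.
by rewrite addrC mulrC [X in _ + X]mulrC [RHS]addrC mulrC addrC mulrC.
Qed.

Lemma expi0 : expi (0 : R) = 1.
Proof. by rewrite /expi cos0 sin0. Qed.

Lemma cmod_expi (t : R) : cmod (expi t) = 1.
Proof. by rewrite cmodE/= cos2Dsin2 sqrtr1. Qed.

End Modulus.

(** * Integration of complex functions *)

Section ComplexIntegral.
Context {disp : measure_display} {T : measurableType disp} {R : realType}.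
Implicit Types (f g : T -> R[i]) (u v : T -> R).

Definition cmeasurable f :=
  measurable_fun setT (fun t => complex.Re (f t)) /\
  measurable_fun setT (fun t => complex.Im (f t)).

Lemma cmeasurable_cst (c : R[i]) : cmeasurable (fun=> c).
Proof. by split; exact: measurable_cst. Qed.

Lemma cmeasurableM f g : cmeasurable f -> cmeasurable g ->
  cmeasurable (fun t => f t * g t).
Proof.
move=> [f1 f2] [g1 g2]; split.
- by under eq_fun do rewrite Re_mul; apply: measurable_funB; exact: measurable_funM.
- by under eq_fun do rewrite Im_mul; apply: measurable_funD; exact: measurable_funM.
Qed.

Lemma cmeasurableB f g : cmeasurable f -> cmeasurable g ->
  cmeasurable (fun t => f t - g t).
Proof.
move=> [f1 f2] [g1 g2]; split.
- by under eq_fun do rewrite Re_sub; exact: measurable_funB.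
- by under eq_fun do rewrite Im_sub; exact: measurable_funB.
Qed.

Lemma cmeasurable_real u : measurable_fun setT u -> cmeasurable (fun t => (u t)%:C).
Proof. by move=> mu; split => //=; exact: measurable_cst. Qed.

Lemma cmeasurable_expi u : measurable_fun setT u -> cmeasurable (fun t => expi (u t)).
Proof.
move=> mu; split => /=.
- apply: (measurableT_comp _ mu); apply: continuous_measurable_fun.
  exact: continuous_cos.
- apply: (measurableT_comp _ mu); apply: continuous_measurable_fun.
  exact: continuous_sin.
Qed.

Lemma cmeasurable_cmod f : cmeasurable f ->
  measurable_fun setT (fun t => cmod (f t)).
Proof.
move=> [f1 f2]; under eq_fun do rewrite cmodE.
apply: measurableT_comp.
  by apply: continuous_measurable_fun; exact: sqrt_continuous.
by apply: measurable_funD; exact: measurable_funX.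
Qed.

Variable mu : {measure set T -> \bar R}.

Definition cintegrable f :=
  mu.-integrable setT (fun t => (complex.Re (f t))%:E) /\
  mu.-integrable setT (fun t => (complex.Im (f t))%:E).

Definition cint f : R[i] :=
  (\int[mu]_t complex.Re (f t)) +i* (\int[mu]_t complex.Im (f t)).

Lemma cintegrable_measurable f : cintegrable f -> cmeasurable f.
Proof.
by case=> /measurable_int/measurable_EFinP f1 /measurable_int/measurable_EFinP f2.
Qed.

Lemma integrable_cmod f : cintegrable f ->
  mu.-integrable setT (fun t => (cmod (f t))%:E).
Proof.
move=> fi; have [f1 f2] := fi.
apply: (le_integrable _ _ _ (integrableD _ (integrable_abse f1) (integrable_abse f2))) => //.
  apply/measurable_EFinP; exact/cmeasurable_cmod/cintegrable_measurable.
move=> t _; rewrite /= lee_fin (ger0_norm (cmod_ge0 _)).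
by rewrite (le_trans (cmod_le_ReIm _))// ler_norm.
Qed.

Lemma le_cintegrable f u : cmeasurable f -> mu.-integrable setT (fun t => (u t)%:E) ->
  (forall t, cmod (f t) <= u t) -> cintegrable f.
Proof.
move=> [f1 f2] iu fu; split; apply: (le_integrable _ _ _ iu) => //;
  try exact/measurable_EFinP; move=> t _ /=; rewrite lee_fin (le_trans _ (ler_norm _))//.
- exact: le_trans (Re_le_cmod _) _.
- exact: le_trans (Im_le_cmod _) _.
Qed.

Lemma cintegrableB f g : cintegrable f -> cintegrable g ->
  cintegrable (fun t => f t - g t).
Proof.
move=> [f1 f2] [g1 g2]; split.
- by under eq_fun do rewrite Re_sub EFinB; exact: integrableB.
- by under eq_fun do rewrite Im_sub EFinB; exact: integrableB.
Qed.

Lemma cintegrableZ (c : R[i]) f : cintegrable f -> cintegrable (fun t => c * f t).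
Proof.
move=> fi; apply: (@le_cintegrable _ (fun t => cmod c * cmod (f t))).
- by apply: cmeasurableM; [exact: cmeasurable_cst|exact: cintegrable_measurable].
- by under eq_fun do rewrite EFinM; apply: integrableZl => //; exact: integrable_cmod.
- by move=> t; rewrite cmodM.
Qed.

Lemma cintD f g : cintegrable f -> cintegrable g ->
  cint (fun t => f t + g t) = cint f + cint g.
Proof.
move=> [f1 f2] [g1 g2]; apply: complex_ext; rewrite ?Re_add ?Im_add /= -RintegralD//;
by apply: eq_Rintegral => t _; rewrite ?Re_add ?Im_add.
Qed.

Lemma cintB f g : cintegrable f -> cintegrable g ->
  cint (fun t => f t - g t) = cint f - cint g.
Proof.
move=> [f1 f2] [g1 g2]; apply: complex_ext; rewrite ?Re_sub ?Im_sub /= -RintegralB//;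
by apply: eq_Rintegral => t _; rewrite ?Re_sub ?Im_sub.
Qed.

Lemma cintZ (c : R[i]) f : cintegrable f -> cint (fun t => c * f t) = c * cint f.
Proof.
move=> [f1 f2].
have iZ (r : R) u : mu.-integrable setT (fun t => (u t)%:E) ->
    mu.-integrable setT (EFin \o (fun t => r * u t)).
  by move=> ui; rewrite /comp; under eq_fun do rewrite EFinM; exact: integrableZl.
apply: complex_ext; rewrite ?Re_mul ?Im_mul /= -!RintegralZl//.
- rewrite -RintegralB//; [|exact: iZ..].
  by apply: eq_Rintegral => t _; rewrite Re_mul.
- rewrite -RintegralD//; [|exact: iZ..].
  by apply: eq_Rintegral => t _; rewrite Im_mul.
Qed.

Arguments cint : simpl never.

Lemma eq_cint f g : f =1 g -> cint f = cint g.
Proof. by move=> /funext ->. Qed.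

Lemma cint_real u : cint (fun t => (u t)%:C) = (\int[mu]_t u t)%:C.
Proof. by apply: complex_ext => //=; rewrite /Rintegral integral0. Qed.

(** Rotating the integral onto the positive real axis reduces this to the
    monotonicity of real integrals. *)
Lemma cmod_cint f : cintegrable f ->
  ((cmod (cint f))%:E <= \int[mu]_t (cmod (f t))%:E)%E.
Proof.
move=> fi; set z := cint f.
have [z0|z0] := eqVneq (cmod z) 0.
  by rewrite z0 integral_ge0// => t _; rewrite lee_fin cmod_ge0.
have zp : 0 < cmod z by rewrite lt_neqAle eq_sym z0 cmod_ge0.
pose c : R[i] := (complex.Re z / cmod z) -i* (complex.Im z / cmod z).
have c1 : cmod c = 1.
  apply/eqP; rewrite -(eqrXn2 (_ : 0 < 2)%N) ?cmod_ge0// expr1n.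
  have -> : cmod c ^+ 2 = cmod z ^+ 2 / cmod z ^+ 2.
    have E (a b m : R) : m != 0 ->
      (a / m) ^+ 2 + (- (b / m)) ^+ 2 = (a ^+ 2 + b ^+ 2) / m ^+ 2.
      by move=> m0; field.
    by rewrite sqr_cmod [in X in _ = X / _]sqr_cmod; exact: E.
  by rewrite divff// expf_neq0.
have -> : cmod z = \int[mu]_t complex.Re (c * f t).
  have <- : complex.Re (c * z) = cmod z.
    rewrite Re_mul; transitivity (cmod z ^+ 2 / cmod z); last by rewrite expr2 mulfK.
    have E (a b m : R) : a / m * a - (- (b / m)) * b = (a ^+ 2 + b ^+ 2) / m by ring.
    by rewrite sqr_cmod; exact: E.
  by rewrite /z -cintZ.
have [cfi _] := cintegrableZ c fi.
rewrite fineK; last exact: integrable_fin_num.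
apply: le_integral => //; first exact: integrable_cmod.
move=> t _; rewrite lee_fin (le_trans (ler_norm _))// (le_trans (Re_le_cmod _))//.
by rewrite cmodM c1 mul1r.
Qed.

Lemma cmod_cint_le f u : cintegrable f -> mu.-integrable setT (fun t => (u t)%:E) ->
  (forall t, cmod (f t) <= u t) -> cmod (cint f) <= \int[mu]_t u t.
Proof.
move=> fi ui fu; rewrite -lee_fin (le_trans (cmod_cint fi))// fineK.
  by apply: le_integral => //; [exact: integrable_cmod|move=> t _; rewrite lee_fin].
exact: integrable_fin_num.
Qed.

Lemma cdominated_cvg (f_ : nat -> T -> R[i]) f u :
  (forall n, cmeasurable (f_ n)) -> cmeasurable f ->
  mu.-integrable setT (fun t => (u t)%:E) ->
  (forall n t, cmod (f_ n t) <= u t) ->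
  (forall t, cmod (f_ n t - f t) @[n --> \oo] --> 0) ->
  cintegrable f /\ cmod (cint (f_ n) - cint f) @[n --> \oo] --> 0.
Proof.
move=> mf_ mf ui fu cf.
have fuu t : cmod (f t) <= u t.
  apply/ler_addgt0Pl => e e0.
  have /cvgrPdist_lt/(_ e e0)[N _ /(_ N (leqnn N))] := cf t.
  rewrite sub0r normrN ger0_norm ?cmod_ge0// => h.
  have -> : f t = - (f_ N t - f t) + f_ N t by ring.
  rewrite (le_trans (cmodD _ _))// cmodN lerD// ltW//.
have fi : cintegrable f by exact: (le_cintegrable mf ui).
split=> //.
have f_i n : cintegrable (f_ n) by exact: (le_cintegrable (mf_ n) ui).
have di n : cintegrable (fun t => f_ n t - f t) by exact: cintegrableB.
have lim0 : (\int[mu]_t cmod (f_ n t - f t)) @[n --> \oo] --> (0 : R).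
  have -> : (0 : R) = fine (\int[mu]_(t in setT) (cst (0%:E) t)).
    by rewrite integral0.
  apply: fine_cvg; rewrite fineK ?integral0//.
  rewrite -[X in _ --> X](@integral0 _ _ _ mu setT).
  apply: (@dominated_cvg _ _ _ mu setT measurableT
    (fun n t => (cmod (f_ n t - f t))%:E) (cst 0%E) (fun t => (2 * u t)%:E)) => //.
  - by move=> n; apply/measurable_EFinP; exact/cmeasurable_cmod/cmeasurableB.
  - by move=> t _; apply/cvg_EFin; [exact: nearW|exact: cf].
  - by under eq_fun do rewrite EFinM; exact: integrableZl.
  - move=> n t _; rewrite /= lee_fin ger0_norm ?cmod_ge0//.
    by rewrite (le_trans (cmodB _ _))// mulr_natl mulr2n lerD.
apply: (squeeze_cvgr _ (cvg_cst 0) lim0); apply: nearW => n.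
rewrite cmod_ge0 andTb -cintB//; apply: cmod_cint_le => //.
exact: integrable_cmod.
Qed.

End ComplexIntegral.

Arguments cint : simpl never.

Lemma cmeasurable_comp {R : realType} {d d' : measure_display}
    {T : measurableType d} {T' : measurableType d'} (h : T' -> T) (f : T -> R[i]) :
  measurable_fun setT h -> cmeasurable f -> cmeasurable (fun t => f (h t)).
Proof.
by move=> mh [f1 f2]; split; [exact: (measurableT_comp f1)|exact: (measurableT_comp f2)].
Qed.

(** * Fubini's theorem and Lebesgue measure on tuples *)

Section DominatedFubini.
Context {d1 d2 : measure_display} {T1 : measurableType d1} {T2 : measurableType d2}.
Context {R : realType}.
Variables (m1 : {sigma_finite_measure set T1 -> \bar R}).
Variables (m2 : {sigma_finite_measure set T2 -> \bar R}).
Variables (u : T1 -> R) (v : T2 -> R).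
Hypothesis iu : m1.-integrable setT (fun x => (u x)%:E).
Hypothesis iv : m2.-integrable setT (fun y => (v y)%:E).

(** Every kernel met below is dominated by a product of integrable functions of
    the separate variables, and Tonelli's theorem bounds the integral of such a
    product. *)
Lemma integrable_prod_dominated (F : T1 * T2 -> R) : measurable_fun setT F ->
  (forall x y, `|F (x, y)| <= u x * v y) ->
  (m1 \x m2)%E.-integrable setT (fun z => (F z)%:E).
Proof.
move=> mF Fuv; apply/integrable12ltyP; first exact/measurable_EFinP.
have [/= mu_ u_oo] := (integrableP _ _ _ iu).
have [/= mv_ v_oo] := (integrableP _ _ _ iv).
have mF1 x : measurable_fun setT (fun y => F (x, y)).
  by apply: (measurableT_comp mF); exact: pair1_measurable.
pose V := fine (\int[m2]_y `|(v y)%:E|)%E.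
have VE : (\int[m2]_y `|(v y)%:E| = V%:E)%E.
  by rewrite fineK// ge0_fin_numE// integral_ge0.
apply: (@le_lt_trans _ _ (\int[m1]_x (`|(u x)%:E| * V%:E)))%E.
  apply: ge0_le_integral => //=.
  - by move=> x _; exact: integral_ge0.
  - apply: (measurable_fun_fubini_tonelli_F (fun z => `|(F z)%:E|%E)) => //.
    by apply: measurableT_comp => //; exact/measurable_EFinP.
  - apply: emeasurable_funM => //; do 2 apply: measurableT_comp => //.
    exact/measurable_EFinP.
  - move=> x _; rewrite -VE -ge0_integralZl//; last first.
    + by apply: measurableT_comp.
    apply: ge0_le_integral => //=.
    + by apply/measurable_EFinP/measurableT_comp.
    + apply: emeasurable_funM => //; apply/measurable_EFinP/measurableT_comp => //.
      exact/measurable_EFinP.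
    + move=> y _; rewrite lee_fin (le_trans (Fuv _ _))//.
      by rewrite (le_trans (ler_norm _))// normrM.
rewrite ge0_integralZr//; last by rewrite lee_fin fine_ge0// integral_ge0.
- by rewrite muleC lte_mul_pinfty// lee_fin fine_ge0// integral_ge0.
- by apply: measurableT_comp.
Qed.

Lemma Rintegral_prod_dominated (F : T1 * T2 -> R) : measurable_fun setT F ->
  (forall x y, `|F (x, y)| <= u x * v y) ->
  [/\ measurable_fun setT (fun x => \int[m2]_y F (x, y)),
      \int[m1]_x \int[m2]_y F (x, y) = \int[(m1 \x m2)%E]_z F z &
      \int[m2]_y \int[m1]_x F (x, y) = \int[(m1 \x m2)%E]_z F z].
Proof.
move=> mF Fuv; have iF := integrable_prod_dominated mF Fuv.
have iF1 x : m2.-integrable setT (fun y => (F (x, y))%:E).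
  apply: (@le_integrable _ _ _ _ _ _ _ (fun y => (u x * v y)%:E)) => //.
  - apply/measurable_EFinP/(measurableT_comp mF); exact: pair1_measurable.
  - by move=> y _; rewrite /= lee_fin (le_trans (Fuv _ _))// ler_norm.
  - by under eq_fun do rewrite EFinM; exact: integrableZl.
have iF2 y : m1.-integrable setT (fun x => (F (x, y))%:E).
  apply: (@le_integrable _ _ _ _ _ _ _ (fun x => (v y * u x)%:E)) => //.
  - apply/measurable_EFinP/(measurableT_comp mF); exact: pair2_measurable.
  - by move=> x _; rewrite /= lee_fin (le_trans (Fuv _ _))// mulrC ler_norm.
  - by under eq_fun do rewrite EFinM; exact: integrableZl.
split.
- apply/measurable_EFinP.
  have := measurable_fubini_F iF; rewrite /fubini_F.
  congr measurable_fun; apply/funext => x /=.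
  by rewrite fineK//; exact: integrable_fin_num.
- congr fine; rewrite -(integral12_prod_meas1 iF); apply: eq_integral => x _.
  by rewrite fineK//; exact: integrable_fin_num.
- congr fine; rewrite -(integral21_prod_meas1 iF); apply: eq_integral => y _.
  by rewrite fineK//; exact: integrable_fin_num.
Qed.

Lemma cint_prod_dominated (F : T1 * T2 -> R[i]) : cmeasurable F ->
  (forall x y, cmod (F (x, y)) <= u x * v y) ->
  [/\ cintegrable (m1 \x m2)%E F,
      cmeasurable (fun x => cint m2 (fun y => F (x, y))),
      cint m1 (fun x => cint m2 (fun y => F (x, y))) = cint (m1 \x m2)%E F &
      cint m1 (fun x => cint m2 (fun y => F (x, y))) =
      cint m2 (fun y => cint m1 (fun x => F (x, y)))].
Proof.
move=> [mF1 mF2] Fuv.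
have Re_uv x y : `|complex.Re (F (x, y))| <= u x * v y.
  by rewrite (le_trans (Re_le_cmod _)).
have Im_uv x y : `|complex.Im (F (x, y))| <= u x * v y.
  by rewrite (le_trans (Im_le_cmod _)).
have [m1F e1 e2] := Rintegral_prod_dominated mF1 Re_uv.
have [m2F e3 e4] := Rintegral_prod_dominated mF2 Im_uv.
split.
- split.
  + exact: (integrable_prod_dominated mF1 Re_uv).
  + exact: (integrable_prod_dominated mF2 Im_uv).
- by split.
- by apply: complex_ext; [exact: e1|exact: e3].
- by apply: complex_ext; [rewrite /= e1|rewrite /= e3].
Qed.

End DominatedFubini.

Section TupleMeasure.
Context {R : realType}.
Local Notation L := (@lebesgue_measure R).
Local Notation Tup n := (n.-tuple (measurableTypeR R)).

(** Lebesgue measure on tuples is the image of a product measure, so Tonelli's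
    theorem peels off the first coordinate. *)
Lemma ge0_integral_tupleS n (F : Tup n.+1 -> \bar R) :
  measurable_fun setT F -> (forall t, 0 <= F t)%E ->
  (\int[lebesgue_tuple n.+1]_t F t =
   \int[L]_x \int[lebesgue_tuple n]_t F (tuple_of_prod (x, t)))%E.
Proof.
move=> mF F0.
have mc := @measurable_tuple_of_prod _ (measurableTypeR R) n.
transitivity (\int[pushforward (L \x lebesgue_tuple n)
    (@tuple_of_prod _ (measurableTypeR R) n)]_t F t)%E.
  by apply: eq_measure_integral.
rewrite ge0_integral_pushforward// preimage_setT.
rewrite (fubini_tonelli1 (F \o @tuple_of_prod _ (measurableTypeR R) n))//.
  exact: (measurableT_comp mF mc).
by move=> p; exact: F0.
Qed.

Lemma cint_tupleS n (F : Tup n.+1 -> R[i]) (u : R -> R) (v : Tup n -> R) :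
  cmeasurable F -> L.-integrable setT (fun x => (u x)%:E) ->
  (lebesgue_tuple n).-integrable setT (fun t => (v t)%:E) ->
  (forall x t, cmod (F (tuple_of_prod (x, t))) <= u x * v t) ->
  cintegrable (lebesgue_tuple n.+1) F /\
  cint (lebesgue_tuple n.+1) F =
  cint L (fun x => cint (lebesgue_tuple n) (fun t => F (tuple_of_prod (x, t)))).
Proof.
move=> mF iu iv Fuv.
have mc := @measurable_tuple_of_prod _ (measurableTypeR R) n.
have mFc : cmeasurable (fun p => F (tuple_of_prod p)) := cmeasurable_comp mc mF.
have [[i1 i2] _ e _] := cint_prod_dominated iu iv mFc Fuv.
have [mF1 mF2] := mF.
split.
  split; apply: (integrable_pushforward mc _ _ measurableT) => //;
  exact/measurable_EFinP.
rewrite e; apply: complex_ext; congr fine.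
- transitivity (\int[pushforward (L \x lebesgue_tuple n)
      (@tuple_of_prod _ (measurableTypeR R) n)]_t (complex.Re (F t))%:E)%E.
    by apply: eq_measure_integral.
  by rewrite integral_pushforward// ?preimage_setT//; exact/measurable_EFinP.
- transitivity (\int[pushforward (L \x lebesgue_tuple n)
      (@tuple_of_prod _ (measurableTypeR R) n)]_t (complex.Im (F t))%:E)%E.
    by apply: eq_measure_integral.
  by rewrite integral_pushforward// ?preimage_setT//; exact/measurable_EFinP.
Qed.

Lemma tnth_tuple_of_prod0 n (x : R) (t : Tup n) :
  tnth (tuple_of_prod (x, t) : Tup n.+1) ord0 = x.
Proof. by []. Qed.

Lemma tnth_tuple_of_prodS n (x : R) (t : Tup n) i :
  tnth (tuple_of_prod (x, t) : Tup n.+1) (lift ord0 i) = tnth t i.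
Proof. by rewrite tnthS. Qed.

Lemma prod_tuple_of_prod n (h : 'I_n.+1 -> R -> R[i]) (x : R) (t : Tup n) :
  \prod_i h i (tnth (tuple_of_prod (x, t) : Tup n.+1) i) =
  h ord0 x * \prod_i h (lift ord0 i) (tnth t i).
Proof.
rewrite big_ord_recl; congr (_ * _); apply: eq_bigr => i _.
by congr (h _ _); exact: tnth_tuple_of_prodS.
Qed.

Lemma cmeasurable_prod d' (T : measurableType d') n (h : 'I_n -> T -> R[i]) :
  (forall i, cmeasurable (h i)) -> cmeasurable (fun t => \prod_i h i t).
Proof.
elim: n h => [|n IH] h mh.
  by under eq_fun do rewrite big_ord0; exact: cmeasurable_cst.
under eq_fun do rewrite big_ord_recl.
by apply: cmeasurableM => //; exact: IH.
Qed.

Lemma cint_tuple_prod n (h : 'I_n -> R -> R[i]) :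
  (forall i, cintegrable L (h i)) ->
  cintegrable (lebesgue_tuple n) (fun t : Tup n => \prod_i h i (tnth t i)) /\
  cint (lebesgue_tuple n) (fun t : Tup n => \prod_i h i (tnth t i)) =
  \prod_i cint L (h i).
Proof.
elim: n h => [|n IH] h ih.
  rewrite big_ord0; under eq_fun do rewrite big_ord0.
  split.
    apply: (@le_cintegrable _ _ _ _ _ (fun=> 1)).
    - exact: cmeasurable_cst.
    - apply/integrableP; split; first exact: measurable_cst.
      by rewrite /= integral_dirac//= diracT mul1e normr1 ltry.
    - by move=> t; rewrite cmod1.
  apply: complex_ext; rewrite /cint/= /Rintegral integral_dirac//= indicE in_setT mul1r//.
have [i1 e1] := IH (fun i => h (lift ord0 i)) (fun i => ih _).
have mt (i : 'I_n.+1) : measurable_fun setT (fun t : Tup n.+1 => tnth t i : measurableTypeR R).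
  exact: measurable_tnth.
have mh : cmeasurable (fun t : Tup n.+1 => \prod_i h i (tnth t i)).
  apply: cmeasurable_prod => i; apply: (cmeasurable_comp (mt i)).
  exact: (cintegrable_measurable (ih i)).
have [] := cint_tupleS mh (integrable_cmod (ih ord0)) (integrable_cmod i1).
  by move=> x t; rewrite prod_tuple_of_prod cmodM.
move=> i2 e2; split => //; rewrite e2 big_ord_recl -e1.
transitivity (cint L (fun x => cint (lebesgue_tuple n)
    (fun t : Tup n => \prod_i h (lift ord0 i) (tnth t i)) * h ord0 x)); last first.
  by rewrite cintZ// mulrC.
apply: eq_cint => x; rewrite mulrC -cintZ//; apply: eq_cint => t.
exact: prod_tuple_of_prod.
Qed.

(** The image of Lebesgue measure under the affine map, multiplied by [c], agrees
    with Lebesgue measure on intervals, hence everywhere by uniqueness. *)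
Lemma ge0_integral_affine1 (a c : R) (F : R -> \bar R) : 0 < c ->
  measurable_fun setT F -> (forall x, 0 <= F x)%E ->
  (\int[L]_x F (a + c * x)%R = c^-1%:E * \int[L]_x F x)%E.
Proof.
move=> c0 mF F0.
pose phi : measurableTypeR R -> measurableTypeR R := fun x => a + c * x.
have mphi : measurable_fun setT phi.
  by apply: measurable_funD => //; exact: measurable_funM.
have cn0 : 0 <= c by exact: ltW.
pose nu_ := mscale (NngNum cn0) (pushforward L phi).
pose nu := nu_ mphi.
have LE A : measurable A -> L A = nu A.
  apply: lebesgue_measure_unique => _ [[u v]] _ <-.
  change (L `]u, v]%classic = (c%:E * L (phi @^-1` `]u, v]%classic))%E).
  have -> : phi @^-1` `]u, v]%classic = `](u - a) / c, (v - a) / c]%classic.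
    apply/seteqP; split => x /=; rewrite !in_itv/= /phi ltr_pdivrMr// ler_pdivlMr//;
    by rewrite ltrBlDl lerBrDl (mulrC x).
  rewrite !lebesgue_measure_itv/= !lte_fin ltr_pM2r ?invr_gt0// ltrD2r.
  case: ifPn => uv; last by rewrite mule0.
  rewrite -EFinM; congr (_%:E); field; exact: lt0r_neq0.
have -> : (\int[L]_x F x = \int[nu]_x F x)%E.
  by apply: eq_measure_integral => A mA _; exact: LE.
rewrite ge0_integral_mscale// ge0_integral_pushforward// preimage_setT/=.
by rewrite muleA -EFinM mulVf ?mul1e// lt0r_neq0.
Qed.

Definition affine_tuple n (a : 'I_n -> R) (c : R) (t : Tup n) : Tup n :=
  [tuple of mktuple (fun i => a i + c * tnth t i)].

Lemma measurable_affine_tuple n (a : 'I_n -> R) c :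
  measurable_fun setT (affine_tuple a c).
Proof.
apply/measurable_fun_tnthP => i.
rewrite (_ : _ \o _ = fun t : Tup n => a i + c * tnth t i); last first.
  by apply/funext => t; exact: tnth_mktuple.
apply: measurable_funD => //; apply: measurable_funM => //.
exact: measurable_tnth.
Qed.

Lemma ge0_integral_affine n (a : 'I_n -> R) (c : R) (F : Tup n -> \bar R) :
  0 < c -> measurable_fun setT F -> (forall t, 0 <= F t)%E ->
  (\int[lebesgue_tuple n]_t F (affine_tuple a c t) =
   (c ^- n)%:E * \int[lebesgue_tuple n]_t F t)%E.
Proof.
move=> c0; elim: n a F => [|n IH] a F mF F0.
  rewrite expr0 invr1 mul1e; apply: eq_integral => t _.
  by congr F; rewrite [LHS]tuple0 [RHS]tuple0.
have mFa := measurableT_comp mF (measurable_affine_tuple a c).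
rewrite ge0_integral_tupleS//.
have E x t : affine_tuple a c (tuple_of_prod (x, t)) =
    tuple_of_prod (a ord0 + c * x, affine_tuple (fun i => a (lift ord0 i)) c t).
  apply: eq_from_tnth => i; rewrite tnth_mktuple.
  have [->|[j ->]] : i = ord0 \/ exists j, i = lift ord0 j.
    by case: (unliftP ord0 i) => [j|] ->; [right; exists j|left].
    by rewrite !tnth_tuple_of_prod0.
  by rewrite !tnth_tuple_of_prodS tnth_mktuple.
have mc := @measurable_tuple_of_prod _ (measurableTypeR R) n.
have mF2 : measurable_fun setT (fun p : measurableTypeR R * Tup n => F (tuple_of_prod p)).
  exact: (measurableT_comp mF).
under eq_integral => x _.
  under eq_integral do rewrite E.
  rewrite (IH (fun i => a (lift ord0 i))
    (fun t => F (tuple_of_prod (a ord0 + c * x, t))))//; last first.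
    by apply: (measurableT_comp mF2); exact: pair1_measurable.
  over.
have c1 : (0 <= (c ^- n)%:E)%E by rewrite lee_fin invr_ge0 exprn_ge0// ltW.
have mG := measurable_fun_fubini_tonelli_F (m2 := lebesgue_tuple n) _ mF2 (fun p => F0 _).
rewrite (@ge0_integral_affine1 (a ord0) c (fun x => ((c ^- n)%:E *
   \int[lebesgue_tuple n]_t F (tuple_of_prod (x, t)))%E) c0)//.
- rewrite ge0_integralZl//; last by move=> x _; exact: integral_ge0.
  by rewrite muleA -EFinM ge0_integral_tupleS// exprS invfM.
- exact: measurable_funeM.
- by move=> x; rewrite mule_ge0// integral_ge0.
Qed.

Lemma integrable_affine n (a : 'I_n -> R) (c : R) (f : Tup n -> R) : 0 < c ->
  (lebesgue_tuple n).-integrable setT (fun t => (f t)%:E) ->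
  (lebesgue_tuple n).-integrable setT (fun t => (f (affine_tuple a c t))%:E).
Proof.
move=> c0 /integrableP[mf foo]; apply/integrableP; split.
  exact: (measurableT_comp mf (measurable_affine_tuple a c)).
rewrite (@ge0_integral_affine n a c (fun t => `|(f t)%:E|%E) c0)//.
- by rewrite lte_mul_pinfty// lee_fin invr_ge0 exprn_ge0// ltW.
- exact: measurableT_comp.
Qed.

Lemma Rintegral_affine n (a : 'I_n -> R) (c : R) (f : Tup n -> R) : 0 < c ->
  (lebesgue_tuple n).-integrable setT (fun t => (f t)%:E) ->
  \int[lebesgue_tuple n]_t f (affine_tuple a c t) =
  c ^- n * \int[lebesgue_tuple n]_t f t.
Proof.
move=> c0 fi.
have fp := integrable_funepos measurableT fi.
have fn := integrable_funeneg measurableT fi.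
have c1 : c ^- n = fine (c ^- n)%:E by [].
rewrite c1 /Rintegral -fineM//; last exact: integrable_fin_num.
congr fine; rewrite integralE [in RHS]integralE muleBr//; last first.
  by rewrite fin_num_adde_defl// fin_numN; exact: integrable_fin_num.
congr (_ - _)%E.
- rewrite -(ge0_integral_affine a)//; last exact: measurable_int fp.
  by apply: eq_integral => t _; rewrite !funeposE.
- rewrite -(ge0_integral_affine a)//; last exact: measurable_int fn.
  by apply: eq_integral => t _; rewrite !funenegE.
Qed.

Lemma cint_affine n (a : 'I_n -> R) (c : R) (f : Tup n -> R[i]) : 0 < c ->
  cintegrable (lebesgue_tuple n) f ->
  cint (lebesgue_tuple n) f =
  cint (lebesgue_tuple n) (fun t => (c ^+ n)%:C * f (affine_tuple a c t)).
Proof.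
move=> c0 [f1 f2].
have i1 := @integrable_affine n a c (fun t => complex.Re (f t)) c0 f1.
have i2 := @integrable_affine n a c (fun t => complex.Im (f t)) c0 f2.
have e1 := @Rintegral_affine n a c (fun t => complex.Re (f t)) c0 f1.
have e2 := @Rintegral_affine n a c (fun t => complex.Im (f t)) c0 f2.
rewrite cintZ//.
have cn : c ^+ n != 0 by rewrite expf_neq0// lt0r_neq0.
by apply: complex_ext; rewrite ?Re_mul ?Im_mul /cint /= mul0r ?subr0 ?addr0
  ?e1 ?e2 mulrA mulfV// mul1r.
Qed.

End TupleMeasure.

(** * Continuous functions of several variables *)

Section EuclideanSpace.
Context {R : realType} {d : nat}.
Local Notation C := R[i].
Local Notation E := 'rV[R]_d.
Local Notation Tup := (d.-tuple (measurableTypeR R)).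
Implicit Types (x y : E) (f g : E -> C).

Lemma continuous_rVP (u : E -> R) : continuous u <->
  forall x (e : R), 0 < e -> exists2 delta : R, 0 < delta &
    forall y, (forall i, `|x 0 i - y 0 i| < delta) -> `|u x - u y| < e.
Proof.
split => [cu x e e0|h x].
  have /cvgrPdist_lt/(_ e e0) := cu x.
  move=> /nbhs_ballP[delta d0 hd]; exists delta => // y xy.
  by apply: hd; split => // i j; rewrite (ord1 i); exact: xy.
apply/(@cvgrPdist_lt R R^o E (nbhs x) _) => e /(h x)[delta d0 hd].
by apply/nbhs_ballP; exists delta => // y [_ xy]; apply: hd => i; exact: xy.
Qed.

Lemma ltcR (a b : R) : (a%:C < b%:C :> C) = (a < b).
Proof. by rewrite ltcE/= eqxx. Qed.

Lemma normc_cmod (z : C) : `|z| = (cmod z)%:C.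
Proof. by rewrite normc_def cmodE. Qed.

Lemma continuousC_rVP f : continuous (f : E -> (C : numFieldType)) <->
  forall x (e : R), 0 < e -> exists2 delta : R, 0 < delta &
    forall y, (forall i, `|x 0 i - y 0 i| < delta) -> cmod (f x - f y) < e.
Proof.
split => [cf x e e0|h x].
  have e0C : 0 < e%:C :> C by rewrite ltcR.
  have /(@cvgrPdist_lt C C^o)/(_ e%:C e0C) := cf x.
  move=> /nbhs_ballP[delta d0 hd]; exists delta => // y xy.
  have := hd y; rewrite /= normc_cmod ltcR; apply; split => // i j.
  by rewrite (ord1 i); exact: xy.
apply/(@cvgrPdist_lt C C^o E (nbhs x) _) => -[e e'] /=.
rewrite ltcE/= => /andP[/eqP -> e0].
have [delta d0 hd] := h x e e0.
apply/nbhs_ballP; exists delta => // y [_ xy].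
by rewrite /= normc_cmod ltcR; apply: hd => i; exact: xy.
Qed.

Lemma continuous_cmod f : continuous (f : E -> (C : numFieldType)) ->
  continuous (fun x => cmod (f x)).
Proof.
move=> /continuousC_rVP h; apply/continuous_rVP => x e /(h x)[delta d0 hd].
by exists delta => // y /hd; apply: le_lt_trans; exact: cmod_dist.
Qed.

Lemma continuous_Re f : continuous (f : E -> (C : numFieldType)) ->
  continuous (fun x => complex.Re (f x)).
Proof.
move=> /continuousC_rVP h; apply/continuous_rVP => x e /(h x)[delta d0 hd].
exists delta => // y /hd; apply: le_lt_trans.
by rewrite -Re_sub Re_le_cmod.
Qed.

Lemma continuous_Im f : continuous (f : E -> (C : numFieldType)) ->
  continuous (fun x => complex.Im (f x)).
Proof.
move=> /continuousC_rVP h; apply/continuous_rVP => x e /(h x)[delta d0 hd].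
exists delta => // y /hd; apply: le_lt_trans.
by rewrite -Im_sub Im_le_cmod.
Qed.

Lemma continuousC_ReIm f : continuous (fun x => complex.Re (f x)) ->
  continuous (fun x => complex.Im (f x)) -> continuous (f : E -> (C : numFieldType)).
Proof.
move=> /continuous_rVP h1 /continuous_rVP h2; apply/continuousC_rVP => x e e0.
have [d1 d10 hd1] := h1 x _ (divr_gt0 e0 (ltr0n _ 2)).
have [d2 d20 hd2] := h2 x _ (divr_gt0 e0 (ltr0n _ 2)).
exists (Num.min d1 d2); first by rewrite lt_min d10.
move=> y xy; rewrite (le_lt_trans (cmod_le_ReIm _))// Re_sub Im_sub (splitr e).
by rewrite ltrD// ?hd1 ?hd2// => i; have := xy i; rewrite lt_min => /andP[].
Qed.

Lemma vecE (t : Tup) i : vec t 0 i = tnth t i.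
Proof. by rewrite mxE. Qed.

Let grid (n : nat) (v : {ffun 'I_d -> int}) : E := \row_i ((v i)%:~R / n.+1%:R).
Let snap (n : nat) (t : Tup) : {ffun 'I_d -> int} :=
  [ffun i => Num.floor (n.+1%:R * tnth t i)].

(** The Borel sets of the product and of the topology agree: a continuous
    function is the limit of its values at the nearest points of a finer and
    finer lattice, and these only take countably many values. *)
Lemma measurable_vec_continuous (u : E -> R) : continuous u ->
  measurable_fun setT (fun t : Tup => u (vec t)).
Proof.
move=> /continuous_rVP cu.
apply: (@measurable_fun_cvg _ _ _ _ (fun n t => u (grid n (snap n t)))); last first.
  move=> t _; apply/cvgrPdist_lt => e /(cu (vec t))[delta d0 hd].
  near=> n; apply: hd => i; rewrite vecE !mxE ffunE.
  set s := tnth t i.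
  have n0 : 0 < n.+1%:R :> R by [].
  have [lo hi] : (Num.floor (n.+1%:R * s))%:~R <= n.+1%:R * s /\
      n.+1%:R * s < (Num.floor (n.+1%:R * s))%:~R + 1.
    have := eqxx (Num.floor (n.+1%:R * s)).
    by rewrite floor_eq intrD => /andP[].
  set z := (Num.floor _)%:~R : R in lo hi *.
  have -> : s - z / n.+1%:R = (n.+1%:R * s - z) / n.+1%:R.
    by rewrite mulrBl mulrAC divff ?mul1r ?lt0r_neq0.
  rewrite ger0_norm; last by rewrite divr_ge0// subr_ge0.
  rewrite (@le_lt_trans _ _ (n.+1%:R^-1))//.
    by rewrite ler_pdivrMr// mulVf ?lt0r_neq0// lerBlDl ltW.
  near: n; have := near_infty_natSinv_lt (PosNum d0); exact.
move=> n _ B mB; rewrite setTI.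
have -> : (fun t => u (grid n (snap n t))) @^-1` B =
    \bigcup_(v : {ffun 'I_d -> int}) [set t : Tup | snap n t = v /\ B (u (grid n v))].
  apply/seteqP; split => [t Bt|t [v _ [<-]]//].
  by exists (snap n t).
apply: countable_bigcupT_measurable; first exact: countableP.
move=> v; have [Bv|nBv] := pselect (B (u (grid n v))); last first.
  by rewrite (_ : [set _ | _] = set0)//; apply/seteqP; split => // t [].
have -> : [set t : Tup | snap n t = v /\ B (u (grid n v))] =
    \bigcap_(i in [set: 'I_d])
      ((fun t : Tup => n.+1%:R * tnth t i) @^-1` `[(v i)%:~R, (v i)%:~R + 1[).
  apply/seteqP; split => [t [sv _] i _ /=|t h].
    rewrite -sv ffunE in_itv/=; have := eqxx (Num.floor (n.+1%:R * tnth t i)).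
    by rewrite floor_eq intrD.
  split => //; apply/ffunP => i; rewrite ffunE; apply/eqP.
  rewrite floor_eq; have := h i Logic.I; rewrite /= in_itv/= => /andP[-> /=].
  by rewrite intrD.
apply: fin_bigcap_measurable => // i _.
rewrite -[X in measurable X]setTI.
have : measurable_fun setT (fun t : Tup => n.+1%:R * tnth t i).
  by apply: measurable_funM => //; exact: measurable_tnth.
by apply => //; exact: measurable_itv.
Unshelve. all: by end_near. Qed.

Lemma cmeasurable_vec f : continuous (f : E -> (C : numFieldType)) ->
  cmeasurable (fun t : Tup => f (vec t)).
Proof.
move=> cf; split; apply: (measurable_vec_continuous (u := fun x => _ (f x))).
- exact: continuous_Re.
- exact: continuous_Im.
Qed.

Lemma dotpC x y : dotp x y = dotp y x.
Proof. by apply: eq_bigr => i _; rewrite mulrC. Qed.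

Lemma dotpDl x y z : dotp (x + y) z = dotp x z + dotp y z.
Proof. by rewrite -big_split; apply: eq_bigr => i _; rewrite mxE mulrDl. Qed.

Lemma dotpZl c x y : dotp (c *: x) y = c * dotp x y.
Proof. by rewrite /dotp mulr_sumr; apply: eq_bigr => i _; rewrite mxE mulrA. Qed.

Lemma dotpNl x y : dotp (- x) y = - dotp x y.
Proof. by rewrite -scaleN1r dotpZl mulN1r. Qed.

Lemma dotpDr x y z : dotp z (x + y) = dotp z x + dotp z y.
Proof. by rewrite dotpC dotpDl !(dotpC z). Qed.

Lemma dotpNr x y : dotp y (- x) = - dotp y x.
Proof. by rewrite dotpC dotpNl (dotpC y). Qed.

Lemma dotp_ge0 x : 0 <= dotp x x.
Proof. by apply: sumr_ge0 => i _; rewrite -expr2 sqr_ge0. Qed.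

Lemma enorm_ge0 x : 0 <= enorm x.
Proof. exact: sqrtr_ge0. Qed.

Lemma sqr_enorm x : enorm x ^+ 2 = dotp x x.
Proof. by rewrite sqr_sqrtr// dotp_ge0. Qed.

Lemma enormN x : enorm (- x) = enorm x.
Proof. by rewrite /enorm dotpNl dotpNr opprK. Qed.

Lemma coord_le_enorm x i : `|x 0 i| <= enorm x.
Proof.
rewrite -(ler_pXn2r (_ : 0 < 2)%N) ?nnegrE ?enorm_ge0 ?normr_ge0//.
rewrite sqr_enorm real_normK ?num_real// /dotp (bigD1 i)//= -expr2 lerDl.
by apply: sumr_ge0 => j _; rewrite -expr2 sqr_ge0.
Qed.

Lemma cauchy_schwarz x y : dotp x y ^+ 2 <= dotp x x * dotp y y.
Proof.
have [y0|y0] := eqVneq (dotp y y) 0.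
  have yi i : y 0 i = 0.
    apply/eqP; rewrite -normr_eq0 eq_le normr_ge0 andbT.
    by rewrite (le_trans (coord_le_enorm _ _))// /enorm y0 sqrtr0.
  have -> : dotp x y = 0 by apply: big1 => i _; rewrite yi mulr0.
  by rewrite y0 mulr0 expr0n.
have yp : 0 < dotp y y by rewrite lt_neqAle eq_sym y0 dotp_ge0.
have := dotp_ge0 (dotp y y *: x - dotp x y *: y).
rewrite dotpDl !dotpDr !dotpNl !dotpNr !dotpZl !(dotpC _ (_ *: _)) !dotpZl (dotpC y x).
move: yp; move: (dotp x x) (dotp x y) (dotp y y) => a b c c0 h.
have : 0 <= c * (a * c - b ^+ 2) by move: h; congr (_ <= _); ring.
by rewrite pmulr_rge0// subr_ge0.
Qed.

Lemma enormD x y : enorm (x + y) <= enorm x + enorm y.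
Proof.
rewrite -(ler_pXn2r (_ : 0 < 2)%N) ?nnegrE ?enorm_ge0 ?addr_ge0 ?enorm_ge0//.
rewrite sqr_enorm sqrrD !sqr_enorm dotpDl !dotpDr (dotpC y x).
have : dotp x y <= enorm x * enorm y.
  rewrite (le_trans (ler_norm _))// -(ler_pXn2r (_ : 0 < 2)%N) ?nnegrE ?mulr_ge0 ?enorm_ge0//.
  by rewrite real_normK ?num_real// exprMn !sqr_enorm cauchy_schwarz.
rewrite mulr2n; lra.
Qed.

Lemma measurable_dotp d' (T : measurableType d') (h k : T -> Tup) :
  measurable_fun setT h -> measurable_fun setT k ->
  measurable_fun setT (fun p => dotp (vec (h p)) (vec (k p))).
Proof.
move=> mh mk; apply: measurable_sum => i; apply: measurable_funM.
- under eq_fun do rewrite vecE; exact: (measurableT_comp (measurable_tnth i) mh).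
- under eq_fun do rewrite vecE; exact: (measurableT_comp (measurable_tnth i) mk).
Qed.

Lemma measurable_enorm : measurable_fun setT (fun t : Tup => enorm (vec t)).
Proof.
apply: measurableT_comp; first by apply: continuous_measurable_fun; exact: sqrt_continuous.
exact: measurable_dotp.
Qed.

Lemma measurable_coord i : measurable_fun setT (fun t : Tup => vec t 0 i).
Proof. by under eq_fun do rewrite vecE; exact: measurable_tnth. Qed.

Lemma expi_dotp (z x : E) : expi (dotp z x) = \prod_i expi (z 0 i * x 0 i).
Proof. by rewrite /dotp (big_morph _ (@expiD R) (@expi0 R)). Qed.

End EuclideanSpace.

(** * The Poisson kernel *)

Section PoissonKernel.
Context {R : realType}.
Local Notation L := (@lebesgue_measure R).

Lemma continuous_exp_cos_sin (c z : R) :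
  [/\ continuous (fun x : R => expR (- (c * `|x|)) : R),
      continuous (fun x : R => cos (z * x) : R) & continuous (fun x : R => sin (z * x) : R)].
Proof.
have lin (g : R -> R) (b : R) : continuous g -> continuous (fun x => b * g x).
  by move=> cg x; apply: cvgM; [exact: cvg_cst|exact: cg].
split.
- move=> x; apply: (@continuous_comp _ _ _ (fun x => - (c * `|x|))); last exact: continuous_expR.
  by apply: cvgN; apply: lin; exact: norm_continuous.
- by move=> x; apply: continuous_comp; [apply: lin => y; exact: cvg_id|exact: continuous_cos].
- by move=> x; apply: continuous_comp; [apply: lin => y; exact: cvg_id|exact: continuous_sin].
Qed.

(** The summand 1 makes the integrand nonnegative, so that the fundamental
    theorem applies on the half-line without integrability hypotheses. *)
Lemma ge0_integral_exp_1Dcos (c z : R) : 0 < c ->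
  (\int[L]_(x in `[0%R, +oo[) (expR (- (c * x)) * (1 + cos (z * x)))%:E =
   (c^-1 + c / (c ^+ 2 + z ^+ 2))%:E)%E.
Proof.
move=> c0; pose D := c ^+ 2 + z ^+ 2.
have D0 : 0 < D by rewrite ltr_pwDl ?sqr_ge0// exprn_gt0.
pose f x : R := expR (- (c * x)) * (1 + cos (z * x)).
pose F x : R := expR (- (c * x)) * (- c^-1 + D^-1 * (z * sin (z * x) - c * cos (z * x))).
have dF (x : R) : is_derive x 1 F (f x).
  apply: is_derive_eq.
  rewrite /f /GRing.scale/= /D.
  have cn : c != 0 by exact: lt0r_neq0.
  have Dn : c ^+ 2 + z ^+ 2 != 0 by exact: lt0r_neq0.
  by field; rewrite Dn.
rewrite (@ge0_continuous_FTC2y _ f F 0 0).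
- rewrite /F mulr0 oppr0 expR0 mul1r mulr0 sin0 mulr0 sub0r cos0 mulr1 add0e.
  by rewrite -EFinN opprD opprK mulrN opprK mulrC.
- by move=> x _; rewrite mulr_ge0 ?expR_ge0.
- apply: continuous_subspaceT => x.
  by apply: differentiable_continuous; apply/derivable1_diffP; exact: ex_derive.
- pose M := c^-1 + D^-1 * (`|z| + c).
  have FM x : `|F x| <= M * expR (- (c * x)).
    rewrite normrM (ger0_norm (expR_ge0 _)) mulrC ler_wpM2r ?expR_ge0//.
    rewrite (le_trans (ler_normD _ _))// lerD//.
      by rewrite normrN ger0_norm// invr_ge0 ltW.
    rewrite normrM ger0_norm ?invr_ge0 ?(ltW D0)// ler_wpM2l ?invr_ge0 ?(ltW D0)//.
    rewrite (le_trans (ler_normB _ _))// lerD// normrM.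
      by rewrite ler_piMr//; exact: sin_max.
    by rewrite gtr0_norm// ler_piMr ?(ltW c0)//; exact: cos_max.
  have lim0 : M * expR (- (c * x)) @[x --> +oo] --> (0 : R).
    rewrite -[X in _ --> X](mulr0 M); apply: cvgM; first exact: cvg_cst.
    apply: (@cvg_comp _ _ _ (fun x => c * x) (fun y => expR (- y)) _ +oo%R).
      by apply: gt0_cvgMry => //; exact: cvg_id.
    exact: cvgr_expR.
  apply/norm_cvg0P; apply: (squeeze_cvgr _ (cvg_cst 0) lim0).
  by apply: nearW => x; rewrite normr_ge0 FM.
- by move=> x _; exact: ex_derive.
- apply: cvg_at_right_filter.
  by apply: differentiable_continuous; apply/derivable1_diffP; exact: ex_derive.
- by move=> x _; rewrite derive1E; exact: derive_val.
Qed.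

Lemma Rintegral_odd (f : R -> R) : (forall x, f (- x) = - f x) ->
  L.-integrable setT (fun x => (f x)%:E) -> \int[L]_x f x = 0.
Proof.
move=> oddf fi; rewrite /Rintegral integralE.
have fp := integrable_funepos measurableT fi.
have fn := integrable_funeneg measurableT fi.
suff -> : (\int[L]_x (fun x => (f x)%:E)^\- x = \int[L]_x (fun x => (f x)%:E)^\+ x)%E.
  by rewrite subee//; exact: integrable_fin_num.
pose nu := pushforward L (-%R : _ -> measurableTypeR R).
transitivity (\int[nu]_x (fun x => (f x)%:E)^\- x)%E.
  apply: eq_measure_integral => A mA _; apply/esym; exact: lebesgue_measureN.
rewrite ge0_integral_pushforward//.
  rewrite preimage_setT; apply: eq_integral => x _ /=.
  by rewrite funenegE funeposE oddf EFinN oppeK.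
exact: measurable_int fn.
Qed.

Lemma integral_exp_1Dcos (c z : R) : 0 < c ->
  (\int[L]_x (expR (- (c * `|x|)) * (1 + cos (z * x)))%:E =
   (2 * (c^-1 + c / (c ^+ 2 + z ^+ 2)))%:E)%E.
Proof.
move=> c0; have [ce cc cs] := continuous_exp_cos_sin c z.
rewrite (@ge0_symfun_integralT _ (fun x => expR (- (c * `|x|)) * (1 + cos (z * x)))).
- rewrite -set_itvcy EFinM -(ge0_integral_exp_1Dcos z c0); congr (_ * _)%E.
  by apply: eq_integral => x; rewrite inE/= in_itv/= andbT => x0; rewrite ger0_norm.
- by move=> x; rewrite mulr_ge0 ?expR_ge0.
- move=> x; apply: cvgM; first exact: ce.
  by apply: cvgD; [exact: cvg_cst|exact: cc].
- by move=> x; rewrite /= normrN mulrN cosN.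
Qed.

Lemma integrable_exp_norm (c : R) : 0 < c ->
  L.-integrable setT (fun x => (expR (- (c * `|x|)))%:E).
Proof.
move=> c0; have [ce _ _] := continuous_exp_cos_sin c 0.
apply/integrableP; split.
  by apply/measurable_EFinP; exact: continuous_measurable_fun.
have := integral_exp_1Dcos 0 c0.
under eq_integral do rewrite mul0r cos0 -[1 + 1]/(2%:R) mulrC EFinM.
rewrite ge0_integralZl//; last first.
  by apply/measurable_EFinP; exact: continuous_measurable_fun.
move=> h; under eq_integral do rewrite /= ger0_norm ?expR_ge0//.
move: h; set I := (\int[L]_x _)%E => h.
case: I h => [r _| |]; first by rewrite ltry.
- by rewrite mulry gtr0_sg// mul1e.
- by rewrite mulrNy gtr0_sg// mul1e.
Qed.

(** The real part comes from subtracting the case [z = 0] in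
    [integral_exp_1Dcos]; the imaginary part is the integral of an odd function. *)
Lemma cint_poisson1 (c z : R) : 0 < c ->
  cintegrable L (fun x => (expR (- (c * `|x|)))%:C * expi (z * x)) /\
  cint L (fun x => (expR (- (c * `|x|)))%:C * expi (z * x)) =
  (2 * c / (c ^+ 2 + z ^+ 2))%:C.
Proof.
move=> c0; have [ce cc cs] := continuous_exp_cos_sin c z.
have ie := integrable_exp_norm c0.
have mzx : measurable_fun setT (fun x : R => z * x) by exact: measurable_funM.
have fi : cintegrable L (fun x => (expR (- (c * `|x|)))%:C * expi (z * x)).
  apply: (le_cintegrable _ ie).
  - apply: cmeasurableM; last exact: cmeasurable_expi.
    by apply: cmeasurable_real; exact: continuous_measurable_fun.
  - by move=> x; rewrite cmodM cmod_expi mulr1 cmod_real ger0_norm ?expR_ge0.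
split=> //; have [f1 f2] := fi.
have E1 x : complex.Re ((expR (- (c * `|x|)))%:C * expi (z * x)) =
    expR (- (c * `|x|)) * cos (z * x) by rewrite Re_mul/= mul0r subr0.
have E2 x : complex.Im ((expR (- (c * `|x|)))%:C * expi (z * x)) =
    expR (- (c * `|x|)) * sin (z * x) by rewrite Im_mul/= mul0r addr0.
move: f1 f2; under eq_fun do rewrite E1; move=> f1.
under eq_fun do rewrite E2; move=> f2.
have e0 : \int[L]_x expR (- (c * `|x|)) = 2 * c^-1.
  have := integral_exp_1Dcos 0 c0.
  under eq_integral do rewrite mul0r cos0 -[1 + 1]/(2%:R) mulrC EFinM.
  rewrite integralZl// -[X in (_ * X)%E]fineK; last exact: integrable_fin_num.
  rewrite -EFinM => -[]; rewrite -/(Rintegral L setT (fun x => expR (- (c * `|x|)))) => h.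
  have cn : c != 0 by exact: lt0r_neq0.
  apply: (@mulfI _ 2) => //; rewrite h; field; exact: cn.
have -> : cint L (fun x => (expR (- (c * `|x|)))%:C * expi (z * x)) =
    (\int[L]_x (expR (- (c * `|x|)) * cos (z * x))) +i*
    (\int[L]_x (expR (- (c * `|x|)) * sin (z * x))).
  by congr (_ +i* _); apply: eq_Rintegral => x _; rewrite ?E1 ?E2.
apply: complex_ext => /=.
- have : \int[L]_x (expR (- (c * `|x|)) + expR (- (c * `|x|)) * cos (z * x)) =
      2 * (c^-1 + c / (c ^+ 2 + z ^+ 2)).
    rewrite /Rintegral; under eq_integral do rewrite -[X in X + _]mulr1 -mulrDr.
    by rewrite integral_exp_1Dcos.
  by rewrite RintegralD// e0 mulrDr => /addrI ->; rewrite mulrA.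
- by apply: Rintegral_odd => // x; rewrite normrN mulrN sinN mulrN.
Qed.

Lemma integrable_lorentz :
  L.-integrable setT (fun x => ((1 + x ^+ 2)^-1)%:E) /\
  \int[L]_x (1 + x ^+ 2)^-1 = pi.
Proof.
have E : (\int[L]_x ((1 + x ^+ 2)^-1)%:E = pi%:E)%E.
  rewrite (@ge0_symfun_integralT _ (fun x => (oneDsqr x)^-1)).
  - rewrite -set_itvcy integral0y_oneDsqr -EFinM; congr _%:E.
    by rewrite mulrCA divff ?mulr1.
  - by move=> x; rewrite invr_ge0.
  - exact: continuous_oneDsqrV.
  - by move=> x; rewrite /= /oneDsqr sqrrN.
split; last by rewrite /Rintegral E.
apply/integrableP; split.
  apply/measurable_EFinP.
  exact: (@continuous_measurable_fun R (fun x => (oneDsqr x)^-1) (@continuous_oneDsqrV R)).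
under eq_integral.
  move=> x _; rewrite /= ger0_norm; last by rewrite invr_ge0 addr_ge0 ?sqr_ge0.
  over.
by rewrite E ltry.
Qed.

End PoissonKernel.

(** * Fourier inversion *)

Section FourierInversion.
Context {R : realType} {d : nat}.
Local Notation C := R[i].
Local Notation E := 'rV[R]_d.
Local Notation Tup := (d.-tuple (measurableTypeR R)).
Local Notation mu := (@lebesgue_tuple R d).
Implicit Types (x y z xi : E) (f g : E -> C).

(** Being positive and integrable, this function dominates a multiple of every
    bounded function with compact support; it is also, up to a factor, the Poisson
    kernel at scale 1, which is why its exact integral is needed. *)
Definition lorentz x : R := \prod_i (1 + x 0 i ^+ 2)^-1.

Lemma lorentz_gt0 x : 0 < lorentz x.
Proof. by apply: prodr_gt0 => i _; rewrite invr_gt0 ltr_pwDl ?sqr_ge0. Qed.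

Lemma real_prod (I : finType) (h : I -> R) : (\prod_i h i)%:C = \prod_i (h i)%:C :> C.
Proof. exact: rmorph_prod. Qed.

Lemma integrable_lorentz_vec :
  mu.-integrable setT (fun t : Tup => (lorentz (vec t))%:E) /\
  \int[mu]_t lorentz (vec t) = pi ^+ d.
Proof.
have [i1 e1] := @integrable_lorentz R.
have ci (i : 'I_d) : cintegrable (@lebesgue_measure R) (fun x : R => ((1 + x ^+ 2)^-1)%:C).
  by split => //=; exact: integrable0.
have [[i2 _] e2] := cint_tuple_prod ci.
have E (t : Tup) : \prod_(i < d) (((1 + tnth t i ^+ 2)^-1)%:C : C) = (lorentz (vec t))%:C.
  by rewrite -real_prod; congr (_%:C); apply: eq_bigr => i _; rewrite vecE.
split; first by move: i2; under eq_fun do rewrite E.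
move: e2; under eq_cint do rewrite E.
rewrite cint_real prodr_const cint_real card_ord e1 -rmorphXn /=.
by case.
Qed.

(** A damping factor that tends to 1 as [delta] tends to 0 and whose Fourier
    transform is the product of Poisson kernels of [cint_poisson]. *)
Definition theta (delta : R) xi : R := expR (- (delta * \sum_i `|xi 0 i|)).

Lemma thetaE delta xi : theta delta xi = \prod_i expR (- (delta * `|xi 0 i|)).
Proof.
by rewrite /theta mulr_sumr -sumrN; apply: (big_morph _ (@expRD R) (@expR0 R)).
Qed.

Lemma theta_ge0 delta xi : 0 <= theta delta xi.
Proof. exact: expR_ge0. Qed.

Lemma theta_le1 delta xi : 0 <= delta -> theta delta xi <= 1.
Proof.
move=> d0; rewrite /theta -expR0 ler_expR oppr_le0 mulr_ge0//.
by apply: sumr_ge0 => i _.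
Qed.

Lemma cint_poisson delta z : 0 < delta ->
  mu.-integrable setT (fun t : Tup => (theta delta (vec t))%:E) /\
  cint mu (fun t : Tup => (theta delta (vec t))%:C * expi (dotp z (vec t))) =
  (\prod_i (2 * delta / (delta ^+ 2 + z 0 i ^+ 2)))%:C.
Proof.
move=> d0.
have H (w : E) : cintegrable mu (fun t : Tup => (theta delta (vec t))%:C * expi (dotp w (vec t))) /\
  cint mu (fun t : Tup => (theta delta (vec t))%:C * expi (dotp w (vec t))) =
  (\prod_i (2 * delta / (delta ^+ 2 + w 0 i ^+ 2)))%:C.
  have [] := cint_tuple_prod (fun i => (cint_poisson1 (w 0 i) d0).1).
  rewrite (eq_bigr _ (fun i _ => (cint_poisson1 (w 0 i) d0).2)) -real_prod.
  have E (t : Tup) : \prod_(i < d) ((expR (- (delta * `|tnth t i|)))%:C * expi (w 0 i * tnth t i)) =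
     (theta delta (vec t))%:C * expi (dotp w (vec t)).
    rewrite big_split/= thetaE real_prod expi_dotp; congr (_ * _);
    by apply: eq_bigr => i _; rewrite vecE.
  by rewrite (funext E).
split; last by have [] := H z.
have [/integrable_cmod i0 _] := H 0.
move: i0; apply: eq_integrable => // t _.
by rewrite cmodM cmod_expi mulr1 cmod_real ger0_norm ?theta_ge0.
Qed.

Lemma measurable_lorentz : measurable_fun setT (fun t : Tup => lorentz (vec t)).
Proof. by have [/measurable_int/measurable_EFinP] := integrable_lorentz_vec. Qed.

Definition compactly_supported f :=
  continuous (f : E -> (C : numFieldType)) /\ compact (supp f).

Lemma notin_supp f x : ~ supp f x -> f x = 0.
Proof.
move=> nx; apply: contra_notP nx => /eqP fx.
by apply: subset_closure => /=.
Qed.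

Lemma compact_lorentz (K : set E) : compact K ->
  exists2 m : R, 0 < m & forall x, K x -> m <= lorentz x.
Proof.
move=> /compact_bounded[B [_ hB]].
pose b : R := `|B| + 1.
have Bb : B < b by rewrite (le_lt_trans (ler_norm _))// ltrDl.
have b0 : 0 <= b by rewrite addr_ge0.
exists (\prod_(i < d) (1 + b ^+ 2)^-1).
  by apply: prodr_gt0 => i _; rewrite invr_gt0 ltr_pwDl ?sqr_ge0.
move=> x Kx; apply: ler_prod => i _.
rewrite invr_ge0 addr_ge0 ?sqr_ge0//= lef_pV2 ?posrE ?ltr_pwDl ?sqr_ge0//.
rewrite lerD2l -(real_normK (num_real (x 0 i))) ler_pXn2r ?nnegrE//.
have := hB b Bb x Kx; rewrite /= /Num.norm/= mx_normrE; apply: le_trans.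
by have := @le_bigmax _ R _ 0 (fun ij : 'I_1 * 'I_d => `|x ij.1 ij.2|) (0, i).
Qed.

Lemma compactly_supported_bounded f : compactly_supported f ->
  exists2 M : R, 0 <= M & forall x, cmod (f x) <= M.
Proof.
move=> [cf kf].
have [s0|/set0P ns0] := eqVneq (supp f) set0.
  exists 0 => // x; rewrite notin_supp ?cmod0//.
  by rewrite s0.
have [c cs hc] := @EVT_max_rV R d (fun x => cmod (f x)) (supp f) ns0 kf
  (continuous_subspaceT (continuous_cmod cf)).
exists (cmod (f c)); first exact: cmod_ge0.
move=> x; have [sx|nsx] := pselect (supp f x).
  by apply: hc; rewrite inE.
by rewrite (notin_supp nsx) cmod0 cmod_ge0.
Qed.

Lemma compactly_supported_lorentz f : compactly_supported f ->
  exists2 M : R, 0 <= M & forall x, cmod (f x) <= M * lorentz x.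
Proof.
move=> cf; have [M M0 hM] := compactly_supported_bounded cf.
have [m m0 hm] := compact_lorentz cf.2.
exists (M / m); first by rewrite divr_ge0// ltW.
move=> x; have [sx|nsx] := pselect (supp f x).
  rewrite (le_trans (hM x))// -mulrA ler_peMr// mulrC ler_pdivlMr// mul1r.
  exact: hm.
by rewrite (notin_supp nsx) cmod0 mulr_ge0 ?divr_ge0// ltW// lorentz_gt0.
Qed.

Lemma integrable_scaled_lorentz (M : R) :
  mu.-integrable setT (fun t : Tup => (M * lorentz (vec t))%:E).
Proof.
have [i1 _] := integrable_lorentz_vec.
by under eq_fun do rewrite EFinM; exact: integrableZl.
Qed.

Lemma compactly_supported_integrable f : compactly_supported f ->
  cintegrable mu (fun t : Tup => f (vec t)).
Proof.
move=> cf; have [M _ hM] := compactly_supported_lorentz cf.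
exact: (le_cintegrable (cmeasurable_vec cf.1) (integrable_scaled_lorentz M)).
Qed.

Lemma measurable_dotpl xi : measurable_fun setT (fun t : Tup => dotp (vec t) xi).
Proof.
apply: measurable_sum => i; apply: measurable_funM => //.
exact: measurable_coord.
Qed.

Lemma integralCE f : integralC f = cint mu (fun t : Tup => f (vec t)).
Proof. by []. Qed.

Lemma compactly_supported_mod f xi : compactly_supported f ->
  cintegrable mu (fun t : Tup => f (vec t) * expi (- dotp (vec t) xi)).
Proof.
move=> cf; have [M _ hM] := compactly_supported_lorentz cf.
apply: (le_cintegrable _ (integrable_scaled_lorentz M)).
- apply: cmeasurableM; first exact: cmeasurable_vec cf.1.
  by apply: cmeasurable_expi; apply: measurableT_comp => //; exact: measurable_dotpl.
- by move=> t; rewrite cmodM cmod_expi mulr1.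
Qed.

(** Multiplication by a strictly positive integrable function makes the kernel
    integrable on the product, and Fubini's theorem provides measurability. *)
Lemma cmeasurable_fourier f : compactly_supported f ->
  cmeasurable (fun t : Tup => fourier f (vec t)).
Proof.
move=> cf; have [M _ hM] := compactly_supported_lorentz cf.
pose F (p : Tup * Tup) : C :=
  (lorentz (vec p.1))%:C * (f (vec p.2) * expi (- dotp (vec p.2) (vec p.1))).
have mF : cmeasurable F.
  apply: cmeasurableM.
    apply: cmeasurable_real; apply: (measurableT_comp measurable_lorentz).
    exact: measurable_fst.
  apply: cmeasurableM.
    by apply: (cmeasurable_comp (f := fun t : Tup => f (vec t))) => //; exact: cmeasurable_vec cf.1.
  apply: cmeasurable_expi; apply: measurableT_comp => //.
  exact: measurable_dotp.
have [|_ mG _ _] :=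
  cint_prod_dominated (integrable_scaled_lorentz 1) (integrable_scaled_lorentz M) mF.
  move=> s t; rewrite /F/= !cmodM cmod_expi mulr1 cmod_real mul1r.
  by rewrite gtr0_norm ?lorentz_gt0// ler_wpM2l// ltW// lorentz_gt0.
have : cmeasurable (fun t : Tup => ((lorentz (vec t))^-1)%:C * cint mu (fun s => F (t, s))).
  apply: cmeasurableM => //; apply: cmeasurable_real.
  under eq_fun do rewrite -prodfV; under eq_fun do under eq_bigr do rewrite invrK.
  apply: measurable_prod => i _; apply: measurable_funD => //.
  by apply: measurable_funX; exact: measurable_coord.
congr cmeasurable; apply/funext => t.
rewrite /F/= cintZ; last exact: compactly_supported_mod.
by rewrite mulrA -rmorphM mulVf ?mul1r// lt0r_neq0// lorentz_gt0.
Qed.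

Lemma clim_unique (u : nat -> C) (a b : C) :
  cmod (u n - a) @[n --> \oo] --> 0 -> cmod (u n - b) @[n --> \oo] --> 0 -> a = b.
Proof.
move=> ua ub; apply/eqP; rewrite -subr_eq0; apply/eqP/cmod_eq0.
apply/eqP; rewrite eq_le cmod_ge0 andbT.
apply/ler_addgt0Pl => e e0; rewrite addr0.
have e2 : 0 < e / 2 by rewrite divr_gt0.
near \oo => n.
have ha : cmod (u n - a) < e / 2.
  near: n; move/cvgrPdist_lt : ua => /(_ _ e2); apply: filterS => n.
  by rewrite sub0r normrN ger0_norm ?cmod_ge0.
have hb : cmod (u n - b) < e / 2.
  near: n; move/cvgrPdist_lt : ub => /(_ _ e2); apply: filterS => n.
  by rewrite sub0r normrN ger0_norm ?cmod_ge0.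
have -> : a - b = - (u n - a) + (u n - b) by ring.
by rewrite (le_trans (cmodD _ _))// cmodN (splitr e) lerD// ltW.
Unshelve. all: by end_near. Qed.

End FourierInversion.

Section FourierInversionTheorem.
Context {R : realType} {d : nat}.
Local Notation C := R[i].
Local Notation E := 'rV[R]_d.
Local Notation Tup := (d.-tuple (measurableTypeR R)).
Local Notation mu := (@lebesgue_tuple R d).
Implicit Types (x y z xi : E) (f g : E -> C).

Lemma measurable_theta delta : measurable_fun setT (fun t : Tup => theta delta (vec t)).
Proof.
apply: measurableT_comp => //; apply: measurableT_comp => //.
apply: measurable_funM => //; apply: measurable_sum => i.
by apply: measurableT_comp => //; exact: measurable_coord.
Qed.

Lemma vec_affine_tuple x (c : R) (t : Tup) :
  vec (affine_tuple (fun i => x 0 i) c t) = x + c *: vec t.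
Proof. by apply/rowP => i; rewrite !mxE tnth_mktuple. Qed.

Lemma poisson_le (delta r : R) : 0 < delta ->
  `|2 * delta / (delta ^+ 2 + r ^+ 2)| <= 2 / delta.
Proof.
move=> d0; have D0 : 0 < delta ^+ 2 + r ^+ 2.
  by apply: ltr_pwDl; [exact: exprn_gt0|exact: sqr_ge0].
rewrite ger0_norm; last by rewrite divr_ge0 ?mulr_ge0 ?ltW.
rewrite ler_pdivrMr// mulrAC -mulrA ler_pM2l//.
by rewrite ler_pdivlMr// -expr2 lerDl sqr_ge0.
Qed.

Lemma poisson_scaled (delta x s : R) : 0 < delta ->
  delta * (2 * delta / (delta ^+ 2 + (x - (x + delta * s)) ^+ 2)) =
  2 * (1 + s ^+ 2)^-1.
Proof.
move=> d0; rewrite opprD addrA subrr sub0r sqrrN.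
have s1 : 1 + s ^+ 2 != 0 by rewrite lt0r_neq0// ltr_pwDl ?sqr_ge0.
have dn : delta != 0 by exact: lt0r_neq0.
have -> : delta ^+ 2 + (delta * s) ^+ 2 = delta ^+ 2 * (1 + s ^+ 2) by ring.
by field; rewrite s1 dn.
Qed.

(** Fubini's theorem turns the Fourier integral damped by [theta] into a
    Poisson mean of [f] around [x]. *)
Lemma damped_inversion f x delta : compactly_supported f -> 0 < delta ->
  cint mu (fun t : Tup => (fourier f (vec t) * expi (dotp x (vec t))) * (theta delta (vec t))%:C) =
  cint mu (fun t : Tup => f (x + delta *: vec t) * (2 ^+ d * lorentz (vec t))%:C).
Proof.
move=> cf d0; have [M _ hM] := compactly_supported_lorentz cf.
have dn : delta != 0 by exact: lt0r_neq0.
have [th _] := cint_poisson (0 : E) d0.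
pose F (p : Tup * Tup) : C := (theta delta (vec p.1))%:C * expi (dotp x (vec p.1)) *
  (f (vec p.2) * expi (- dotp (vec p.2) (vec p.1))).
have mxp : measurable_fun setT (fun t : Tup => dotp x (vec t)).
  by under eq_fun do rewrite dotpC; exact: measurable_dotpl.
have mF : cmeasurable F.
  apply: cmeasurableM; last first.
    apply: cmeasurableM.
      apply: (cmeasurable_comp (f := fun t : Tup => f (vec t))) => //.
      exact: cmeasurable_vec cf.1.
    apply: cmeasurable_expi; apply: measurableT_comp => //.
    exact: measurable_dotp.
  apply: cmeasurableM.
    by apply: cmeasurable_real; apply: (measurableT_comp (measurable_theta delta)).
  by apply: cmeasurable_expi; apply: (measurableT_comp mxp).
have [|_ _ _ fub] := cint_prod_dominated th (integrable_scaled_lorentz M) mF.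
  move=> s t; rewrite /F/= !cmodM !cmod_expi !mulr1 cmod_real.
  by rewrite ger0_norm ?theta_ge0// ler_wpM2l// theta_ge0.
transitivity (cint mu (fun t => cint mu (fun s => F (t, s)))).
  apply: eq_cint => t; rewrite /F/= cintZ; last exact: compactly_supported_mod.
  by rewrite /fourier integralCE mulrC mulrA mulrAC -mulrA mulrC.
rewrite fub.
transitivity (cint mu (fun s : Tup => f (vec s) *
    (\prod_i (2 * delta / (delta ^+ 2 + (x - vec s) 0 i ^+ 2)))%:C)).
  apply: eq_cint => s; rewrite /F/=.
  have [i1 e1] := cint_poisson (x - vec s) d0.
  rewrite -e1 -cintZ; last first.
    apply: (le_cintegrable _ i1).
      apply: cmeasurableM; first exact: (cmeasurable_real (measurable_theta delta)).
      apply: cmeasurable_expi; under eq_fun do rewrite dotpC.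
      exact: measurable_dotpl.
    by move=> t; rewrite cmodM cmod_expi mulr1 cmod_real ger0_norm ?theta_ge0.
  apply: eq_cint => t; rewrite dotpDl dotpNl expiD; ring.
have cst (c : R) : c ^+ d = \prod_(i < d) c by rewrite prodr_const card_ord.
rewrite (cint_affine (fun i => x 0 i) d0); last first.
  apply: (le_cintegrable _ (integrable_scaled_lorentz ((2 / delta) ^+ d * M))).
    apply: cmeasurableM; first exact: cmeasurable_vec cf.1.
    apply: cmeasurable_real; apply: measurable_prod => i _.
    have D0 (r : R) : 0 < delta ^+ 2 + r ^+ 2.
      by apply: ltr_pwDl; [exact: exprn_gt0|exact: sqr_ge0].
    have ch : continuous (fun r : R => 2 * delta / (delta ^+ 2 + r ^+ 2) : R).
      move=> r; apply: cvgM; first exact: cvg_cst.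
      apply: (@cvgV _ _ _ _ (fun y : R => delta ^+ 2 + y ^+ 2)).
        exact: lt0r_neq0 (D0 r).
      by apply: cvgD; [exact: cvg_cst|exact: exprn_continuous].
    have mxi : measurable_fun setT (fun t : Tup => x 0 i - tnth t i).
      apply: measurable_funB; first exact: measurable_cst.
      exact: measurable_tnth.
    under eq_fun do rewrite !mxE.
    exact: (measurableT_comp (continuous_measurable_fun ch) mxi).
  move=> s; rewrite cmodM cmod_real -mulrA mulrC; apply: ler_pM.
  - exact: normr_ge0.
  - exact: cmod_ge0.
  - rewrite normr_prod cst; apply: ler_prod => i _.
    by rewrite normr_ge0 poisson_le.
  - exact: hM.
apply: eq_cint => t; rewrite vec_affine_tuple mulrCA -rmorphM; congr (_ * _%:C).
rewrite /lorentz !cst -!big_split/=; apply: eq_bigr => i _.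
by rewrite !mxE poisson_scaled.
Qed.

(** Let the damping in [damped_inversion] tend to 0.  The left-hand side converges
    because the Fourier transform is integrable; the right-hand side, a mean of
    [f] with total mass [(2 * pi) ^+ d], concentrates at [x]. *)
Theorem fourier_inversion f x : compactly_supported f ->
  cintegrable mu (fun t : Tup => fourier f (vec t)) ->
  cint mu (fun t : Tup => fourier f (vec t) * expi (dotp x (vec t))) =
  ((2 * pi) ^+ d)%:C * f x.
Proof.
move=> cf ifh.
have [M M0 hM] := compactly_supported_bounded cf.
pose dl (n : nat) : R := n.+1%:R^-1.
have dl0 n : 0 < dl n by rewrite invr_gt0.
have dlcvg (c : R) : dl n * c @[n --> \oo] --> 0.
  rewrite -[X in _ --> X](mul0r c); apply: cvgM; last exact: cvg_cst.
  exact: cvg_harmonic.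
pose J n := cint mu (fun t : Tup =>
  (fourier f (vec t) * expi (dotp x (vec t))) * (theta (dl n) (vec t))%:C).
have mxp : measurable_fun setT (fun t : Tup => dotp x (vec t)).
  by under eq_fun do rewrite dotpC; exact: measurable_dotpl.
have mG : cmeasurable (fun t : Tup => fourier f (vec t) * expi (dotp x (vec t))).
  by apply: cmeasurableM; [exact: cintegrable_measurable ifh|exact: cmeasurable_expi].
apply: (@clim_unique _ J).
- apply: (cdominated_cvg _ mG (integrable_cmod ifh) _ _).2.
  + move=> n; apply: cmeasurableM => //; exact: (cmeasurable_real (measurable_theta (dl n))).
  + move=> n t; rewrite !cmodM cmod_expi mulr1 cmod_real ger0_norm ?theta_ge0//.
    by rewrite ler_piMr ?cmod_ge0// theta_le1// ltW.
  + move=> t; set g := (fourier f _ * _); set S := \sum_i `|vec t 0 i|.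
    have -> : (fun n => cmod (g * (theta (dl n) (vec t))%:C - g)) =
        (fun n => cmod g * `|theta (dl n) (vec t) - 1|).
      apply/funext => n; rewrite -{2}(mulr1 g) -mulrBr cmodM; congr (_ * _).
      by rewrite -cmod_real rmorphB.
    rewrite -[X in _ --> X](mulr0 (cmod g)); apply: cvgM; first exact: cvg_cst.
    apply/norm_cvg0P/subr_cvg0.
    rewrite -[X in _ --> X](@expR0 R) -[X in expR X]oppr0.
    apply: continuous_cvg; first exact: continuous_expR.
    by apply: cvgN; exact: dlcvg.
- have [iP eP] := @integrable_lorentz_vec R d.
  have -> : ((2 * pi) ^+ d)%:C * f x =
      cint mu (fun t : Tup => f x * (2 ^+ d * lorentz (vec t))%:C).
    rewrite cintZ; last first.
      by split => /=; [exact: integrable_scaled_lorentz|exact: integrable0].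
    rewrite cint_real mulrC; congr (_ * _%:C).
    by rewrite RintegralZl// eP exprMn.
  have mL : cmeasurable (fun t : Tup => (2 ^+ d * lorentz (vec t))%:C).
    by apply: cmeasurable_real; apply: measurable_funM => //; exact: measurable_lorentz.
  have -> : J = (fun n => cint mu (fun t : Tup =>
      f (x + dl n *: vec t) * (2 ^+ d * lorentz (vec t))%:C)).
    by apply/funext => n; exact: damped_inversion.
  apply: (cdominated_cvg _ _ (integrable_scaled_lorentz (M * 2 ^+ d)) _ _).2.
  + move=> n; apply: cmeasurableM => //.
    under eq_fun do rewrite -vec_affine_tuple.
    apply: (cmeasurable_comp (f := fun t : Tup => f (vec t))); last exact: cmeasurable_vec cf.1.
    exact: measurable_affine_tuple.
  + by apply: cmeasurableM => //; exact: cmeasurable_cst.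
  + move=> n t; rewrite cmodM cmod_real -mulrA ger0_norm; last first.
      by rewrite mulr_ge0 ?exprn_ge0// ltW// lorentz_gt0.
    by rewrite ler_wpM2r// mulr_ge0 ?exprn_ge0// ltW// lorentz_gt0.
  + move=> t; have /continuousC_rVP cc := cf.1.
    set b := (_)%:C.
    have -> : (fun n => cmod (f (x + dl n *: vec t) * b - f x * b)) =
        (fun n => cmod (f (x + dl n *: vec t) - f x) * cmod b).
      by apply/funext => n; rewrite -mulrBl cmodM.
    rewrite -[X in _ --> X](mul0r (cmod b)); apply: cvgM; last exact: cvg_cst.
    apply/cvgrPdist_lt => e /(cc x)[eta eta0 he].
    have near_eta i : \forall n \near \oo, `|dl n * vec t 0 i| < eta.
      have /cvgrPdist_lt/(_ _ eta0) := dlcvg (vec t 0 i).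
      by apply: filterS => n; rewrite sub0r normrN.
    have : \forall n \near \oo, forall i, `|dl n * vec t 0 i| < eta by exact: filter_forall.
    apply: filterS => n hn; rewrite sub0r normrN ger0_norm ?cmod_ge0// cmod_distC.
    by apply: he => i; rewrite !mxE opprD addrA subrr sub0r normrN; have := hn i; rewrite mxE.
Qed.

End FourierInversionTheorem.

(** * Weights *)

Section Weights.
Context {R : realType}.
Variable w : R -> R.
Hypothesis hw : weight_class w.

(** The condition at infinity says that [expR (w t)] dominates every power of
    [1 + t]; on a bounded interval a constant suffices. *)
Lemma weight_growth (A : R) : 0 <= A ->
  exists2 B : R, 0 < B & forall t, 0 <= t -> expR (A * ln (1 + t)) <= B * expR (w t).
Proof.
move=> A0; have /cvgryPge/(_ A)[t0 [_ ht0]] := weight_log hw.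
pose t1 := `|t0| + 1.
have t10 : 0 < t1 by apply: ltr_pwDr.
exists (expR (A * ln (1 + t1))); first exact: expR_gt0.
move=> t t0'; rewrite -expRD ler_expR.
have w0 := weight_ge0 hw t0'.
have [tt1|tt1] := leP t t1.
  rewrite -[leLHS]addr0 lerD// ler_wpM2l// ler_ln ?posrE ?ltr_pwDl// ?lerD2l//.
  exact: ltW.
have lt0 : t0 < t.
  by rewrite (le_lt_trans _ tt1)// (le_trans (ler_norm _))// /t1 lerDl.
have tp : 0 < t by rewrite (lt_trans t10).
have := ht0 t lt0; rewrite ler_pdivlMr ?ln_gt0 ?ltrDl// => h.
rewrite -[leLHS]add0r lerD// mulr_ge0// ln_ge0// lerDl.
exact: ltW.
Qed.

(** Extended by [w 0] to the negative half-line, the weight is monotone. *)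
Lemma measurable_weight : measurable_fun setT (fun t : R => w (Num.max t 0)).
Proof.
apply: nondecreasing_measurable => // s t st.
apply: (weight_nondecreasing hw).
  by rewrite le_max lexx orbT.
by rewrite ge_max le_max st/= le_max lexx orbT.
Qed.

Context {d : nat}.
Local Notation C := R[i].
Local Notation E := 'rV[R]_d.
Local Notation Tup := (d.-tuple (measurableTypeR R)).
Local Notation mu := (@lebesgue_tuple R d).

Lemma weight_enorm_ge0 (x : E) : 0 <= w (enorm x).
Proof. exact: weight_ge0 hw _ (enorm_ge0 _). Qed.

Lemma weight_enormD (x y : E) : w (enorm (x + y)) <= w (enorm x) + w (enorm y).
Proof.
apply: le_trans (weight_subadditive hw (enorm_ge0 x) (enorm_ge0 y)).
exact: (weight_nondecreasing hw (enorm_ge0 _) (enormD _ _)).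
Qed.

Lemma measurable_weight_vec (l : R) :
  measurable_fun setT (fun t : Tup => expR (l * w (enorm (vec t)))).
Proof.
apply: measurableT_comp => //; apply: measurable_funM => //.
have -> : (fun t : Tup => w (enorm (vec t))) = (fun t => w (Num.max (enorm (vec t)) 0)).
  by apply/funext => t; rewrite max_l ?enorm_ge0.
exact: (measurableT_comp measurable_weight measurable_enorm).
Qed.

(** Each factor [1 + x_i^2] is at most [(1 + |x|)^2], and powers of [1 + |x|] are
    dominated by the exponential of the weight. *)
Lemma exp_weight_lorentz :
  exists2 B : R, 0 < B & forall x : E, expR (- w (enorm x)) <= B * lorentz x.
Proof.
have [B B0 hB] := weight_growth (ler0n R (2 * d)).
exists B => // x; have := hB (enorm x) (enorm_ge0 x).
have n0 : 0 < 1 + enorm x by apply: ltr_pwDl => //; exact: enorm_ge0.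
rewrite expRM_natl lnK ?posrE// exprM => h.
have : \prod_(i < d) (1 + x 0 i ^+ 2) <= ((1 + enorm x) ^+ 2) ^+ d.
  rewrite -[X in _ ^+ X](card_ord d) -prodr_const; apply: ler_prod => i _.
  rewrite addr_ge0 ?sqr_ge0//= sqrrD expr1n mul1r -addrA lerD2l.
  rewrite -[leLHS]add0r lerD// ?mulrn_wge0 ?enorm_ge0//.
  rewrite -(real_normK (num_real (x 0 i))) ler_pXn2r ?nnegrE ?enorm_ge0//.
  exact: coord_le_enorm.
have p0 : 0 < \prod_(i < d) (1 + x 0 i ^+ 2).
  by apply: prodr_gt0 => i _; rewrite ltr_pwDl ?sqr_ge0.
move=> /le_trans/(_ h) h2; rewrite /lorentz prodfV expRN ler_pdivlMr// mulrC.
by rewrite ler_pdivrMr ?expR_gt0.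
Qed.

End Weights.

(** * The weighted norms *)

Section CompactSupport.
Context {R : realType} {d : nat}.
Local Notation C := R[i].
Local Notation E := 'rV[R]_d.
Local Notation Tup := (d.-tuple (measurableTypeR R)).
Local Notation mu := (@lebesgue_tuple R d).
Implicit Types (x y z xi : E) (f g : E -> C) (K : set E).

Lemma rV_hausdorff : hausdorff_space E.
Proof. exact: norm_hausdorff. Qed.

Lemma supp_subset f K : compact K -> (forall x, ~ K x -> f x = 0) -> supp f `<=` K.
Proof.
move=> cK fK; have clK : closed K by exact: (compact_closed rV_hausdorff cK).
rewrite ((closure_id K).1 clK); apply: closure_subset => x /=.
by move=> /eqP fx; apply: contra_notP fx; exact: fK.
Qed.

Lemma compact_supp_subset f K : compact K -> supp f `<=` K -> compact (supp f).
Proof. by move=> cK; apply: subclosed_compact => //; exact: closed_closure. Qed.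

Lemma continuousCM f g : continuous (f : E -> (C : numFieldType)) ->
  continuous (g : E -> (C : numFieldType)) ->
  continuous ((fun x => f x * g x) : E -> (C : numFieldType)).
Proof.
move=> cf cg.
have [f1 f2] := (continuous_Re cf, continuous_Im cf).
have [g1 g2] := (continuous_Re cg, continuous_Im cg).
apply: continuousC_ReIm => x.
- rewrite (_ : (fun y => complex.Re (f y * g y)) = (fun y : E =>
    complex.Re (f y) * complex.Re (g y) - complex.Im (f y) * complex.Im (g y))).
    exact: (cvgB (cvgM (f1 x) (g1 x)) (cvgM (f2 x) (g2 x))).
  by apply/funext => y; rewrite Re_mul.
- rewrite (_ : (fun y => complex.Im (f y * g y)) = (fun y : E =>
    complex.Re (f y) * complex.Im (g y) + complex.Im (f y) * complex.Re (g y))).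
    exact: (cvgD (cvgM (f1 x) (g2 x)) (cvgM (f2 x) (g1 x))).
  by apply/funext => y; rewrite Im_mul.
Qed.

Lemma continuousCD f g : continuous (f : E -> (C : numFieldType)) ->
  continuous (g : E -> (C : numFieldType)) ->
  continuous ((fun x => f x + g x) : E -> (C : numFieldType)).
Proof.
move=> cf cg.
have [f1 f2] := (continuous_Re cf, continuous_Im cf).
have [g1 g2] := (continuous_Re cg, continuous_Im cg).
apply: continuousC_ReIm => x.
- rewrite (_ : (fun y => complex.Re (f y + g y)) =
    (fun y : E => complex.Re (f y) + complex.Re (g y))).
    exact: (cvgD (f1 x) (g1 x)).
  by apply/funext => y; rewrite Re_add.
- rewrite (_ : (fun y => complex.Im (f y + g y)) =
    (fun y : E => complex.Im (f y) + complex.Im (g y))).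
    exact: (cvgD (f2 x) (g2 x)).
  by apply/funext => y; rewrite Im_add.
Qed.

Lemma continuousC_cst (c : C) : continuous ((fun=> c) : E -> (C : numFieldType)).
Proof.
by apply/continuousC_rVP => x e e0; exists 1 => // y _; rewrite subrr cmod0.
Qed.

Lemma continuousC_expi (xi : E) :
  continuous ((fun x => expi (dotp x xi)) : E -> (C : numFieldType)).
Proof.
have cd : continuous (fun x : E => dotp x xi).
  move=> x; apply: (@cvg_big R^o 'I_d +%R 0 xpredT _ E (nbhs x)).
    exact: add_continuous.
  move=> i _; apply: (cvgM (@coord_continuous R 1 d 0 i x)).
  exact: cvg_cst.
apply: continuousC_ReIm => x /=.
- by apply: (continuous_comp (cd x)); exact: continuous_cos.
- by apply: (continuous_comp (cd x)); exact: continuous_sin.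
Qed.

Lemma compactly_supportedM f g : compactly_supported f ->
  continuous (g : E -> (C : numFieldType)) -> compactly_supported (fun x => f x * g x).
Proof.
move=> [cf kf] cg; split; first exact: (continuousCM cf cg).
apply: (compact_supp_subset kf); apply: supp_subset => // x nx.
by rewrite (notin_supp nx) mul0r.
Qed.

Lemma compactly_supportedD f g : compactly_supported f -> compactly_supported g ->
  compactly_supported (fun x => f x + g x).
Proof.
move=> [cf kf] [cg kg]; split; first exact: (continuousCD cf cg).
have kU : compact (supp f `|` supp g) by exact: compactU.
apply: (compact_supp_subset kU); apply: supp_subset => // x nx.
by rewrite !notin_supp ?addr0// => h; apply: nx; [right|left].
Qed.

Lemma compactly_supportedZ (c : C) f : compactly_supported f ->
  compactly_supported (fun x => c * f x).
Proof.
move=> [cf kf]; split; first exact: (continuousCM (@continuousC_cst c)).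
apply: (compact_supp_subset kf); apply: supp_subset => // x nx.
by rewrite (notin_supp nx) mulr0.
Qed.

Lemma compactly_supportedB f g : compactly_supported f -> compactly_supported g ->
  compactly_supported (fun x => f x - g x).
Proof.
move=> cf cg; have := compactly_supportedD cf (compactly_supportedZ (-1) cg).
by congr compactly_supported; apply/funext => x; rewrite mulN1r.
Qed.

Lemma fourierD f g xi : compactly_supported f -> compactly_supported g ->
  fourier (fun x => f x + g x) xi = fourier f xi + fourier g xi.
Proof.
move=> cf cg; rewrite /fourier !integralCE.
rewrite -cintD; [|exact: compactly_supported_mod..].
by apply: eq_cint => t; rewrite mulrDl.
Qed.

Lemma fourierZ (c : C) f xi : compactly_supported f ->
  fourier (fun x => c * f x) xi = c * fourier f xi.
Proof.
move=> cf; rewrite /fourier !integralCE.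
rewrite -cintZ; last exact: compactly_supported_mod.
by apply: eq_cint => t; rewrite mulrA.
Qed.

Lemma fourier_modulation f xi eta :
  fourier (fun x => f x * expi (dotp x eta)) xi = fourier f (xi - eta).
Proof.
rewrite /fourier !integralCE; apply: eq_cint => t.
by rewrite -mulrA -expiD; congr (_ * expi _); rewrite dotpDr dotpNr; ring.
Qed.

(** A multiple of [lorentz] dominates the indicator function of [K]; its integral
    plays the part of the volume of [K]. *)
Lemma cint_supported_le K : compact K -> exists2 V : R, 0 <= V &
  forall (h : E -> C) (e : R), cmeasurable (fun t : Tup => h (vec t)) -> 0 <= e ->
    (forall x, ~ K x -> h x = 0) -> (forall x, cmod (h x) <= e) ->
    cmod (integralC h) <= e * V.
Proof.
move=> /compact_lorentz[m m0 hm].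
have [iP eP] := @integrable_lorentz_vec R d.
exists (m^-1 * pi ^+ d).
  by rewrite mulr_ge0 ?invr_ge0 ?(ltW m0)// exprn_ge0// pi_ge0.
move=> h e mh e0 hK he; rewrite integralCE.
have hle (t : Tup) : cmod (h (vec t)) <= (e * m^-1) * lorentz (vec t).
  have [Kx|nKx] := pselect (K (vec t)).
    rewrite (le_trans (he _))// -mulrA ler_peMr// mulrC ler_pdivlMr// mul1r.
    exact: hm.
  rewrite (hK _ nKx) cmod0 mulr_ge0//; last exact: ltW (lorentz_gt0 _).
  by rewrite mulr_ge0// invr_ge0 ltW.
have ih : cintegrable mu (fun t : Tup => h (vec t)).
  exact: (le_cintegrable mh (integrable_scaled_lorentz _)).
rewrite (le_trans (cmod_cint_le ih (integrable_scaled_lorentz _) hle))//.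
by rewrite RintegralZl// eP mulrA.
Qed.

End CompactSupport.

Section WeightedNorms.
Context {R : realType} {d : nat}.
Variable w : R -> R.
Hypothesis hw : weight_class w.
Local Notation C := R[i].
Local Notation E := 'rV[R]_d.
Local Notation Tup := (d.-tuple (measurableTypeR R)).
Local Notation mu := (@lebesgue_tuple R d).
Implicit Types (x y z xi eta : E) (f g psi : E -> C) (l : R).

Lemma wnormE l f : wnorm w l f =
  (\int[mu]_t (cmod (fourier f (vec t)) * expR (l * w (enorm (vec t))))%:E)%E.
Proof. by []. Qed.

Lemma wnorm_ge0 l f : (0 <= wnorm w l f)%E.
Proof. by apply: integral_ge0 => t _; rewrite lee_fin mulr_ge0 ?cmod_ge0 ?expR_ge0. Qed.

Lemma measurable_wnorm l f : compactly_supported f -> measurable_fun setT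
  (fun t : Tup => (cmod (fourier f (vec t)) * expR (l * w (enorm (vec t))))%:E).
Proof.
move=> cf; apply/measurable_EFinP; apply: measurable_funM.
  exact: (cmeasurable_cmod (cmeasurable_fourier cf)).
exact: (measurable_weight_vec hw).
Qed.

Lemma wnormD l f g : compactly_supported f -> compactly_supported g ->
  (wnorm w l (fun x => f x + g x)%R <= wnorm w l f + wnorm w l g)%E.
Proof.
move=> cf cg; rewrite !wnormE -ge0_integralD//; last first.
- exact: measurable_wnorm.
- by move=> t _; rewrite lee_fin mulr_ge0 ?cmod_ge0 ?expR_ge0.
- exact: measurable_wnorm.
- by move=> t _; rewrite lee_fin mulr_ge0 ?cmod_ge0 ?expR_ge0.
apply: ge0_le_integral => //.
- by move=> t _; rewrite lee_fin mulr_ge0 ?cmod_ge0 ?expR_ge0.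
- exact: (measurable_wnorm _ (compactly_supportedD cf cg)).
- by apply: emeasurable_funD; exact: measurable_wnorm.
- move=> t _; rewrite -EFinD lee_fin -mulrDl ler_wpM2r ?expR_ge0//.
  by rewrite fourierD// cmodD.
Qed.

Lemma wnormZ l (c : C) f : compactly_supported f ->
  wnorm w l (fun x => c * f x) = ((cmod c)%:E * wnorm w l f)%E.
Proof.
move=> cf; rewrite !wnormE -ge0_integralZl//.
- by apply: eq_integral => t _; rewrite fourierZ// cmodM -EFinM mulrA.
- exact: measurable_wnorm.
- by move=> t _; rewrite lee_fin mulr_ge0 ?cmod_ge0 ?expR_ge0.
- by rewrite lee_fin cmod_ge0.
Qed.

Lemma integrable_wnorm l f : compactly_supported f -> (wnorm w l f < +oo)%E ->
  mu.-integrable setT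
    (fun t : Tup => (cmod (fourier f (vec t)) * expR (l * w (enorm (vec t))))%:E).
Proof.
move=> cf foo; apply/integrableP; split; first exact: measurable_wnorm.
under eq_integral => t _.
  rewrite /= ger0_norm; last by rewrite mulr_ge0 ?cmod_ge0 ?expR_ge0.
  over.
exact: foo.
Qed.

Lemma wnorm_fourier_integrable l f : 0 <= l -> compactly_supported f ->
  (wnorm w l f < +oo)%E -> cintegrable mu (fun t : Tup => fourier f (vec t)).
Proof.
move=> l0 cf foo.
apply: (le_cintegrable (cmeasurable_fourier cf) (integrable_wnorm cf foo)) => t.
rewrite ler_peMr ?cmod_ge0// -expR0 ler_expR mulr_ge0//.
exact: (weight_enorm_ge0 hw).
Qed.

Lemma pow2pi_neq0 : (2 * pi) ^+ d != 0 :> R.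
Proof.
by apply: expf_neq0; apply: lt0r_neq0; apply: mulr_gt0 => //; exact: pi_gt0.
Qed.

Definition inv2pi : R := ((2 * pi) ^+ d)^-1.

Lemma inv2pi_gt0 : 0 < inv2pi.
Proof. by rewrite invr_gt0 exprn_gt0// mulr_gt0// pi_gt0. Qed.

Lemma inv2piK : inv2pi%:C * ((2 * pi) ^+ d)%:C = 1 :> C.
Proof. by rewrite -rmorphM mulVf ?pow2pi_neq0. Qed.

Lemma fourier_inversionV l f x : 0 <= l -> compactly_supported f ->
  (wnorm w l f < +oo)%E ->
  f x = inv2pi%:C * cint mu (fun t : Tup => fourier f (vec t) * expi (dotp x (vec t))).
Proof.
move=> l0 cf foo; rewrite fourier_inversion//; last exact: (wnorm_fourier_integrable l0).
by rewrite mulrA inv2piK mul1r.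
Qed.

(** By inversion, the uniform norm is at most the integral of the modulus of the
    Fourier transform, and the exponential weights are at least 1. *)
Lemma cmod_le_wnorm l f x : 0 <= l -> compactly_supported f ->
  ((cmod (f x))%:E <= inv2pi%:E * wnorm w l f)%E.
Proof.
move=> l0 cf; have [foo|] := ltP (wnorm w l f) +oo%E; last first.
  by rewrite leye_eq => /eqP ->; rewrite gt0_muley ?leey// lte_fin inv2pi_gt0.
have fi := wnorm_fourier_integrable l0 cf foo.
have mx : measurable_fun setT (fun t : Tup => dotp x (vec t)).
  by under eq_fun do rewrite dotpC; exact: measurable_dotpl.
have fie : cintegrable mu (fun t : Tup => fourier f (vec t) * expi (dotp x (vec t))).
  apply: (le_cintegrable _ (integrable_cmod fi)).
  - apply: cmeasurableM; [exact: cmeasurable_fourier|exact: cmeasurable_expi].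
  - by move=> t; rewrite cmodM cmod_expi mulr1.
rewrite (fourier_inversionV x l0 cf foo) cmodM cmod_real gtr0_norm ?inv2pi_gt0//.
rewrite EFinM lee_wpmul2l ?lee_fin ?(ltW inv2pi_gt0)//.
rewrite (le_trans (cmod_cint fie))//; apply: ge0_le_integral => //.
- by move=> t _; rewrite lee_fin cmod_ge0.
- by apply/measurable_EFinP/cmeasurable_cmod; exact: cintegrable_measurable fie.
- exact: measurable_wnorm.
- move=> t _; rewrite lee_fin cmodM cmod_expi mulr1 ler_peMr ?cmod_ge0//.
  rewrite -expR0 ler_expR mulr_ge0//; exact: (weight_enorm_ge0 hw).
Qed.

Definition translate_tuple (eta : E) : Tup -> Tup :=
  affine_tuple (fun i => - eta 0 i) 1.

Lemma measurable_translate_tuple eta : measurable_fun setT (translate_tuple eta).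
Proof. exact: measurable_affine_tuple. Qed.

Lemma ge0_integral_translate (F : Tup -> \bar R) (eta : E) :
  measurable_fun setT F -> (forall t, 0 <= F t)%E ->
  (\int[mu]_t F (translate_tuple eta t) = \int[mu]_t F t)%E.
Proof.
by move=> mF F0; rewrite /translate_tuple ge0_integral_affine// expr1n invr1 mul1e.
Qed.

Lemma vec_translate (eta : E) (t : Tup) :
  vec (translate_tuple eta t) = vec t - eta.
Proof. by apply/rowP => i; rewrite !mxE tnth_mktuple mul1r addrC. Qed.

(** Translating the Fourier transform by [eta] costs a factor
    [expR (l * w (enorm eta))], by subadditivity of the weight. *)
Lemma wnorm_modulation l f eta : 0 <= l -> compactly_supported f ->
  (wnorm w l (fun x => f x * expi (dotp x eta))%R <=
   (expR (l * w (enorm eta)))%:E * wnorm w l f)%E.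
Proof.
move=> l0 cf.
pose F (t : Tup) : \bar R := (cmod (fourier f (vec t)) * expR (l * w (enorm (vec t))))%:E.
have mF : measurable_fun setT F by exact: measurable_wnorm.
have F0 t : (0 <= F t)%E by rewrite lee_fin mulr_ge0 ?cmod_ge0 ?expR_ge0.
rewrite wnormE -[wnorm w l f]/(\int[mu]_t F t)%E -(ge0_integral_translate eta mF F0).
have mFa : measurable_fun setT (fun t : Tup => F (translate_tuple eta t)).
  exact: (measurableT_comp mF (measurable_translate_tuple _)).
rewrite -ge0_integralZl// ?lee_fin ?expR_ge0//.
apply: ge0_le_integral => //.
- by move=> t _; rewrite lee_fin mulr_ge0 ?cmod_ge0 ?expR_ge0.
- exact: (measurable_wnorm _ (compactly_supportedM cf (@continuousC_expi _ _ eta))).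
- exact: measurable_funeM.
move=> t _; rewrite /F vec_translate -EFinM lee_fin fourier_modulation.
rewrite [leRHS]mulrCA ler_wpM2l ?cmod_ge0// -expRD ler_expR -mulrDr ler_wpM2l//.
by rewrite -{1}(subrK eta (vec t)) addrC; exact: (weight_enormD hw).
Qed.

(** Insert the inversion formula for [psi] and exchange the two integrals; what
    remains is a convolution of Fourier transforms. *)
Lemma fourier_mul l psi f xi : 0 <= l -> compactly_supported psi ->
  (wnorm w l psi < +oo)%E -> compactly_supported f ->
  fourier (fun x => psi x * f x) xi =
  inv2pi%:C * cint mu (fun t : Tup => fourier psi (vec t) * fourier f (xi - vec t)).
Proof.
move=> l0 cpsi poo cf.
have ip := wnorm_fourier_integrable l0 cpsi poo.
have [M M0 hM] := compactly_supported_lorentz cf.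
have mfp := cmeasurable_fourier cpsi.
pose F (p : Tup * Tup) : C := (f (vec p.1) * expi (- dotp (vec p.1) xi)) *
  (fourier psi (vec p.2) * expi (dotp (vec p.1) (vec p.2))).
have mF : cmeasurable F.
  apply: cmeasurableM; apply: cmeasurableM.
  - by apply: (cmeasurable_comp (f := fun t : Tup => f (vec t))) => //; exact: cmeasurable_vec cf.1.
  - apply: cmeasurable_expi; apply: measurableT_comp => //.
    exact: (measurableT_comp (measurable_dotpl xi) measurable_fst).
  - by apply: (cmeasurable_comp (f := fun t : Tup => fourier psi (vec t))).
  - apply: cmeasurable_expi; exact: measurable_dotp.
have mx x : measurable_fun setT (fun t : Tup => dotp x (vec t)).
  by under eq_fun do rewrite dotpC; exact: measurable_dotpl.
have ipe x : cintegrable mu (fun t : Tup => fourier psi (vec t) * expi (dotp x (vec t))).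
  apply: (le_cintegrable _ (integrable_cmod ip)).
  - by apply: cmeasurableM => //; exact: cmeasurable_expi.
  - by move=> t; rewrite cmodM cmod_expi mulr1.
have [|iF mG _ fub] := cint_prod_dominated (integrable_scaled_lorentz M) (integrable_cmod ip) mF.
  move=> s t; rewrite /F/= !cmodM !cmod_expi !mulr1.
  by apply: ler_wpM2r; [exact: cmod_ge0|exact: hM].
have E1 (s : Tup) : cint mu (fun t => F (s, t)) = ((2 * pi) ^+ d)%:C *
    (psi (vec s) * f (vec s) * expi (- dotp (vec s) xi)).
  rewrite /F/= (cintZ _ (ipe (vec s))) (fourier_inversion (vec s) cpsi ip).
  move: (f (vec s)) (expi _) (psi _) (_%:C) => a b c e; ring.
transitivity (inv2pi%:C * cint mu (fun s => cint mu (fun t => F (s, t)))).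
  under [X in _ * X]eq_cint do rewrite E1.
  rewrite cintZ; last exact: compactly_supported_mod (compactly_supportedM cpsi cf.1).
  rewrite mulrA inv2piK mul1r; reflexivity.
rewrite fub; congr (_ * _); apply: eq_cint => t.
rewrite /F /= [fourier f _]/fourier integralCE -cintZ; last exact: compactly_supported_mod.
apply: eq_cint => s; rewrite dotpDr dotpNr opprB expiD; ring.
Qed.

End WeightedNorms.

Section ProductEstimate.
Context {R : realType} {d : nat}.
Variable w : R -> R.
Hypothesis hw : weight_class w.
Local Notation C := R[i].
Local Notation E := 'rV[R]_d.
Local Notation Tup := (d.-tuple (measurableTypeR R)).
Local Notation mu := (@lebesgue_tuple R d).
Local Notation inv2pi := (@inv2pi R d).
Implicit Types (x y z xi eta : E) (f g psi : E -> C) (l : R).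

Definition sub_tuple (p : Tup * Tup) : Tup :=
  [tuple of mktuple (fun i => tnth p.1 i - tnth p.2 i)].

Lemma measurable_sub_tuple : measurable_fun setT sub_tuple.
Proof.
apply/measurable_fun_tnthP => i.
rewrite (_ : _ \o _ = fun p : Tup * Tup => tnth p.1 i - tnth p.2 i); last first.
  by apply/funext => t; exact: tnth_mktuple.
apply: measurable_funB.
- exact: (measurableT_comp (measurable_tnth i) measurable_fst).
- exact: (measurableT_comp (measurable_tnth i) measurable_snd).
Qed.

Lemma vec_sub_tuple (s t : Tup) : vec (sub_tuple (s, t)) = vec s - vec t.
Proof. by apply/rowP => i; rewrite !mxE tnth_mktuple. Qed.

Lemma sub_tuple_translate (s t : Tup) : sub_tuple (s, t) = translate_tuple (vec t) s.
Proof.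
by apply: eq_from_tnth => i; rewrite !tnth_mktuple /= vecE mul1r addrC.
Qed.

Lemma cmod_fourier_bounded f : compactly_supported f ->
  exists2 B : R, 0 <= B & forall xi, cmod (fourier f xi) <= B.
Proof.
move=> cf; have [M M0 hM] := compactly_supported_lorentz cf.
exists (\int[mu]_t (M * lorentz (vec t))).
  by apply: Rintegral_ge0 => t _; apply: mulr_ge0 => //; exact: ltW (lorentz_gt0 _).
move=> xi; apply: (cmod_cint_le (compactly_supported_mod xi cf) (integrable_scaled_lorentz M)).
by move=> t; rewrite cmodM cmod_expi mulr1.
Qed.

(** The Fourier transform of the product is a convolution, and subadditivity gives
    [w |s| <= w |t| + w |s - t|], so the exponential weight of a convolution is at
    most the convolution of the weighted factors; Tonelli's theorem integrates
    the latter. *)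
Lemma wnormM l psi f : 0 <= l -> compactly_supported psi ->
  (wnorm w l psi < +oo)%E -> compactly_supported f ->
  (wnorm w l (fun x => psi x * f x)%R <= inv2pi%:E * (wnorm w l psi * wnorm w l f))%E.
Proof.
move=> l0 cpsi poo cf.
have ip := wnorm_fourier_integrable hw l0 cpsi poo.
have [B B0 hB] := cmod_fourier_bounded cf.
pose a (t : Tup) : \bar R := (cmod (fourier psi (vec t)) * expR (l * w (enorm (vec t))))%:E.
pose b (t : Tup) : \bar R := (cmod (fourier f (vec t)) * expR (l * w (enorm (vec t))))%:E.
have ma : measurable_fun setT a by exact: (measurable_wnorm hw).
have mb : measurable_fun setT b by exact: (measurable_wnorm hw).
have a0 t : (0 <= a t)%E by rewrite lee_fin mulr_ge0 ?cmod_ge0 ?expR_ge0.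
have b0 t : (0 <= b t)%E by rewrite lee_fin mulr_ge0 ?cmod_ge0 ?expR_ge0.
have c0 : (0 <= inv2pi%:E)%E by rewrite lee_fin ltW// inv2pi_gt0.
pose H (p : Tup * Tup) : \bar R := (a p.2 * b (sub_tuple p))%E.
have H0 p : (0 <= H p)%E by exact: mule_ge0.
have mH : measurable_fun setT H.
  apply: emeasurable_funM; first exact: (measurableT_comp ma measurable_snd).
  exact: (measurableT_comp mb measurable_sub_tuple).
have tr t : (\int[mu]_s b (sub_tuple (s, t)) = wnorm w l f)%E.
  under eq_integral do rewrite sub_tuple_translate.
  by rewrite ge0_integral_translate.
have -> : (wnorm w l psi * wnorm w l f = \int[mu]_s \int[mu]_t H (s, t))%E.
  rewrite (fubini_tonelli H mH H0) [wnorm w l psi]wnormE -ge0_integralZr//; last 2 first.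
  - by move=> t _; exact: a0.
  - exact: wnorm_ge0.
  apply: eq_integral => t _.
  rewrite -(tr t) -ge0_integralZl//; last exact: a0.
  under eq_fun do rewrite sub_tuple_translate.
  exact: (measurableT_comp mb (measurable_translate_tuple _)).
rewrite -ge0_integralZl//; last 2 first.
- by apply: measurable_fun_fubini_tonelli_F.
- by move=> s _; exact: integral_ge0.
rewrite wnormE; apply: ge0_le_integral => //.
- by move=> s _; rewrite lee_fin mulr_ge0 ?cmod_ge0 ?expR_ge0.
- exact: (measurable_wnorm hw _ (compactly_supportedM cpsi cf.1)).
- by apply: measurable_funeM; exact: measurable_fun_fubini_tonelli_F.
move=> s _.
pose G (t : Tup) : C := fourier psi (vec t) * fourier f (vec s - vec t).
have mG : cmeasurable G.
  apply: cmeasurableM; first exact: cmeasurable_fourier.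
  under eq_fun do rewrite -vec_sub_tuple.
  apply: (cmeasurable_comp (f := fun t : Tup => fourier f (vec t))); last first.
    exact: cmeasurable_fourier.
  apply: (measurableT_comp measurable_sub_tuple); exact: pair1_measurable.
have iG : cintegrable mu G.
  apply: (@le_cintegrable _ _ _ _ _ (fun t => B * cmod (fourier psi (vec t)))) => //.
  - under eq_fun do rewrite EFinM; apply: integrableZl => //.
    exact: integrable_cmod.
  - by move=> t; rewrite /G cmodM mulrC ler_wpM2r ?cmod_ge0.
rewrite (fourier_mul hw _ l0 cpsi poo cf) cmodM cmod_real gtr0_norm ?inv2pi_gt0//.
rewrite -mulrA EFinM lee_wpmul2l//; set W := expR _.
rewrite (@le_trans _ _ (W%:E * \int[mu]_t (cmod (G t))%:E)%E)//.
  by rewrite mulrC EFinM lee_wpmul2l ?lee_fin ?expR_ge0//; exact: cmod_cint.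
rewrite -ge0_integralZl//; last 3 first.
- by apply/measurable_EFinP; exact: cmeasurable_cmod.
- by move=> t _; rewrite lee_fin cmod_ge0.
- by rewrite lee_fin expR_ge0.
apply: ge0_le_integral => //.
- by move=> t _; rewrite mule_ge0 ?lee_fin ?expR_ge0 ?cmod_ge0.
- by apply: measurable_funeM; apply/measurable_EFinP; exact: cmeasurable_cmod.
- by apply: (measurableT_comp mH); exact: pair1_measurable.
move=> t _; rewrite /H /a /b/= vec_sub_tuple -!EFinM lee_fin /G cmodM.
rewrite mulrACA mulrC ler_wpM2l ?mulr_ge0 ?cmod_ge0//.
rewrite -expRD ler_expR -mulrDr ler_wpM2l//.
by rewrite -{1}(subrK (vec t) (vec s)) addrC; exact: (weight_enormD hw).
Qed.

End ProductEstimate.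

(** * Spaces of test functions *)

Section TestFunctions.
Context {R : realType} {d : nat}.
Variable w : R -> R.
Hypothesis hw : weight_class w.
Local Notation C := R[i].
Local Notation E := 'rV[R]_d.
Local Notation Tup := (d.-tuple (measurableTypeR R)).
Local Notation mu := (@lebesgue_tuple R d).
Implicit Types (x y z xi eta : E) (f g psi phi : E -> C) (l : R) (Om K : set E).

Lemma testfun_compactly_supported Om f : testfun w Om f -> compactly_supported f.
Proof. by case. Qed.

Lemma testfun_wnorm Om f l : testfun w Om f -> 0 < l -> (wnorm w l f < +oo)%E.
Proof. by case=> _ _ _; apply. Qed.

Lemma testfun_inP Om K f : compact K -> K `<=` Om ->
  continuous (f : E -> (C : numFieldType)) -> (forall x, ~ K x -> f x = 0) ->
  (forall l, 0 < l -> (wnorm w l f < +oo)%E) -> testfun_in w Om K f.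
Proof.
move=> cK KOm cf fK foo; have sK := supp_subset cK fK.
split=> //; split=> //; first exact: (compact_supp_subset cK).
exact: subset_trans sK KOm.
Qed.

Lemma testfun_in_notin Om K f x : testfun_in w Om K f -> ~ K x -> f x = 0.
Proof. by move=> [_ sK] nKx; apply: notin_supp => /sK. Qed.

Lemma testfun_inD Om K f g : compact K -> K `<=` Om ->
  testfun_in w Om K f -> testfun_in w Om K g -> testfun_in w Om K (fun x => f x + g x).
Proof.
move=> cK KOm hf hg.
have cf := testfun_compactly_supported hf.1.
have cg := testfun_compactly_supported hg.1.
apply: testfun_inP => //.
- exact: continuousCD cf.1 cg.1.
- by move=> x nKx; rewrite (testfun_in_notin hf nKx) (testfun_in_notin hg nKx) addr0.
- move=> l l0; apply: (le_lt_trans (wnormD hw l cf cg)).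
  exact: lte_add_pinfty (testfun_wnorm hf.1 l0) (testfun_wnorm hg.1 l0).
Qed.

Lemma testfun_inZ Om K (c : C) f : compact K -> K `<=` Om ->
  testfun_in w Om K f -> testfun_in w Om K (fun x => c * f x).
Proof.
move=> cK KOm hf; have cf := testfun_compactly_supported hf.1.
apply: testfun_inP => //.
- exact: (compactly_supportedZ c cf).1.
- by move=> x nKx; rewrite (testfun_in_notin hf nKx) mulr0.
- move=> l l0; rewrite (wnormZ hw l c cf).
  apply: lte_mul_pinfty; [by rewrite lee_fin cmod_ge0|by []|].
  exact: testfun_wnorm hf.1 l0.
Qed.

Lemma testfun_inB Om K f g : compact K -> K `<=` Om ->
  testfun_in w Om K f -> testfun_in w Om K g -> testfun_in w Om K (fun x => f x - g x).
Proof.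
move=> cK KOm hf hg; have hgN := testfun_inZ (-1) cK KOm hg.
have := testfun_inD cK KOm hf hgN; congr testfun_in.
by apply/funext => x; rewrite mulN1r.
Qed.

Lemma testfun_in_modulation Om K f eta : compact K -> K `<=` Om ->
  testfun_in w Om K f -> testfun_in w Om K (fun x => f x * expi (dotp x eta)).
Proof.
move=> cK KOm hf; have cf := testfun_compactly_supported hf.1.
apply: testfun_inP => //.
- exact: continuousCM cf.1 (@continuousC_expi _ _ eta).
- by move=> x nKx; rewrite (testfun_in_notin hf nKx) mul0r.
- move=> l l0; apply: (le_lt_trans (wnorm_modulation hw eta (ltW l0) cf)).
  apply: lte_mul_pinfty; [by rewrite lee_fin expR_ge0|by []|].
  exact: testfun_wnorm hf.1 l0.
Qed.

Lemma ccauchy_cvg (z : nat -> C) :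
  (forall e : R, 0 < e -> exists N : nat, forall m n, (N <= m)%N -> (N <= n)%N ->
    cmod (z m - z n) <= e) ->
  exists a : C, cmod (z n - a) @[n --> \oo] --> 0.
Proof.
move=> hz.
have real_case (u : nat -> R) : (forall m n, `|u m - u n| <= cmod (z m - z n)) ->
    u n @[n --> \oo] --> limn u.
  move=> uz; apply: (@cauchy_cvg R^o (u @ \oo)); apply: cauchy_exP => e e0.
  have [N hN] := hz _ (divr_gt0 e0 (ltr0n _ 2)).
  exists (u N); exists N => // n /= Nn; rewrite /ball/=.
  rewrite (le_lt_trans (uz _ _))// (le_lt_trans (hN _ _ (leqnn N) Nn))//.
  by rewrite ltr_pdivrMr// ltr_pMr// ltr1n.
have r1 := real_case (fun n => complex.Re (z n)) (fun m n => _).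
have /r1 c1 : forall m n, `|complex.Re (z m) - complex.Re (z n)| <= cmod (z m - z n).
  by move=> m n; rewrite -Re_sub Re_le_cmod.
have r2 := real_case (fun n => complex.Im (z n)) (fun m n => _).
have /r2 c2 : forall m n, `|complex.Im (z m) - complex.Im (z n)| <= cmod (z m - z n).
  by move=> m n; rewrite -Im_sub Im_le_cmod.
exists (limn (fun n => complex.Re (z n)) +i* limn (fun n => complex.Im (z n))).
set a := _ +i* _.
have s0 : `|complex.Re (z n) - complex.Re a| + `|complex.Im (z n) - complex.Im a|
    @[n --> \oo] --> (0 : R).
  rewrite -[X in _ --> X](addr0 0); apply: cvgD;
  by apply/norm_cvg0P/subr_cvg0.
apply: (squeeze_cvgr _ (cvg_cst 0) s0); apply: nearW => n.
by rewrite cmod_ge0/= (le_trans (cmod_le_ReIm _))// Re_sub Im_sub.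
Qed.

Lemma limn_einf_le (u : nat -> \bar R) (B : \bar R) N :
  (forall n, (N <= n)%N -> (u n <= B)%E) -> (limn_einf u <= B)%E.
Proof.
move=> uB; rewrite limn_einf_lim; apply: lime_le; first exact: is_cvg_einfs.
apply: nearW => n; apply: (@le_trans _ _ (u (maxn n N))).
  by apply: ereal_inf_lbound; exists (maxn n N) => //=; exact: leq_maxl.
by apply: uB; exact: leq_maxr.
Qed.

(** The norm of index 1 dominates the uniform norm, so a Cauchy sequence converges
    uniformly.  As all supports lie in [K], the Fourier transforms then converge
    pointwise, and Fatou's lemma bounds the norms of the limit. *)
Lemma testfun_in_complete Om K (phi : nat -> E -> C) : compact K -> K `<=` Om ->
  (forall n, testfun_in w Om K (phi n)) ->
  (forall l e : R, 0 < l -> 0 < e -> exists N : nat, forall m n, (N <= m)%N -> (N <= n)%N ->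
    (wnorm w l (fun x => phi m x - phi n x)%R <= e%:E)%E) ->
  exists2 f, testfun_in w Om K f & forall e : R, 0 < e ->
    exists N : nat, forall n x, (N <= n)%N -> cmod (phi n x - f x) <= e.
Proof.
move=> cK KOm hphi hC.
have cphi n := testfun_compactly_supported (hphi n).1.
have cB m n : compactly_supported (fun x => phi m x - phi n x).
  exact: testfun_compactly_supported (testfun_inB cK KOm (hphi m) (hphi n)).1.
have unif e : 0 < e -> exists N : nat, forall m n x, (N <= m)%N -> (N <= n)%N ->
    cmod (phi m x - phi n x) <= e.
  move=> e0; have i0 := @inv2pi_gt0 R d.
  have [N hN] := hC 1 (e / @inv2pi R d) ltr01 (divr_gt0 e0 i0).
  exists N => m n x Nm Nn; rewrite -lee_fin.
  rewrite (le_trans (cmod_le_wnorm hw x ler01 (cB m n)))//.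
  have -> : e%:E = ((@inv2pi R d)%:E * (e / @inv2pi R d)%:E)%E.
    by rewrite -EFinM mulrCA divff ?mulr1// lt0r_neq0.
  by rewrite lee_wpmul2l ?lee_fin ?(ltW i0)// hN.
have /choice[f hf] : forall x, exists a, cmod (phi n x - a) @[n --> \oo] --> 0.
  move=> x; apply: ccauchy_cvg => e /unif[N hN].
  by exists N => m n; exact: hN.
have unif_f e : 0 < e -> exists N : nat, forall n x, (N <= n)%N -> cmod (phi n x - f x) <= e.
  move=> e0; have [N hN] := unif _ (divr_gt0 e0 (ltr0n _ 2)).
  exists N => n x Nn.
  have /cvgrPdist_lt/(_ _ (divr_gt0 e0 (ltr0n _ 2)))[M _ hM] := hf x.
  have -> : phi n x - f x = (phi n x - phi (maxn N M) x) + (phi (maxn N M) x - f x) by ring.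
  rewrite (le_trans (cmodD _ _))// (splitr e) lerD//.
    by apply: hN => //; exact: leq_maxl.
  have := hM (maxn N M) (leq_maxr _ _).
  by rewrite /= sub0r normrN ger0_norm ?cmod_ge0// => /ltW.
exists f => //.
have f0 x : ~ K x -> f x = 0.
  move=> nKx; apply: (@clim_unique _ (fun n => phi n x)); first exact: hf.
  under eq_fun do rewrite (testfun_in_notin (hphi _) nKx) subrr cmod0.
  exact: cvg_cst.
have cf : continuous (f : E -> (C : numFieldType)).
  apply/continuousC_rVP => x e e0.
  have e3 : 0 < e / 3 by rewrite divr_gt0.
  have [N hN] := unif_f _ e3.
  have [delta d0 hd] := (continuousC_rVP (phi N)).1 (cphi N).1 x _ e3.
  exists delta => // y xy.
  have -> : f x - f y = - (phi N x - f x) + (phi N x - phi N y) + (phi N y - f y) by ring.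
  have h1 := hN N x (leqnn N); have h2 := hN N y (leqnn N); have h3 := hd y xy.
  rewrite (le_lt_trans (cmodD _ _))//.
  have := cmodD (- (phi N x - f x)) (phi N x - phi N y); rewrite cmodN.
  move: (cmod _) (cmod (phi N x - phi N y)) h3 (cmod (phi N x - f x)) h1 (cmod (phi N y - f y)) h2.
  by move=> a b hb c hc' a' ha' ha; lra.
have ccf : compactly_supported f.
  by split => //; apply: (compact_supp_subset cK); exact: supp_subset.
apply: testfun_inP => // l l0.
have [V V0 hV] := cint_supported_le cK.
have fourier_cvg xi : cmod (fourier (phi n) xi) @[n --> \oo] --> cmod (fourier f xi).
  apply/cvgrPdist_le => e e0.
  have e1 : 0 < e / (V + 1) by rewrite divr_gt0// ltr_wpDl.
  have [N hN] := unif_f _ e1.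
  exists N => // n /= Nn.
  rewrite (le_trans (cmod_dist _ _))// cmod_distC.
  have cNf : compactly_supported (fun x => -1 * f x) by exact: compactly_supportedZ.
  have -> : fourier (phi n) xi - fourier f xi = fourier (fun x => phi n x + -1 * f x) xi.
    by rewrite fourierD// fourierZ// mulN1r.
  have cD := compactly_supportedD (cphi n) cNf.
  apply: (@le_trans _ _ (e / (V + 1) * V)).
    apply: hV.
    - apply: cmeasurableM; first exact: cmeasurable_vec cD.1.
      by apply: cmeasurable_expi; apply: measurableT_comp => //; exact: measurable_dotpl.
    - exact: ltW.
    - by move=> x nKx; rewrite (testfun_in_notin (hphi n) nKx) f0// mulr0 addr0 mul0r.
    - by move=> x; rewrite cmodM cmod_expi mulr1 mulN1r; exact: hN.
  by rewrite mulrAC ler_pdivrMr ?ltr_wpDl// ler_wpM2l ?(ltW e0)// lerDl.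
have [N hN] := hC l 1 l0 ltr01.
have bound n : (N <= n)%N -> (wnorm w l (phi n) <= 1 + wnorm w l (phi N))%E.
  move=> Nn; have -> : phi n = (fun x => (phi n x - phi N x) + phi N x).
    by apply/funext => x; rewrite subrK.
  by rewrite (le_trans (wnormD hw l (cB n N) (cphi N)))// leeD2r// hN.
rewrite (@le_lt_trans _ _ (1 + wnorm w l (phi N))%E)//; last first.
  by rewrite lte_add_pinfty// ?ltry// (testfun_wnorm (hphi N).1).
apply: le_trans (limn_einf_le bound).
pose h n (t : Tup) : \bar R :=
  (cmod (fourier (phi n) (vec t)) * expR (l * w (enorm (vec t))))%:E.
apply: le_trans (@fatou _ _ _ mu setT measurableT h _ _); last 2 first.
- by move=> n; exact: (measurable_wnorm hw).
- by move=> n t _; rewrite lee_fin mulr_ge0 ?cmod_ge0 ?expR_ge0.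
rewrite wnormE le_eqVlt; apply/orP; left; apply/eqP; apply: eq_integral => t _.
apply/esym; apply: (cvg_limn_einf_sup _).1.
apply: cvg_EFin; first exact: nearW.
by apply: cvgM; [exact: fourier_cvg|exact: cvg_cst].
Qed.

End TestFunctions.

(** * Uniform boundedness *)

Section UniformBoundedness.
Context {R : realType} {d : nat}.
Variable w : R -> R.
Hypothesis hw : weight_class w.
Local Notation C := R[i].
Local Notation E := 'rV[R]_d.
Local Notation Tup := (d.-tuple (measurableTypeR R)).
Local Notation mu := (@lebesgue_tuple R d).
Implicit Types (x y z xi eta : E) (f g psi : E -> C) (l : R) (Om K : set E).

(** Equal to [1 / ((n + 1) (n + 2))] (see [teleE]); written as a difference because
    sums of consecutive terms are then explicit. *)
Definition tele (n : nat) : R := n.+1%:R^-1 - n.+2%:R^-1.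

Lemma tele_gt0 n : 0 < tele n.
Proof. by rewrite subr_gt0 ltf_pV2 ?posrE ?ltr0n// ltr_nat. Qed.

Lemma wnormB_sym l f g : compactly_supported f -> compactly_supported g ->
  wnorm w l (fun x => f x - g x) = wnorm w l (fun x => g x - f x).
Proof.
move=> cf cg.
have cN : compactly_supported (fun x => g x - f x).
  have := compactly_supportedD cg (compactly_supportedZ (-1) cf).
  by congr compactly_supported; apply/funext => x; rewrite mulN1r.
have -> : (fun x => f x - g x) = (fun x => -1 * (g x - f x)).
  by apply/funext => x; rewrite mulN1r opprB.
by rewrite (wnormZ hw l (-1) cN) cmodN cmod1 mul1e.
Qed.

Lemma wnorm_telescope l W N0 (phi : nat -> E -> C) :
  (forall n, compactly_supported (phi n)) -> 0 <= W ->
  (forall n, (N0 <= n)%N -> (wnorm w l (fun x => phi n.+1 x - phi n x)%R <= (W * tele n)%:E)%E) ->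
  forall e : R, 0 < e -> exists N : nat, forall m n, (N <= m)%N -> (N <= n)%N ->
    (wnorm w l (fun x => phi m x - phi n x)%R <= e%:E)%E.
Proof.
move=> cphi W0 hstep e e0.
have key n k : (N0 <= n)%N ->
    (wnorm w l (fun x => phi (n + k)%N x - phi n x)%R <=
     (W * (n.+1%:R^-1 - (n + k).+1%:R^-1))%:E)%E.
  move=> Nn; elim: k => [|k IH].
    rewrite addn0 subrr mulr0.
    have -> : (fun x => phi n x - phi n x) = (fun x => 0 * phi n x).
      by apply/funext => x; rewrite subrr mul0r.
    by rewrite (wnormZ hw l 0 (cphi n)) cmod0 mul0e.
  have -> : (fun x => phi (n + k.+1)%N x - phi n x) =
      (fun x => (phi (n + k).+1 x - phi (n + k)%N x) + (phi (n + k)%N x - phi n x)).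
    by apply/funext => x; rewrite addnS; ring.
  apply: (le_trans (wnormD hw l (compactly_supportedB (cphi _) (cphi _))
    (compactly_supportedB (cphi _) (cphi _)))).
  have h := leeD (hstep (n + k)%N (leq_trans Nn (leq_addr k n))) IH.
  apply: (le_trans h); rewrite -EFinD lee_fin -mulrDr ler_wpM2l// /tele addnS.
  by rewrite addrC addrA subrK.
have [N1 hN1] : exists N1 : nat, W * N1.+1%:R^-1 <= e.
  exists (Num.truncn (W / e)); rewrite ler_pdivrMr// mulrC -ler_pdivrMr//.
  exact: ltW (truncnS_gt _).
exists (maxn N0 N1) => m n.
wlog nm : m n / (n <= m)%N.
  move=> H hm hn; have [nm|/ltnW mn] := leqP n m; first exact: H.
  by rewrite (wnormB_sym l (cphi m) (cphi n)); exact: H.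
move=> _; rewrite geq_max => /andP[n0 n1].
rewrite -(subnKC nm); apply: (le_trans (key n (m - n)%N n0)).
rewrite lee_fin (le_trans _ hN1)// ler_wpM2l// lerBlDr.
apply: (@le_trans _ _ (N1.+1%:R^-1)).
  by rewrite lef_pV2 ?posrE ?ltr0n// ler_nat ltnS.
by rewrite lerDl invr_ge0 ler0n.
Qed.

Lemma integralC_le (u : E -> C) : compactly_supported u ->
  exists2 M : R, 0 <= M & forall f (e : R), continuous (f : E -> (C : numFieldType)) ->
    (forall x, cmod (f x) <= e) -> cmod (integralC (fun x => u x * f x)) <= M * e.
Proof.
move=> cu; have iu := compactly_supported_integrable cu.
exists (\int[mu]_t cmod (u (vec t))).
  by apply: Rintegral_ge0 => t _; exact: cmod_ge0.
move=> f e cf fe; rewrite integralCE mulrC -RintegralZl//; last exact: integrable_cmod.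
apply: cmod_cint_le.
- exact: (compactly_supported_integrable (compactly_supportedM cu cf)).
- by under eq_fun do rewrite EFinM; apply: integrableZl => //; exact: integrable_cmod.
- by move=> t; rewrite cmodM mulrC ler_wpM2r ?cmod_ge0.
Qed.

Lemma integralC_lin (u f g : E -> C) (c : C) : compactly_supported u ->
  continuous (f : E -> (C : numFieldType)) -> continuous (g : E -> (C : numFieldType)) ->
  integralC (fun x => u x * (f x + c * g x)) =
  integralC (fun x => u x * f x) + c * integralC (fun x => u x * g x).
Proof.
move=> cu cf cg; rewrite !integralCE.
have i1 := compactly_supported_integrable (compactly_supportedM cu cf).
have i2 := compactly_supported_integrable (compactly_supportedM cu cg).
rewrite -(cintZ c i2) -(cintD i1 (cintegrableZ c i2)).
by apply: eq_cint => t; ring.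
Qed.

(** Since [b + b = (a + b) - (a - b)], one of the two signs works.  This keeps a new
    hump from being cancelled by the previous ones. *)
Lemma cmod_sign (a b : C) : exists2 s : C, cmod s = 1 & cmod b <= cmod (a + s * b).
Proof.
have [h|h] := leP (cmod b) (cmod (a + b)).
  by exists 1; rewrite ?cmod1 ?mul1r.
exists (-1); first by rewrite cmodN cmod1.
have : cmod (b + b) <= cmod (a + b) + cmod (a - b).
  have -> : b + b = (a + b) - (a - b) by ring.
  exact: cmodB.
have -> : cmod (b + b) = cmod b + cmod b.
  have -> : b + b = (1 + 1 : R)%:C * b by rewrite rmorphD mulrDl mul1r.
  by rewrite cmodM cmod_real ger0_norm// mulrDl mul1r.
rewrite mulN1r; move: h; lra.
Qed.

Variables (Om K : set E) (psi : E -> C) (u : nat -> E -> C).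
Hypotheses (cK : compact K) (KOm : K `<=` Om) (hpsi : testfun_in w Om K psi).
Hypothesis cu : forall n, compactly_supported (u n).
Let B n f : C := integralC (fun x => u n x * f x).

Section GlidingHump.
Variables (M : nat -> R) (S : R).
Hypothesis MB : forall n f (e : R), continuous (f : E -> (C : numFieldType)) ->
  (forall x, cmod (f x) <= e) -> cmod (B n f) <= M n * e.
Hypothesis S0 : 0 <= S.
Hypothesis psiS : forall x, cmod (psi x) <= S.
Hypothesis unbounded : forall l A : R, 0 < l -> 0 < A -> exists n xi,
  A * expR (l * w (enorm xi)) < cmod (B n (fun x => psi x * expi (dotp x xi))).

(** A state is a partial sum of humps together with an upper bound for the
    constants [M n] of the functionals already used.  Step [j] adds a hump that is
    small relative to that bound, so that it hardly moves the earlier functionals,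
    and small in the norms of index at most [j + 1], so that the sum converges,
    but on which some functional becomes at least [j + 1]. *)
Definition hump_step (j : nat) (s s' : (E -> C) * R) : Prop :=
  testfun_in w Om K s.1 -> 0 <= s.2 ->
  [/\ testfun_in w Om K s'.1, s.2 <= s'.2,
      exists2 n, M n <= s'.2 & j.+1%:R <= cmod (B n s'.1),
      forall x, cmod (s'.1 x - s.1 x) <= S / (1 + s.2) * tele j &
      forall l, 0 < l -> l <= j.+1%:R ->
        (wnorm w l (fun x => s'.1 x - s.1 x)%R <= (tele j)%:E * wnorm w l psi)%E].

Lemma hump_next j s : exists s', hump_step j s s'.
Proof.
have [[hs s0]|ns] := pselect (testfun_in w Om K s.1 /\ 0 <= s.2); last first.
  by exists s => hs s0; exfalso; apply: ns.
have cpsi := testfun_compactly_supported hpsi.1.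
have Mx0 : 0 < 1 + s.2 by apply: ltr_pwDl.
have A0 : 0 < j.+1%:R * (1 + s.2) / tele j.
  by apply: divr_gt0; [apply: mulr_gt0 => //; rewrite ltr0n|exact: tele_gt0].
have [n [xi hn]] := unbounded (ltr0Sn R j) A0.
set h := (fun x => psi x * expi (dotp x xi)) in hn.
pose W := w (enorm xi).
have W0 : 0 <= W by exact: weight_enorm_ge0.
(* The scaling factor of the hump: the exponential pays for the modulation in the
   norms of index at most [j + 1], [tele j] makes the norms summable, and
   [1 + s.2] protects the earlier functionals.  Divided into [j + 1], it gives the
   lower bound that was requested from [unbounded]. *)
pose c : R := tele j / (1 + s.2) * expR (- (j.+1%:R * W)).
have q0 : 0 < tele j / (1 + s.2) by apply: divr_gt0 => //; exact: tele_gt0.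
have c0 : 0 < c by apply: mulr_gt0 => //; exact: expR_gt0.
have hh : testfun_in w Om K h := testfun_in_modulation hw xi cK KOm hpsi.
have chh := testfun_compactly_supported hh.1.
have [sg sg1 hsg] := cmod_sign (B n s.1) (c%:C * B n h).
pose k : C := sg * c%:C.
have kc : cmod k = c by rewrite /k cmodM sg1 mul1r cmod_real gtr0_norm.
exists ((fun x => s.1 x + k * h x), Num.max s.2 (M n)) => _ _ /=.
have diff x : s.1 x + k * h x - s.1 x = k * h x by rewrite addrAC subrr add0r.
split.
- exact: (testfun_inD hw cK KOm hs (testfun_inZ hw k cK KOm hh)).
- by rewrite le_max lexx.
- exists n; first by rewrite le_max lexx orbT.
  have -> : B n (fun x => s.1 x + k * h x) = B n s.1 + sg * (c%:C * B n h).
    rewrite /B integralC_lin//; first by rewrite mulrA.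
    + exact: (testfun_compactly_supported hs.1).1.
    + exact: chh.1.
  apply: le_trans hsg; rewrite cmodM cmod_real gtr0_norm//.
  have -> : j.+1%:R = c * (j.+1%:R * (1 + s.2) / tele j * expR (j.+1%:R * W)) :> R.
    rewrite /c expRN.
    have e0 : expR (j.+1%:R * W) != 0 by exact: lt0r_neq0 (expR_gt0 _).
    have t0 : tele j != 0 by exact: lt0r_neq0 (tele_gt0 _).
    have m0 : 1 + s.2 != 0 by exact: lt0r_neq0.
    have alg (a b p q : R) : a != 0 -> b != 0 -> p != 0 ->
        q = b / p * a^-1 * (q * p / b * a).
      by move=> a0 b0 p0; field; rewrite a0 b0 p0.
    exact: alg.
  by rewrite ler_pM2l// ltW.
- move=> x; rewrite diff cmodM kc /h cmodM cmod_expi mulr1.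
  have cle : c <= tele j / (1 + s.2).
    rewrite /c -[leRHS]mulr1 ler_pM2l// -[X in _ <= X]expR0 ler_expR oppr_le0.
    by apply: mulr_ge0 => //; exact: ler0n.
  apply: (@le_trans _ _ (tele j / (1 + s.2) * S)); last by rewrite mulrC mulrA mulrAC.
  by apply: ler_pM; [exact: ltW|exact: cmod_ge0|exact: cle|exact: psiS].
- move=> l l0 lj.
  have -> : (fun x => s.1 x + k * h x - s.1 x) = (fun x => k * h x) by apply/funext.
  rewrite (wnormZ hw l k chh) kc.
  have h1 := wnorm_modulation hw xi (ltW l0) cpsi.
  have c0' : (0 <= c%:E)%E by rewrite lee_fin ltW.
  apply: (le_trans (lee_wpmul2l c0' h1)); rewrite muleA -EFinM.
  apply: lee_wpmul2r; first exact: wnorm_ge0.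
  rewrite lee_fin /c -(mulrA (tele j / (1 + s.2))) -expRD -/W.
  apply: (@le_trans _ _ (tele j / (1 + s.2) * 1)).
    rewrite ler_pM2l// -[X in _ <= X]expR0 ler_expR addrC subr_le0.
    exact: (ler_wpM2r W0 lj).
  rewrite mulr1 ler_pdivrMr// ler_peMr ?lerDl//.
  exact: ltW (tele_gt0 _).
Qed.

(** The humps sum up to a test function by completeness.  The functional used at
    step [j] is at least [j + 1] on the partial sum, and the later humps change its
    value by at most [S]. *)
Lemma gliding_hump : exists2 f, testfun_in w Om K f &
  forall A : R, exists n, A < cmod (B n f).
Proof.
have [next hnext] : exists next : nat -> (E -> C) * R -> (E -> C) * R,
    forall j s, hump_step j s (next j s).
  have /choice[nx hnx] : forall p : nat * ((E -> C) * R), exists s', hump_step p.1 p.2 s'.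
    by move=> p; exact: hump_next.
  by exists (fun j s => nx (j, s)) => j s; exact: (hnx (j, s)).
pose st : nat -> (E -> C) * R := fix st n := if n is m.+1 then next m (st m)
  else ((fun=> 0), 0).
have tf0 : testfun_in w Om K (fun=> 0).
  have := testfun_inZ hw 0 cK KOm hpsi.
  by congr testfun_in; apply/funext => x; rewrite mul0r.
have inv n : testfun_in w Om K (st n).1 /\ 0 <= (st n).2.
  elim: n => [|n [h1 h2]]; first by split.
  have [h3 h4 _ _ _] := hnext n (st n) h1 h2.
  by split; [exact: h3|exact: le_trans h2 h4].
have stepP j : [/\ (st j).2 <= (st j.+1).2,
      exists2 n, M n <= (st j.+1).2 & j.+1%:R <= cmod (B n (st j.+1).1),
      forall x, cmod ((st j.+1).1 x - (st j).1 x) <= S / (1 + (st j).2) * tele j &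
      forall l, 0 < l -> l <= j.+1%:R ->
        (wnorm w l (fun x => (st j.+1).1 x - (st j).1 x)%R <= (tele j)%:E * wnorm w l psi)%E].
  have [h1 h2] := inv j.
  by have [_ h4 h5 h6 h7] := hnext j (st j) h1 h2; split.
pose phi n := (st n).1.
have cphi n : compactly_supported (phi n).
  exact: testfun_compactly_supported (inv n).1.1.
have [f hf flim] : exists2 f, testfun_in w Om K f & forall e : R, 0 < e ->
    exists N : nat, forall n x, (N <= n)%N -> cmod (phi n x - f x) <= e.
  apply: (testfun_in_complete hw cK KOm) => [n|l e l0 e0]; first exact: (inv n).1.
  have Woo := testfun_wnorm hpsi.1 l0.
  have Wfin : wnorm w l psi \is a fin_num.
    by rewrite ge0_fin_numE; [exact: Woo|exact: wnorm_ge0].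
  apply: (@wnorm_telescope l (fine (wnorm w l psi)) (Num.truncn l).+1 phi cphi) => //.
    by apply: fine_ge0; exact: wnorm_ge0.
  move=> n nl; have [_ _ _ h] := stepP n.
  rewrite mulrC EFinM (fineK Wfin); apply: h => //.
  apply: (le_trans (ltW (truncnS_gt l))); rewrite ler_nat.
  exact: leqW.
exists f => // A.
have mono j k : (st j).2 <= (st (j + k)%N).2.
  elim: k => [|k IH]; first by rewrite addn0.
  by have [h _ _ _] := stepP (j + k)%N; rewrite addnS (le_trans IH).
have tail j k x : cmod (phi (j + k)%N x - phi j x) <=
    S / (1 + (st j).2) * (j.+1%:R^-1 - (j + k).+1%:R^-1).
  elim: k => [|k IH]; first by rewrite addn0 !subrr cmod0 mulr0.
  have -> : phi (j + k.+1)%N x - phi j x =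
     (phi (j + k).+1 x - phi (j + k)%N x) + (phi (j + k)%N x - phi j x).
    by rewrite addnS; ring.
  rewrite (le_trans (cmodD _ _))//.
  have [_ _ h _] := stepP (j + k)%N.
  apply: (@le_trans _ _ (S / (1 + (st j).2) * tele (j + k)%N +
     S / (1 + (st j).2) * (j.+1%:R^-1 - (j + k).+1%:R^-1))).
    apply: lerD => //; apply: (le_trans (h x)); apply: ler_wpM2r.
      exact: ltW (tele_gt0 _).
    apply: ler_wpM2l => //; have [_ j0] := inv j.
    have jk := mono j k.
    rewrite lef_pV2 ?posrE; first by rewrite lerD2l.
      by apply: ltr_pwDl => //; exact: le_trans j0 jk.
    by apply: ltr_pwDl.
  by rewrite -mulrDr addnS /tele [X in _ * X]addrC addrA subrK.
have ftail j x : cmod (f x - phi j x) <= S / (1 + (st j).2).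
  apply/ler_addgt0Pl => e e0; have [N hN] := flim e e0.
  have -> : f x - phi j x = - (phi (j + N)%N x - f x) + (phi (j + N)%N x - phi j x) by ring.
  rewrite (le_trans (cmodD _ _))// cmodN lerD//.
    by apply: hN; exact: leq_addl.
  apply: (le_trans (tail j N x)).
  have q0 : 0 <= S / (1 + (st j).2).
    by apply: divr_ge0 => //; apply: addr_ge0 => //; exact: (inv j).2.
  rewrite -[leRHS]mulr1 ler_wpM2l// lerBlDr.
  apply: (@le_trans _ _ 1); last by rewrite lerDl invr_ge0 ler0n.
  by rewrite invf_le1 ?ltr0n// ler1n.
pose j := Num.truncn (`|A| + S).
have [_ [n Mn hB] _ _] := stepP j.
exists n.
have cf := testfun_compactly_supported hf.1.
have hdiff : cmod (B n (fun x => f x + -1 * phi j.+1 x)) <= M n * (S / (1 + (st j.+1).2)).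
  apply: MB.
    exact: continuousCD cf.1 (compactly_supportedZ (-1) (cphi j.+1)).1.
  by move=> x; rewrite mulN1r; exact: ftail.
have Mn1 : M n * (S / (1 + (st j.+1).2)) <= S.
  have p0 : 0 < 1 + (st j.+1).2 by apply: ltr_pwDl => //; exact: (inv j.+1).2.
  rewrite mulrA ler_pdivrMr// mulrC; apply: ler_wpM2l => //.
  by rewrite (le_trans Mn)// lerDr.
have eB : B n (fun x => f x + -1 * phi j.+1 x) = B n f - B n (phi j.+1).
  by rewrite /B (integralC_lin _ (cu n) cf.1 (cphi j.+1).1) mulN1r.
have h3 : cmod (B n (phi j.+1)) <= cmod (B n f) + cmod (B n f - B n (phi j.+1)).
  have {1}-> : B n (phi j.+1) = B n f - (B n f - B n (phi j.+1)) by ring.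
  exact: cmodB.
have h4 : `|A| + S < j.+1%:R by exact: truncnS_gt.
have h5 := ler_norm A.
move: hdiff; rewrite eB => h6.
move: h3 h4 h5 h6 Mn1 hB; rewrite -/(phi j.+1).
move: (cmod (B n f)) (cmod (B n f - _)) (cmod (B n (phi j.+1))) (M n * _) => a b c e.
move=> *; lra.
Qed.

End GlidingHump.

(** The failure of the conclusion feeds [gliding_hump], which then produces a test
    function with unbounded values.  The bound is stated on modulations of [psi]
    because their values are Fourier transforms, and the humps can be taken among
    them. *)
Theorem uniform_boundedness :
  (forall f, testfun_in w Om K f -> exists A : R, forall n, cmod (B n f) <= A) ->
  exists2 l : R, 0 < l & exists2 A : R, 0 < A & forall n xi,
    cmod (B n (fun x => psi x * expi (dotp x xi))) <= A * expR (l * w (enorm xi)).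
Proof.
move=> pt.
have /choice[M hM] : forall n, exists M : R, 0 <= M /\
    forall f (e : R), continuous (f : E -> (C : numFieldType)) ->
    (forall x, cmod (f x) <= e) -> cmod (B n f) <= M * e.
  by move=> n; have [M M0 hM] := integralC_le (cu n); exists M.
have [S S0 hS] := compactly_supported_bounded (testfun_compactly_supported hpsi.1).
apply: contrapT => nex.
have [l A l0 A0|f hf fA] := @gliding_hump M S (fun n => (hM n).2) S0 hS.
- apply: contrapT => nA; apply: nex; exists l => //; exists A => // n xi.
  by rewrite leNgt; apply/negP => h; apply: nA; exists n, xi.
have [A hA] := pt f hf.
by have [n] := fA A; rewrite ltNge hA.
Qed.

End UniformBoundedness.

(** * Smoothness *)

Section Smoothness.
Context {R : realType} {d : nat}.
Variable w : R -> R.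
Hypothesis hw : weight_class w.
Local Notation C := R[i].
Local Notation E := 'rV[R]_d.
Local Notation Tup := (d.-tuple (measurableTypeR R)).
Local Notation mu := (@lebesgue_tuple R d).
Implicit Types (x y z xi eta : E) (f g psi : E -> C) (l : R) (Om K : set E) (a b : Tup -> R).

Arguments fourier : simpl never.

(** The decay of the Fourier transforms of test functions.  Since the weight
    dominates the logarithm, it survives multiplication by coordinates. *)
Definition rapid a := measurable_fun setT a /\ forall l : R, 0 < l ->
  mu.-integrable setT (fun t => (a t * expR (l * w (enorm (vec t))))%:E).

Lemma rapid_integrable a : rapid a -> mu.-integrable setT (fun t => (a t)%:E).
Proof.
move=> [ma ia]; apply: (le_integrable measurableT _ _ (ia 1 ltr01)).
  exact/measurable_EFinP.
move=> t _; rewrite /= lee_fin normrM (ger0_norm (expR_ge0 _)).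
rewrite ler_peMr// -[X in X <= _]expR0 ler_expR mul1r.
exact: (weight_enorm_ge0 hw).
Qed.

Lemma rapid_coord a i : rapid a -> rapid (fun t => vec t 0 i * a t).
Proof.
move=> [ma ia]; split; first by apply: measurable_funM => //; exact: measurable_coord.
move=> l l0; have [B B0 hB] := weight_growth hw ler01.
have l1 : 0 < l + 1 by apply: addr_gt0.
have iB := integrableZl measurableT B (ia _ l1).
apply: (le_integrable measurableT _ _ iB).
  apply/measurable_EFinP; apply: measurable_funM; last exact: (measurable_weight_vec hw).
  by apply: measurable_funM => //; exact: measurable_coord.
move=> t _; rewrite -EFinM /= lee_fin !normrM !(ger0_norm (expR_ge0 _)) (gtr0_norm B0).
have h : `|vec t 0 i| <= B * expR (w (enorm (vec t))).
  apply: (le_trans (coord_le_enorm _ _)).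
  have n0 := enorm_ge0 (vec t).
  have := hB _ n0; rewrite mul1r lnK ?posrE; last exact: ltr_pwDl.
  by apply: le_trans; rewrite lerDr.
rewrite mulrDl mul1r expRD.
have -> : B * (`|a t| * (expR (l * w (enorm (vec t))) * expR (w (enorm (vec t))))) =
  (B * expR (w (enorm (vec t)))) * (`|a t| * expR (l * w (enorm (vec t)))) by ring.
rewrite -mulrA; apply: ler_wpM2r => //.
Qed.

Lemma rapidN a : rapid a -> rapid (fun t => - a t).
Proof.
move=> [ma ia]; split; first exact: measurableT_comp.
move=> l l0; have := integrableN (ia l l0); congr (mu.-integrable setT _).
by apply/funext => t /=; rewrite mulNr EFinN.
Qed.

(** The superposition of plane waves with real amplitudes [a] and [b].  For rapidly
    decreasing amplitudes these functions are stable under partial derivatives,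
    which reduces smoothness to continuity. *)
Definition osc a b x : R :=
  \int[mu]_t (a t * cos (dotp x (vec t)) + b t * sin (dotp x (vec t))).

Lemma osc_integrable a b (h : Tup -> R) : rapid a -> rapid b -> measurable_fun setT h ->
  mu.-integrable setT (fun t => (a t * cos (h t) + b t * sin (h t))%:E).
Proof.
move=> ra rb mh.
under eq_fun do rewrite EFinD.
apply: integrableD => //.
- apply: (le_integrable measurableT _ _ (rapid_integrable ra)).
    apply/measurable_EFinP; apply: measurable_funM; first exact: ra.1.
    apply: (measurableT_comp _ mh); apply: continuous_measurable_fun; exact: continuous_cos.
  move=> t _; rewrite /= lee_fin normrM; apply: ler_piMr; first exact: normr_ge0.
  exact: cos_max.
- apply: (le_integrable measurableT _ _ (rapid_integrable rb)).
    apply/measurable_EFinP; apply: measurable_funM; first exact: rb.1.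
    apply: (measurableT_comp _ mh); apply: continuous_measurable_fun; exact: continuous_sin.
  move=> t _; rewrite /= lee_fin normrM; apply: ler_piMr; first exact: normr_ge0.
  exact: sin_max.
Qed.

Lemma measurable_dotpr x : measurable_fun setT (fun t : Tup => dotp x (vec t)).
Proof. by under eq_fun do rewrite dotpC; exact: measurable_dotpl. Qed.

Lemma dotp_line x i (r : R) (t : Tup) :
  dotp (r *: delta_mx 0 i + x) (vec t) = r * vec t 0 i + dotp x (vec t).
Proof.
rewrite dotpDl dotpZl; congr (_ * _ + _).
rewrite /dotp (bigD1 i)//= big1 ?addr0 => [|j ji].
  by rewrite !mxE !eqxx mul1r.
by rewrite !mxE eqxx/= (negbTE ji) mul0r.
Qed.

(** Differentiation under the integral sign along a coordinate line; the
    amplitudes multiplied by the coordinate are the dominating function. *)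
Lemma osc_derive a b x i : rapid a -> rapid b ->
  is_derive x (delta_mx 0 i : E) (osc a b)
    (osc (fun t => vec t 0 i * b t) (fun t => - (vec t 0 i * a t)) x).
Proof.
move=> ra rb.
pose F (r : R) (t : Tup) : R := a t * cos (r * vec t 0 i + dotp x (vec t)) +
  b t * sin (r * vec t 0 i + dotp x (vec t)).
pose G (t : Tup) : R := `|vec t 0 i * a t| + `|vec t 0 i * b t|.
have mh (r : R) : measurable_fun setT (fun t : Tup => r * vec t 0 i + dotp x (vec t)).
  apply: measurable_funD; last exact: measurable_dotpr.
  by apply: measurable_funM => //; exact: measurable_coord.
have iF r : mu.-integrable setT (EFin \o F r) by exact: osc_integrable.
have dF (r : R) t : is_derive r 1 (F ^~ t) (vec t 0 i * b t * cos (r * vec t 0 i + dotp x (vec t))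
    - vec t 0 i * a t * sin (r * vec t 0 i + dotp x (vec t))).
  rewrite /F; apply: is_derive_eq; rewrite /GRing.scale/=; ring.
have dF1 (r : R) t : derivable (F ^~ t) r 1 by case: (dF r t).
have dF2 (r : R) t : 'D_1 (F ^~ t) r = vec t 0 i * b t * cos (r * vec t 0 i + dotp x (vec t))
    - vec t 0 i * a t * sin (r * vec t 0 i + dotp x (vec t)) by case: (dF r t).
have iG : mu.-integrable setT (EFin \o G).
  rewrite /G /comp; under eq_fun do rewrite EFinD.
  apply: integrableD => //.
  - exact: (integrable_abse (rapid_integrable (rapid_coord i ra))).
  - exact: (integrable_abse (rapid_integrable (rapid_coord i rb))).
have I0 : [set` `]-1, (1:R)[] 0 by rewrite /= in_itv/= ltrN10 ltr01.
have := @cvg_differentiation_under_integral R _ Tup mu F setT measurableT 0 (-1) 1 I0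
  (fun r _ => iF r) (fun r t _ _ => dF1 r t) G _ iG _.
have GE : forall t, 0 <= G t by move=> t; apply: addr_ge0.
have Gle (r : R) t : `|partial1of2 F r t| <= G t.
  rewrite partial1of2E dF2.
  rewrite (le_trans (ler_normB _ _))// addrC /G !(normrM _ (cos _)) !(normrM _ (sin _)).
  apply: lerD; apply: ler_piMr => //.
  - exact: sin_max.
  - exact: cos_max.
have E : \int[mu]_(t in setT) partial1of2 F 0 t =
    osc (fun t => vec t 0 i * b t) (fun t => - (vec t 0 i * a t)) x.
  apply: eq_Rintegral => t _; rewrite partial1of2E dF2.
  by rewrite mul0r add0r mulNr.
move=> /(_ GE (fun r t _ _ => Gle r t)); rewrite E => h.
have h2 : h^-1 *: ((osc a b \o shift x) (h *: delta_mx 0 i) - osc a b x) @[h --> 0^'] -->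
    osc (fun t => vec t 0 i * b t) (fun t => - (vec t 0 i * a t)) x.
  apply: cvg_trans h; apply: near_eq_cvg; apply: nearW => r /=.
  congr (_ *: (_ - _)); apply: eq_Rintegral => t _; rewrite /F.
  - by rewrite dotp_line addr0.
  - by rewrite mul0r add0r.
by apply: DeriveDef; [exact: (cvgP _ h2)|exact: (cvg_lim _ h2)].
Qed.

Lemma lipschitz1 (u u' : R -> R) : (forall r : R, is_derive r 1 u (u' r)) ->
  (forall r : R, `|u' r| <= 1) -> forall p q : R, `|u p - u q| <= `|p - q|.
Proof.
move=> du u1 p q.
wlog pq : p q / p <= q.
  move=> H; have [pq|/ltW qp] := leP p q; first exact: H.
  by rewrite distrC (distrC p); exact: H.
have cu : {within `[p, q], continuous u}.
  apply: continuous_subspaceT => r; apply: differentiable_continuous.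
  by apply/derivable1_diffP; case: (du r).
have [c _ e] := MVT_segment pq (fun r _ => du r) cu.
rewrite distrC e normrM (distrC p); apply: ler_piMl => //; exact: u1.
Qed.

Lemma osc_continuous a b : rapid a -> rapid b -> continuous (osc a b).
Proof.
move=> ra rb; apply/continuous_rVP => x e e0.
pose G (t : Tup) : R := \sum_i (`|vec t 0 i * a t| + `|vec t 0 i * b t|).
have iG : mu.-integrable setT (EFin \o G).
  rewrite /G /comp; under eq_fun do rewrite -sumEFin.
  apply: integrable_sum => // i _; under eq_fun do rewrite EFinD.
  apply: integrableD => //.
  - exact: (integrable_abse (rapid_integrable (rapid_coord i ra))).
  - exact: (integrable_abse (rapid_integrable (rapid_coord i rb))).
have G0 t : 0 <= G t by apply: sumr_ge0 => i _; exact: addr_ge0.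
pose I := \int[mu]_t G t.
have I0 : 0 <= I by apply: Rintegral_ge0 => t _; exact: G0.
have I1 : 0 < I + 1 by apply: ltr_wpDl.
have e1 : 0 < e / (I + 1) by apply: divr_gt0.
exists (e / (I + 1)) => // y xy.
have lc := @lipschitz1 cos (fun r => - sin r) (@is_derive_cos R) _.
have ls := @lipschitz1 sin cos (@is_derive_sin R) _.
have {}lc p q : `|cos p - cos q| <= `|p - q| :> R.
  apply: lc => z; rewrite normrN; exact: sin_max.
have {}ls p q : `|sin p - sin q| <= `|p - q| :> R.
  apply: ls => z; exact: cos_max.
have i1 := osc_integrable ra rb (measurable_dotpr x).
have i2 := osc_integrable ra rb (measurable_dotpr y).
rewrite /osc -RintegralB//.
have i3 : mu.-integrable setT (EFin \o (fun t : Tup =>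
    a t * cos (dotp x (vec t)) + b t * sin (dotp x (vec t)) -
    (a t * cos (dotp y (vec t)) + b t * sin (dotp y (vec t))))).
  by rewrite /comp; under eq_fun do rewrite EFinB; exact: integrableB.
apply: (le_lt_trans (le_normr_Rintegral measurableT i3)).
have iG2 : mu.-integrable setT (EFin \o (fun t => e / (I + 1) * G t)).
  by rewrite /comp; under eq_fun do rewrite EFinM; exact: integrableZl.
have i4 : mu.-integrable setT (EFin \o (fun t : Tup =>
    `|a t * cos (dotp x (vec t)) + b t * sin (dotp x (vec t)) -
    (a t * cos (dotp y (vec t)) + b t * sin (dotp y (vec t)))|)).
  exact: (integrable_abse i3).
apply: (@le_lt_trans _ _ (\int[mu]_t (e / (I + 1) * G t))).
  apply: le_Rintegral => // t _.
  set p := dotp x _; set q := dotp y _.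
  have pq : `|p - q| <= e / (I + 1) * \sum_i `|vec t 0 i|.
    rewrite /p /q -dotpNl -dotpDl /dotp mulr_sumr (le_trans (ler_norm_sum _ _ _))//.
    apply: ler_sum => i _; rewrite normrM !mxE; apply: ler_wpM2r => //.
    exact: ltW (xy i).
  have -> : a t * cos p + b t * sin p - (a t * cos q + b t * sin q) =
    a t * (cos p - cos q) + b t * (sin p - sin q) by ring.
  rewrite (le_trans (ler_normD _ _))// !normrM.
  apply: (@le_trans _ _ ((`|a t| + `|b t|) * `|p - q|)).
    by rewrite mulrDl; apply: lerD; apply: ler_wpM2l.
  have -> : G t = (`|a t| + `|b t|) * \sum_i `|vec t 0 i|.
    rewrite /G mulr_sumr; apply: eq_bigr => i _; rewrite !normrM; ring.
  rewrite mulrCA; apply: ler_wpM2l => //; exact: addr_ge0.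
rewrite RintegralZl// -/I mulrAC ltr_pdivrMr//.
by rewrite ltr_pM2l// ltrDl.
Qed.

Lemma osc_iter_partial a b s : rapid a -> rapid b -> exists a' b',
  [/\ rapid a', rapid b' & iter_partial s (osc a b) = osc a' b'].
Proof.
move=> ra rb; elim: s => [|i s [a' [b' [ra' rb' e]]]]; first by exists a, b.
exists (fun t => vec t 0 i * b' t), (fun t => - (vec t 0 i * a' t)); split.
- exact: rapid_coord.
- by apply: rapidN; exact: rapid_coord.
- apply/funext => x /=; rewrite -/(iter_partial s _) e.
  by case: (osc_derive x i ra' rb').
Qed.

Lemma smooth_osc a b Om : rapid a -> rapid b -> smooth_real Om (osc a b).
Proof.
move=> ra rb s x _; have [a' [b' [ra' rb' e]]] := osc_iter_partial s ra rb.
rewrite e; split; first exact: osc_continuous.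
by move=> i; case: (osc_derive x i ra' rb').
Qed.

Lemma rapid_scale (c : R) a : rapid a -> rapid (fun t => c * a t).
Proof.
move=> [ma ia]; split; first exact: measurable_funM.
move=> l l0; have := integrableZl measurableT c (ia l l0).
by under eq_fun do rewrite -EFinM mulrA.
Qed.

Lemma oscZ (c : R) a b x : rapid a -> rapid b ->
  osc (fun t => c * a t) (fun t => c * b t) x = c * osc a b x.
Proof.
move=> ra rb; rewrite /osc -RintegralZl//.
  by apply: eq_Rintegral => t _; ring.
exact: (osc_integrable ra rb (measurable_dotpr x)).
Qed.

(** Fourier inversion writes the real and imaginary parts of a test function as
    superpositions of plane waves. *)
Lemma smooth_testfun Om Om' f : testfun w Om f -> smooth Om' f.
Proof.
move=> hf; have cf := testfun_compactly_supported hf.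
have rRe : rapid (fun t => complex.Re (fourier f (vec t))).
  have [m1 m2] := cmeasurable_fourier cf.
  split=> // l l0; have iw := integrable_wnorm hw cf (testfun_wnorm hf l0).
  apply: (le_integrable measurableT _ _ iw).
    apply/measurable_EFinP; apply: measurable_funM => //; exact: (measurable_weight_vec hw).
  move=> t _; move: (fourier f (vec t)) => z; rewrite /= lee_fin !normrM.
  apply: ler_wpM2r => //.
  by rewrite (ger0_norm (cmod_ge0 _)) Re_le_cmod.
have rIm : rapid (fun t => complex.Im (fourier f (vec t))).
  have [m1 m2] := cmeasurable_fourier cf.
  split=> // l l0; have iw := integrable_wnorm hw cf (testfun_wnorm hf l0).
  apply: (le_integrable measurableT _ _ iw).
    apply/measurable_EFinP; apply: measurable_funM => //; exact: (measurable_weight_vec hw).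
  move=> t _; move: (fourier f (vec t)) => z; rewrite /= lee_fin !normrM.
  apply: ler_wpM2r => //.
  by rewrite (ger0_norm (cmod_ge0 _)) Im_le_cmod.
pose c := @inv2pi R d.
have inv x := fourier_inversionV hw x ler01 cf (testfun_wnorm hf ltr01).
pose A (t : Tup) := complex.Re (fourier f (vec t)).
pose B (t : Tup) := complex.Im (fourier f (vec t)).
have rNB : rapid (fun t => - B t) := rapidN rIm.
have ReE x : complex.Re (cint mu (fun t : Tup => fourier f (vec t) * expi (dotp x (vec t)))) =
    osc A (fun t => - B t) x.
  by congr fine; apply: eq_integral => t _; rewrite Re_mul mulNr.
have ImE x : complex.Im (cint mu (fun t : Tup => fourier f (vec t) * expi (dotp x (vec t)))) =
    osc B A x.
  by congr fine; apply: eq_integral => t _; rewrite Im_mul addrC.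
split.
- have -> : (fun x => complex.Re (f x)) = osc (fun t => c * A t) (fun t => c * - B t).
    apply/funext => x; rewrite oscZ// -ReE inv Re_mul mul0r subr0; reflexivity.
  by apply: smooth_osc; exact: rapid_scale.
- have -> : (fun x => complex.Im (f x)) = osc (fun t => c * B t) (fun t => c * A t).
    apply/funext => x; rewrite oscZ// -ImE inv Im_mul mul0r addr0; reflexivity.
  by apply: smooth_osc; exact: rapid_scale.
Qed.

Lemma iter_partial_local (U : set E) (u v : E -> R) s : open U ->
  (forall x, U x -> u x = v x) -> forall x, U x -> iter_partial s u x = iter_partial s v x.
Proof.
move=> oU uv; elim: s => [|i s IH] x Ux /=; first exact: uv.
apply: near_eq_derive; have : nbhs x U by exact: open_nbhs_nbhs.
by apply: filterS => y Uy; exact: IH.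
Qed.

Lemma smooth_real_local Om (u : E -> R) :
  (forall x, Om x -> exists U v, [/\ open U, U x, smooth_real setT v &
    forall y, U y -> u y = v y]) -> smooth_real Om u.
Proof.
move=> loc s x Omx; have [U [v [oU Ux sv uv]]] := loc x Omx.
have nU : nbhs x U by exact: open_nbhs_nbhs.
have eq s' : \near x, iter_partial s' v x = iter_partial s' u x.
  by apply: filterS nU => y Uy; apply/esym; exact: iter_partial_local oU uv y Uy.
have [cv dv] := sv s x I; split.
- have e := iter_partial_local s oU uv Ux.
  move=> A; rewrite e => /(cv A) h.
  have h1 : nbhs x (iter_partial s v @^-1` A) := h.
  change (nbhs x (iter_partial s u @^-1` A)).
  by apply: filterS (filterI h1 (eq s)) => y [] /= + <-.
- move=> i; exact: near_eq_derivable (eq s) (dv i).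
Qed.

End Smoothness.

(** * The regularity theorem *)

Section Localization.
Context {R : realType} {d : nat}.
Variable w : R -> R.
Hypothesis hw : weight_class w.
Local Notation C := R[i].
Local Notation E := 'rV[R]_d.
Local Notation Tup := (d.-tuple (measurableTypeR R)).
Local Notation mu := (@lebesgue_tuple R d).
Local Notation c0 := (@inv2pi R d).
Implicit Types (x y z xi eta : E) (f g psi phi : E -> C) (l : R) (Om K : set E).

Lemma wnorm_on_cutoff Om K h f (B : \bar R) : (wnorm_on w Om K h f < B)%E ->
  exists psi, [/\ testfun w Om psi, forall x, K x -> psi x = 1 &
    (wnorm w h (fun x => psi x * f x)%R < B)%E].
Proof.
move=> /ereal_inf_lt[_ [psi [hpsi psi1] <-] hB].
by exists psi; split.
Qed.

(** A cut-off function [chi] equal to 1 on [K] satisfies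
    [psi * f = psi * (chi * f)], and the norms are submultiplicative. *)
Lemma wnorm_mul_on Om K psi f h (B : R) : testfun_in w Om K psi -> ultradiff w Om f ->
  0 < h -> (wnorm_on w Om K h f < B%:E)%E ->
  (wnorm w h (fun x => psi x * f x)%R <= (c0 * fine (wnorm w h psi) * B)%:E)%E.
Proof.
move=> hpsi [_ hf] h0 /wnorm_on_cutoff[chi [hchi chi1 hB]].
have cpsi := testfun_compactly_supported hpsi.1.
have poo := testfun_wnorm hpsi.1 h0.
have -> : (fun x => psi x * f x) = (fun x => psi x * (chi x * f x)).
  apply/funext => x; have [Kx|nKx] := pselect (K x); first by rewrite chi1 ?mul1r.
  by rewrite (testfun_in_notin hpsi nKx) !mul0r.
have cc := testfun_compactly_supported (hf chi hchi).
apply: (le_trans (wnormM hw (ltW h0) cpsi poo cc)).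
have pfin : wnorm w h psi \is a fin_num.
  by rewrite ge0_fin_numE; [exact: poo|exact: wnorm_ge0].
rewrite !EFinM (fineK pfin) muleA; apply: lee_wpmul2l; last exact: ltW.
by apply: mule_ge0; [rewrite lee_fin ltW// inv2pi_gt0|exact: wnorm_ge0].
Qed.

Lemma pairing_on Om K phi : testfun_in w Om K phi -> exists2 M : R, 0 <= M &
  forall f (B : R), ultradiff w Om f -> (wnorm_on w Om K 1 f < B%:E)%E ->
    cmod (pairing f phi) <= M * B.
Proof.
move=> hphi; have cphi := testfun_compactly_supported hphi.1.
have [M M0 hM] := integralC_le cphi.
have i0 : 0 <= c0 by rewrite ltW// inv2pi_gt0.
exists (M * c0); first exact: mulr_ge0.
move=> f B [_ hf] /wnorm_on_cutoff[chi [hchi chi1 hB]].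
have cc := testfun_compactly_supported (hf chi hchi).
have -> : pairing f phi = integralC (fun x => phi x * (chi x * f x)).
  rewrite /pairing; congr integralC; apply/funext => x.
  have [Kx|nKx] := pselect (K x); first by rewrite chi1// mul1r mulrC.
  by rewrite (testfun_in_notin hphi nKx) mul0r mulr0.
rewrite -mulrA; apply: hM; first exact: cc.1.
move=> x; rewrite -lee_fin; apply: (le_trans (cmod_le_wnorm hw x ler01 cc)).
rewrite EFinM; apply: lee_wpmul2l; [by rewrite lee_fin|exact: ltW].
Qed.

Lemma pairingB Om f g phi : ultradiff w Om f -> ultradiff w Om g -> testfun w Om phi ->
  pairing (fun x => f x - g x) phi = pairing f phi - pairing g phi.
Proof.
move=> [_ hf] [_ hg] hphi.
have if_ := compactly_supported_integrable (testfun_compactly_supported (hf _ hphi)).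
have ig := compactly_supported_integrable (testfun_compactly_supported (hg _ hphi)).
have e u : pairing u phi = cint mu (fun t => phi (vec t) * u (vec t)).
  by rewrite /pairing integralCE; apply: eq_cint => t; rewrite mulrC.
by rewrite !e -(cintB if_ ig); apply: eq_cint => t; rewrite mulrBr.
Qed.

(** Inverses of integers, so that [w (eps n)^-1] grows by at most [w 1] at each
    step: estimates at consecutive indices are comparable. *)
Definition eps (n : nat) : R := n.+2%:R^-1.

Lemma eps_itv n : 0 < eps n < 1.
Proof. by rewrite /eps invr_gt0 ltr0n/= invf_lt1 ?ltr0n// ltr1n. Qed.

Lemma little_o_eps (u : R -> \bar R) (k : R) :
  little_o u (fun e => expR (k * w e^-1)) -> forall c : R, 0 < c ->
  exists N : nat, forall n, (N <= n)%N -> (`|u (eps n)| <= (c * expR (k * w n.+2%:R))%:E)%E.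
Proof.
move=> lo c cpos; have := lo c cpos.
move=> /nbhs_ballP[delta /= d0 hd].
exists (Num.truncn (delta^-1)) => n Nn.
have := hd (eps n); rewrite /eps invrK (ger0_norm (expR_ge0 _)); apply.
- rewrite /ball/= sub0r normrN gtr0_norm ?invr_gt0 ?ltr0n//.
  rewrite invf_plt ?posrE ?ltr0n//.
  apply: (lt_le_trans (truncnS_gt _)); rewrite ler_nat.
  by rewrite ltnS; exact: leqW.
- by rewrite invr_gt0 ltr0n.
Qed.

Lemma weight_nat_step n : w n.+3%:R <= w n.+2%:R + w 1.
Proof.
rewrite -[n.+3]addn1 natrD; apply: (weight_subadditive hw) => //; exact: ler0n.
Qed.

Lemma weight_nat_mono n : w n.+2%:R <= w n.+3%:R.
Proof. by apply: (weight_nondecreasing hw); [exact: ler0n|rewrite ler_nat]. Qed.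

Lemma weight_nat_ge0 n : 0 <= w n.+2%:R.
Proof. by apply: (weight_ge0 hw); exact: ler0n. Qed.

Lemma teleE n : tele n = (n.+1%:R * n.+2%:R)^-1 :> R.
Proof.
have n1 : n.+1%:R != 0 :> R by rewrite pnatr_eq0.
have n2 : n.+2%:R != 0 :> R by rewrite pnatr_eq0.
rewrite /tele -[n.+2]addn1 natrD in n2 *; move: n1 n2; move: (n.+1%:R : R) => a a0 a1.
by field; rewrite a0 a1.
Qed.

(** Exponentials of negative multiples of the weight are summable along the
    integers, again by the growth condition. *)
Lemma weight_decay gamma : 0 < gamma -> exists2 B : R, 0 < B &
  forall n, expR (- (gamma * w n.+2%:R)) <= B * tele n.
Proof.
move=> g0; have A0 : 0 <= 2 / gamma by rewrite divr_ge0// ltW.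
have [B B0 hB] := weight_growth hw A0.
exists (expR (gamma * ln B)); first exact: expR_gt0.
move=> n; have := hB n.+2%:R (ler0n _ _).
rewrite -{1}[B]lnK ?posrE// -expRD ler_expR => h.
have p0 : 0 < 1 + n.+2%:R :> R by rewrite ltr_pwDl// ler0n.
have e2 : 2 * ln (1 + n.+2%:R) <= gamma * ln B + gamma * w n.+2%:R.
  rewrite -mulrDr -ler_pdivrMl// mulrA (mulrC gamma^-1) [X in X * _ <= _](_ : _ = 2 / gamma)//.
rewrite teleE.
have sq : (1 + n.+2%:R) ^- 2 <= (n.+1%:R * n.+2%:R)^-1 :> R.
  rewrite nat1r lef_pV2 ?posrE ?exprn_gt0 ?mulr_gt0 ?ltr0n// expr2.
  rewrite -!natrM ler_nat; apply: leq_mul; [exact: leqW|exact: leqnSn].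
apply: (le_trans _ (ler_wpM2l (ltW (expR_gt0 _)) sq)).
have -> : (1 + n.+2%:R) ^- 2 = expR (- (2 * ln (1 + n.+2%:R))) :> R.
  by rewrite expRN expRM_natl lnK ?posrE.
by rewrite -expRD ler_expR; lra.
Qed.

Lemma exp_weight_integrable : exists2 I : R, 0 <= I &
  (\int[mu]_t (expR (- w (enorm (vec t))))%:E <= I%:E)%E.
Proof.
have [B B0 hB] := @exp_weight_lorentz R w hw d.
have iB := @integrable_scaled_lorentz R d B.
have me := @measurable_weight_vec R w hw d (-1).
exists (\int[mu]_t (B * lorentz (vec t))).
  apply: Rintegral_ge0 => t _; apply: mulr_ge0; first exact: ltW.
  exact: ltW (lorentz_gt0 _).
rewrite fineK; last exact: integrable_fin_num.
apply: ge0_le_integral => //.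
- by under eq_fun do rewrite -mulN1r; exact/measurable_EFinP.
- exact: measurable_int iB.
- by move=> t _; rewrite lee_fin.
Qed.

(** Where the weight is at most a small multiple [s * a] of [a], the decay of the
    pointwise bound on the Fourier transform absorbs the factor [expR ((l + N) * w)];
    elsewhere, a norm of large index [h] gains a factor [expR (- (h - N) * s * a)],
    which absorbs the growth [expR (k * a)].  It is essential that [h] may be
    chosen in terms of [k]. *)
Lemma wnorm_interpolation (b l k N : R) : 0 < b -> 0 < l -> 0 < k -> 0 < N ->
  exists2 h : R, 0 < h & exists2 Q : R, 0 <= Q & forall f (a A H : R),
    compactly_supported f -> 0 <= a -> 0 <= A -> 0 <= H ->
    (forall xi, cmod (fourier f xi) <= A * expR (- (b * a)) * expR (l * w (enorm xi))) ->
    (wnorm w h f <= (H * expR (k * a))%:E)%E ->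
    (wnorm w N f <= ((A * Q + H) * expR (- (b / 2 * a)))%:E)%E.
Proof.
move=> b0 l0 k0 N0.
have [Q Q0 hQ] := exp_weight_integrable.
(* The additional 1 leaves a factor [expR (- w)], which is integrable. *)
pose s := b / 2 / (l + N + 1).
have lN0 : 0 < l + N + 1 by rewrite !addr_gt0.
have s0 : 0 < s by rewrite !divr_gt0.
(* Such that [(h - N) * s] exceeds [k] by the final decay rate [b / 2]. *)
pose h := N + (k + b / 2) / s.
have h0 : 0 < h by rewrite addr_gt0// divr_gt0// addr_gt0// divr_gt0.
exists h => //; exists Q => // f a A H cf a0 A0 H0 hf hH.
have hs : (h - N) * s = k + b / 2.
  by rewrite /h addrAC subrr add0r mulfVK// lt0r_neq0.
have ls : (l + N + 1) * s = b / 2 by rewrite mulrC mulfVK// lt0r_neq0.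
have Nh : N <= h by rewrite lerDl divr_ge0 ?addr_ge0 ?divr_ge0 ?ltW.
have split_w (t : R) : 0 <= t ->
    expR (N * t) <= expR (b / 2 * a) * expR (- ((l + 1) * t)) +
      expR (- ((k + b / 2) * a)) * expR (h * t).
  move=> t0; rewrite -!expRD; have [ts|ts] := leP t (s * a).
    rewrite -[leLHS]addr0; apply: lerD; last exact: expR_ge0.
    rewrite ler_expR lerBrDr -mulrDl -ls -mulrA.
    have -> : N + (l + 1) = l + N + 1 by ring.
    by rewrite ler_pM2l.
  rewrite -[leLHS]add0r; apply: lerD; first exact: expR_ge0.
  rewrite ler_expR addrC lerBrDr -hs -mulrA -lerBrDl -mulrBl.
  apply: ler_wpM2l; [by rewrite subr_ge0|exact: ltW].
pose c1 := A * expR (- (b / 2 * a)).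
pose c2 := expR (- ((k + b / 2) * a)).
have c10 : 0 <= c1 by rewrite mulr_ge0// expR_ge0.
have c20 : 0 <= c2 by exact: expR_ge0.
have m1 : measurable_fun setT (fun t : Tup => (expR (- w (enorm (vec t))))%:E).
  by apply/measurable_EFinP; under eq_fun do rewrite -mulN1r; exact: (measurable_weight_vec hw).
have m2 := measurable_wnorm hw h cf.
pose p (t : Tup) : \bar R := (expR (- w (enorm (vec t))))%:E.
pose q (t : Tup) : \bar R := (cmod (fourier f (vec t)) * expR (h * w (enorm (vec t))))%:E.
have p0 t : (0 <= p t)%E by rewrite lee_fin expR_ge0.
have q0 t : (0 <= q t)%E by rewrite lee_fin mulr_ge0 ?cmod_ge0 ?expR_ge0.
apply: (@le_trans _ _ (\int[mu]_t (c1%:E * p t + c2%:E * q t))%E).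
  rewrite wnormE; apply: ge0_le_integral => //.
  - by move=> t _; rewrite lee_fin mulr_ge0 ?cmod_ge0 ?expR_ge0.
  - exact: measurable_wnorm.
  - by apply: emeasurable_funD; apply: measurable_funeM.
  move=> t _; rewrite /p /q -!EFinM -EFinD lee_fin.
  have W0 := weight_enorm_ge0 hw (vec t).
  set z := cmod _; set W := w _ in W0 *.
  have z0 : 0 <= z by exact: cmod_ge0.
  apply: (le_trans (ler_wpM2l z0 (split_w W W0))); rewrite mulrDr; apply: lerD.
    apply: (@le_trans _ _ (A * expR (- (b * a)) * expR (l * W) *
        (expR (b / 2 * a) * expR (- ((l + 1) * W))))).
      by apply: ler_wpM2r; [rewrite mulr_ge0 ?expR_ge0|exact: hf].
    have e : expR (- (b * a)) * expR (l * W) * (expR (b / 2 * a) * expR (- ((l + 1) * W))) =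
        expR (- (b / 2 * a)) * expR (- W) by rewrite -!expRD; congr expR; field.
    by rewrite /c1 -[X in _ <= X]mulrA -e !mulrA.
  by rewrite mulrCA.
rewrite ge0_integralD//; last 4 first.
- by move=> t _; rewrite mule_ge0.
- exact: measurable_funeM.
- by move=> t _; rewrite mule_ge0.
- exact: measurable_funeM.
rewrite !ge0_integralZl//.
apply: (@le_trans _ _ (c1%:E * Q%:E + c2%:E * (H * expR (k * a))%:E)%E).
  by apply: leeD; apply: lee_wpmul2l.
rewrite -!EFinM -EFinD lee_fin mulrDl; apply: lerD.
  by rewrite /c1 mulrAC.
rewrite /c2 mulrCA -expRD; apply: ler_wpM2l => //; rewrite ler_expR.
by rewrite le_eqVlt; apply/orP; left; apply/eqP; ring.
Qed.

End Localization.

Section CauchyNets.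
Context {R : realType} {d : nat}.
Variable w : R -> R.
Hypothesis hw : weight_class w.
Local Notation C := R[i].
Local Notation E := 'rV[R]_d.
Local Notation Tup := (d.-tuple (measurableTypeR R)).
Local Notation mu := (@lebesgue_tuple R d).
Local Notation c0 := (@inv2pi R d).
Implicit Types (x y z xi eta : E) (f psi phi chi : E -> C) (l : R) (Om K : set E).

Lemma bounded_of_eventually (v : nat -> R) (A : R) N :
  (forall n, (N <= n)%N -> v n <= A) -> exists A' : R, forall n, v n <= A'.
Proof.
move=> vA; exists (`|A| + \sum_(i < N) `|v i|) => n.
have [Nn|nN] := leqP N n.
  rewrite (le_trans (vA n Nn))// (le_trans (ler_norm A))// lerDl.
  by apply: sumr_ge0.
rewrite (le_trans (ler_norm _))// (bigD1 (Ordinal nN))//= addrCA lerDl.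
by apply: addr_ge0 => //; exact: sumr_ge0.
Qed.

(** Strong association makes the functionals given by the differences of
    consecutive terms, multiplied by [expR (b * a n)], bounded at each test
    function.  Uniform boundedness turns this into a pointwise bound on Fourier
    transforms; interpolation with the norms bounded by regularity then gives
    summable norms of the differences. *)
Lemma localized_cauchy Om K psi chi (T : (E -> C) -> C) (g : nat -> E -> C) (b k : R) :
  compact K -> K `<=` Om -> testfun_in w Om K psi -> testfun w Om chi ->
  (forall x, K x -> chi x = 1) -> (forall n, ultradiff w Om (g n)) -> 0 < b -> 0 < k ->
  (forall h : R, 0 < h -> exists N : nat, forall n, (N <= n)%N ->
     (wnorm_on w Om K h (g n) <= (expR (k * w n.+2%:R))%:E)%E) ->
  (forall phi, testfun_in w Om K phi -> exists (A : R) (N : nat), forall n, (N <= n)%N ->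
     cmod (pairing (g n) phi - T phi) <= A * expR (- b * w n.+2%:R)) ->
  forall l e : R, 0 < l -> 0 < e -> exists N : nat, forall m n, (N <= m)%N -> (N <= n)%N ->
    (wnorm w l (fun x => psi x * g m x - psi x * g n x)%R <= e%:E)%E.
Proof.
move=> cK KOm hpsi hchi chi1 hg b0 k0 reg assoc.
pose a (n : nat) : R := w n.+2%:R.
have a0 n : 0 <= a n by exact: (weight_nat_ge0 hw).
have aS n : a n <= a n.+1 by exact: (weight_nat_mono hw).
have aS1 n : a n.+1 <= a n + w 1 by exact: (weight_nat_step hw).
(* The cut-off makes integrable functions with compact support out of the
   differences, and leaves their pairings with functions supported in [K]
   unchanged. *)
pose D n x := chi x * g n.+1 x - chi x * g n x.
pose u n x := (expR (b * a n))%:C * D n x.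
have cchi n := testfun_compactly_supported ((hg n).2 chi hchi).
have cD n : compactly_supported (D n) by exact: compactly_supportedB.
have cu n : compactly_supported (u n) by exact: compactly_supportedZ.
have cutoff phi n : testfun_in w Om K phi ->
    (fun x => u n x * phi x) = (fun x => (expR (b * a n))%:C * (g n.+1 x * phi x - g n x * phi x)).
  move=> hphi; apply/funext => x; rewrite /u /D.
  have [Kx|nKx] := pselect (K x); first by rewrite chi1//; ring.
  by rewrite (testfun_in_notin hphi nKx); ring.
have igphi phi n : testfun_in w Om K phi ->
    cintegrable mu (fun t => g n (vec t) * phi (vec t)).
  move=> hphi; have := testfun_compactly_supported ((hg n).2 phi hphi.1).
  move=> /compactly_supported_integrable.
  by under eq_fun do rewrite mulrC.
have bounded phi : testfun_in w Om K phi ->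
    exists A : R, forall n, cmod (integralC (fun x => u n x * phi x)) <= A.
  move=> hphi; have [A [N hA]] := assoc phi hphi.
  apply: (@bounded_of_eventually _ (A + A) N) => n Nn; rewrite cutoff// integralCE.
  rewrite cintZ; last exact: (cintegrableB (igphi phi n.+1 hphi) (igphi phi n hphi)).
  rewrite (cintB (igphi phi n.+1 hphi) (igphi phi n hphi)) cmodM cmod_real.
  rewrite (ger0_norm (expR_ge0 _)).
  have h1 := hA n.+1 (leqW Nn); have h2 := hA n Nn.
  have A0 : 0 <= A.
    have := le_trans (cmod_ge0 _) h2; rewrite pmulr_lge0//; exact: expR_gt0.
  have -> : cint mu (fun t => g n.+1 (vec t) * phi (vec t)) -
      cint mu (fun t => g n (vec t) * phi (vec t)) =
      (pairing (g n.+1) phi - T phi) - (pairing (g n) phi - T phi).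
    by rewrite /pairing !integralCE; ring.
  apply: (@le_trans _ _ (expR (b * a n) * ((A + A) * expR (- b * a n)))).
    apply: ler_wpM2l; first exact: expR_ge0.
    rewrite (le_trans (cmodB _ _))// mulrDl; apply: lerD; last exact: h2.
    apply: (le_trans h1); apply: ler_wpM2l => //.
    by rewrite ler_expR !mulNr lerN2 ler_pM2l.
  by rewrite mulrCA -expRD mulNr subrr expR0 mulr1.
have [l l0 [A A0 hA]] := uniform_boundedness hw cK KOm hpsi cu bounded.
pose Dp n x := psi x * g n.+1 x - psi x * g n x.
have tpg n : testfun_in w Om K (fun x => psi x * g n x).
  have tt := (hg n).2 psi hpsi.1; split => //.
  apply: supp_subset => // x nKx.
  by rewrite (testfun_in_notin hpsi nKx) mul0r.
have cpg n := testfun_compactly_supported (tpg n).1.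
have cDp n : compactly_supported (Dp n) by exact: compactly_supportedB.
(* Evaluate the functionals at the modulation of [psi] by [- xi]. *)
have pointwise n xi : cmod (fourier (Dp n) xi) <=
    A * expR (- (b * a n)) * expR (l * w (enorm xi)).
  have := hA n (- xi); rewrite enormN cutoff; last exact: testfun_in_modulation.
  have -> : integralC (fun x => (expR (b * a n))%:C *
      (g n.+1 x * (psi x * expi (dotp x (- xi))) - g n x * (psi x * expi (dotp x (- xi))))) =
      (expR (b * a n))%:C * fourier (Dp n) xi.
    rewrite /fourier !integralCE -cintZ; last exact: compactly_supported_mod.
    by apply: eq_cint => t; rewrite /Dp dotpNr; ring.
  rewrite cmodM cmod_real (ger0_norm (expR_ge0 _)) => h.
  rewrite expRN mulrAC ler_pdivlMr ?expR_gt0// mulrC; exact: h.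
move=> l' e l'0 e0.
have [h h0 [Q Q0 interp]] := @wnorm_interpolation R d w hw b l k l' b0 l0 k0 l'0.
have [N hN] := reg h h0.
pose P : R := c0 * fine (wnorm w h psi).
have P0 : 0 <= P.
  by apply: mulr_ge0; [rewrite ltW// inv2pi_gt0|apply: fine_ge0; exact: wnorm_ge0].
(* The factor 2 makes the bound strict, so that some cut-off function satisfies it. *)
have norm_h n : (N <= n)%N ->
    (wnorm w h (fun x => psi x * g n x)%R <= (P * (2 * expR (k * a n)))%:E)%E.
  move=> Nn; apply: (wnorm_mul_on hw hpsi (hg n) h0).
  apply: (le_lt_trans (hN n Nn)); rewrite lte_fin ltr_pMl ?ltr1n//.
  exact: expR_gt0.
pose H : R := P * 2 * (expR (k * w 1) + 1).
have H0 : 0 <= H by rewrite mulr_ge0 ?addr_ge0 ?expR_ge0// mulr_ge0.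
have norm_D n : (N <= n)%N -> (wnorm w h (Dp n) <= (H * expR (k * a n))%:E)%E.
  move=> Nn; have h1 := norm_h n.+1 (leqW Nn); have h2 := norm_h n Nn.
  have -> : Dp n = (fun x => psi x * g n.+1 x + -1 * (psi x * g n x)).
    by apply/funext => x; rewrite mulN1r.
  apply: (le_trans (wnormD hw h (cpg n.+1) (compactly_supportedZ (-1) (cpg n)))).
  rewrite (wnormZ hw h (-1) (cpg n)) cmodN cmod1 mul1e.
  apply: (le_trans (leeD h1 h2)); rewrite -EFinD lee_fin /H.
  have ek : expR (k * a n.+1) <= expR (k * w 1) * expR (k * a n).
    by rewrite -expRD ler_expR -mulrDr ler_pM2l// addrC.
  have P2 : 0 <= P * 2 by rewrite mulr_ge0.
  have := ler_wpM2l P2 ek; move: (expR (k * a n.+1)) (expR (k * w 1)) (expR (k * a n)) => p q r.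
  by move=> hh; rewrite mulrDr mulrDl mulr1 !mulrA lerD2r; move: hh; rewrite !mulrA.
have [B B0 hB] := weight_decay hw (divr_gt0 b0 (ltr0n _ 2)).
have W0 : 0 <= (A * Q + H) * B.
  by apply: mulr_ge0; [apply: addr_ge0 => //; apply: mulr_ge0 => //; exact: ltW|exact: ltW].
apply: (@wnorm_telescope R d w hw l' ((A * Q + H) * B) N (fun n x => psi x * g n x) cpg W0 _ e e0).
move=> n Nn.
apply: (le_trans (interp (Dp n) (a n) A H (cDp n) (a0 n) (ltW A0) H0 (pointwise n) (norm_D n Nn))).
rewrite lee_fin -[X in _ <= X]mulrA; apply: ler_wpM2l; last exact: hB.
by apply: addr_ge0 => //; apply: mulr_ge0 => //; exact: ltW.
Qed.

End CauchyNets.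

Section Regularity.
Context {R : realType} {d : nat}.
Variable w : R -> R.
Hypothesis hw : weight_class w.
Local Notation C := R[i].
Local Notation E := 'rV[R]_d.
Local Notation Tup := (d.-tuple (measurableTypeR R)).
Local Notation mu := (@lebesgue_tuple R d).
Implicit Types (x y z xi eta : E) (f psi phi chi : E -> C) (l : R) (Om K : set E).

Lemma wnorm_on_ge0 Om K l f : (0 <= wnorm_on w Om K l f)%E.
Proof. by apply: le_ereal_inf_tmp => _ [psi _ <-]; exact: wnorm_ge0. Qed.

(** This allows the representatives of a class to be exchanged: differences decay
    at any rate. *)
Lemma negligible_pairing Om K (v : R -> E -> C) phi (b : R) :
  compact K -> K `<=` Om -> testfun_in w Om K phi -> Defs.negligible w Om v -> 0 < b ->
  exists (A : R) (N : nat), forall n, (N <= n)%N ->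
    cmod (pairing (v (@eps R n)) phi) <= A * expR (- b * w n.+2%:R).
Proof.
move=> cK KOm hphi [hv neg] b0.
have [M M0 hM] := pairing_on hw hphi.
have [N hN] := little_o_eps (neg K cK KOm 1 ltr01 b b0) ltr01.
exists (M * 2), N => n Nn; rewrite -mulrA; apply: hM; first exact: hv (@eps_itv R n).
have := hN n Nn; rewrite gee0_abs; last exact: wnorm_on_ge0.
move=> h; apply: (le_lt_trans h).
by rewrite lte_fin mul1r ltr_pMl ?expR_gt0// ltr1n.
Qed.

Lemma closed_ball_compact (x : E) (r : R) : 0 < r -> compact (closed_ball x r).
Proof.
move=> r0; apply: bounded_closed_compact; last exact: closed_ball_closed.
rewrite closed_ballE//.
exists (`|x| + r); split; first exact: num_real.
move=> M hM y /= hy; rewrite (le_trans _ (ltW hM))//.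
have -> : y = x - (x - y) by rewrite opprB addrC subrK.
by rewrite (le_trans (ler_normB _ _))// lerD2l.
Qed.

Lemma open_compact_neighborhood Om x : open Om -> Om x ->
  exists U K, [/\ open U, U x, U `<=` K, compact K & K `<=` Om].
Proof.
move=> oOm Omx; have : nbhs x Om by exact: open_nbhs_nbhs.
move=> /nbhs_closedballP[r hr].
exists (ball x r%:num), (closed_ball x r%:num); split.
- exact: ball_open.
- exact: ballxx.
- exact: subset_closed_ball.
- exact: closed_ball_compact.
- exact: hr.
Qed.

(** The limits of [psi * g_n] for the various [psi] are compatible and define a
    function [f] on [Om], which inherits from them the stability under products
    with test functions and, locally, smoothness; the integrals of [g_n * phi]
    converge both to [T phi] and to the integral of [f * phi]. *)
Theorem strongly_associated_regular Om (T : (E -> C) -> C) (G : set (R -> E -> C)) :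
  open Om -> regular w Om G -> strongly_associated w Om T G -> in_ultradiff w Om T.
Proof.
move=> oOm [[g0 hg0 <-] [g2 [hg2 hg20] reg]] [g1 [hg1 hg10] assoc].
(* [g1] realizes the association and [g2] the regularity; both differ from [g0] by
   negligible nets. *)
pose g n : E -> C := g2 (@eps R n).
have hg n : ultradiff w Om (g n) by exact: hg2.1 (@eps_itv R n).
(* The norm bounded by regularity is an infimum over cut-off functions; as it is
   finite, there are some. *)
have cutoff K : compact K -> K `<=` Om ->
    exists2 chi, testfun w Om chi & forall x, K x -> chi x = 1.
  move=> cK KOm; have [k k0 hk] := reg K cK KOm.
  have [N hN] := little_o_eps (hk 1 ltr01) ltr01.
  have := hN N (leqnn N); rewrite gee0_abs; last exact: wnorm_on_ge0.
  move=> h; have : (wnorm_on w Om K 1 (g N) < +oo)%E by apply: (le_lt_trans h); exact: ltry.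
  by move=> /wnorm_on_cutoff[chi [h1 h2 _]]; exists chi.
have assoc_g K : compact K -> K `<=` Om -> exists2 b : R, 0 < b &
    forall phi, testfun_in w Om K phi -> exists (A : R) (N : nat), forall n, (N <= n)%N ->
      cmod (pairing (g n) phi - T phi) <= A * expR (- b * w n.+2%:R).
  move=> cK KOm; have [b b0 hb] := assoc K cK KOm.
  exists b => // phi hphi.
  have [A1 [N1 h1]] := negligible_pairing cK KOm hphi hg10 b0.
  have [A2 [N2 h2]] := negligible_pairing cK KOm hphi hg20 b0.
  have [N3 h3] := little_o_eps (hb phi hphi) ltr01.
  exists (A2 + A1 + 1), (maxn N1 (maxn N2 N3)) => n.
  rewrite !geq_max => /and3P[n1 n2 n3].
  have := h3 n n3; rewrite abse_EFin lee_fin (ger0_norm (cmod_ge0 _)) => {}h3.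
  have {}h1 := h1 n n1; have {}h2 := h2 n n2.
  have it := @eps_itv R n.
  have d1 := pairingB (hg1.1 _ it) (hg0.1 _ it) hphi.1.
  have d2 := pairingB (hg2.1 _ it) (hg0.1 _ it) hphi.1.
  rewrite d1 in h1; rewrite d2 in h2.
  have -> : pairing (g n) phi - T phi =
    (pairing (g2 (@eps R n)) phi - pairing (g0 (@eps R n)) phi) -
    (pairing (g1 (@eps R n)) phi - pairing (g0 (@eps R n)) phi) +
    (pairing (g1 (@eps R n)) phi - T phi) by rewrite /g; ring.
  rewrite (le_trans (cmodD _ _))// !mulrDl; apply: lerD; last exact: h3.
  by rewrite (le_trans (cmodB _ _))//; apply: lerD.
have limit K psi : compact K -> K `<=` Om -> testfun_in w Om K psi ->
    exists2 F, testfun_in w Om K F & forall e : R, 0 < e ->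
      exists N : nat, forall n x, (N <= n)%N -> cmod (psi x * g n x - F x) <= e.
  move=> cK KOm hpsi; have [chi hchi chi1] := cutoff K cK KOm.
  have [b b0 hb] := assoc_g K cK KOm.
  have [k k0 hk] := reg K cK KOm.
  apply: (testfun_in_complete hw cK KOm).
    move=> n; have tt := (hg n).2 psi hpsi.1; split => //.
    apply: supp_subset => // x nKx.
    by rewrite (testfun_in_notin hpsi nKx) mul0r.
  apply: (localized_cauchy hw cK KOm hpsi hchi chi1 hg b0 k0 _ hb).
  move=> h h0; have [N hN] := little_o_eps (hk h h0) ltr01.
  exists N => n Nn; have := hN n Nn.
  by rewrite gee0_abs ?mul1r//; exact: wnorm_on_ge0.
have cvg_of (z : nat -> C) (a : C) : (forall e : R, 0 < e ->
    exists N : nat, forall n, (N <= n)%N -> cmod (z n - a) <= e) ->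
    cmod (z n - a) @[n --> \oo] --> 0.
  move=> h; apply/cvgrPdist_le => e /h[N hN]; exists N => // n /= Nn.
  by rewrite sub0r normrN ger0_norm ?cmod_ge0// hN.
have /choice[f hf] : forall x, exists a : C, Om x -> cmod (g n x - a) @[n --> \oo] --> 0.
  move=> x; have [Omx|nOmx] := pselect (Om x); last by exists 0.
  have [U [K [_ Ux UK cK KOm]]] := open_compact_neighborhood oOm Omx.
  have [chi hchi chi1] := cutoff K cK KOm.
  have [|||F _ hF] := limit (supp chi) chi; [by case: hchi|by case: hchi|by split|].
  exists (F x) => _; apply: cvg_of => e /hF[N hN]; exists N => n Nn.
  have := hN n x Nn; rewrite chi1 ?mul1r//; exact: UK.
have mul_limit psi : testfun w Om psi -> testfun w Om (fun x => psi x * f x) /\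
    forall e : R, 0 < e -> exists N : nat, forall n x, (N <= n)%N ->
      cmod (psi x * g n x - psi x * f x) <= e.
  move=> hpsi; have [cpsi kpsi spsi _] := hpsi.
  have hin : testfun_in w Om (supp psi) psi by split.
  have [F hF limF] := limit (supp psi) psi kpsi spsi hin.
  have eF : (fun x => psi x * f x) = F.
    apply/funext => x; have [Omx|nOmx] := pselect (Om x); last first.
      have nx : ~ supp psi x by move=> /spsi.
      by rewrite (notin_supp nx) mul0r (testfun_in_notin hF nx).
    apply: (@clim_unique R (fun n => psi x * g n x)).
      have -> : (fun n => cmod (psi x * g n x - psi x * f x)) =
          (fun n => cmod (psi x) * cmod (g n x - f x)).
        by apply/funext => n; rewrite -mulrBr cmodM.
      rewrite -[X in _ --> X](mulr0 (cmod (psi x))).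
      by apply: cvgM; [exact: cvg_cst|exact: hf].
    by apply: cvg_of => e /limF[N hN]; exists N => n; exact: hN.
  split; first by rewrite eF; exact: hF.1.
  move=> e /limF[N hN]; exists N => n x Nn.
  by rewrite -[psi x * f x]/((fun x => psi x * f x) x) eF; exact: hN.
exists f; split; last first.
  move=> phi hphi; have [cphi kphi sphi _] := hphi.
  have hin : testfun_in w Om (supp phi) phi by split.
  have [b b0 hb] := assoc_g _ kphi sphi.
  have [A [N hA]] := hb phi hin.
  have [tf hlim] := mul_limit phi hphi.
  apply: (@clim_unique R (fun n => pairing (g n) phi)).
    have [B B0 hB] := weight_decay hw b0.
    have lim0 : A * (B * n.+1%:R^-1) @[n --> \oo] --> (0 : R).
      rewrite -[X in _ --> X](mulr0 A); apply: cvgM; first exact: cvg_cst.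
      rewrite -[X in _ --> X](mulr0 B); apply: cvgM; first exact: cvg_cst.
      exact: cvg_harmonic.
    apply: (squeeze_cvgr _ (cvg_cst 0) lim0); exists N => // n /= Nn.
    rewrite cmod_ge0/= (le_trans (hA n Nn))//.
    have A0 : 0 <= A.
      have := le_trans (cmod_ge0 _) (hA n Nn); rewrite pmulr_lge0//; exact: expR_gt0.
    apply: ler_wpM2l => //; rewrite mulNr (le_trans (hB n))//.
    apply: ler_wpM2l; first exact: ltW.
    by rewrite /tele lerBlDr lerDl invr_ge0 ler0n.
  have [V V0 hV] := cint_supported_le kphi.
  apply: cvg_of => e e0.
  have e1 : 0 < e / (V + 1) by rewrite divr_gt0// ltr_wpDl.
  have [N1 hN1] := hlim _ e1.
  exists N1 => n Nn.
  have cgn := testfun_compactly_supported ((hg n).2 phi hphi).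
  have cft := testfun_compactly_supported tf.
  have i1 := compactly_supported_integrable cgn.
  have i2 := compactly_supported_integrable cft.
  have -> : pairing (g n) phi - pairing f phi =
      integralC (fun x => phi x * g n x - phi x * f x).
    rewrite integralCE (cintB i1 i2); congr (_ - _); apply: eq_cint => t; exact: mulrC.
  apply: (@le_trans _ _ (e / (V + 1) * V)).
    apply: hV.
    - exact: cintegrable_measurable (cintegrableB i1 i2).
    - exact: ltW.
    - by move=> x nx; rewrite (notin_supp nx) !mul0r subrr.
    - by move=> x; exact: hN1.
  by rewrite mulrAC ler_pdivrMr ?ltr_wpDl// ler_wpM2l ?(ltW e0)// lerDl.
split; last by move=> psi /mul_limit[].
have loc x : Om x -> exists U F, [/\ open U, U x, testfun w Om F & forall y, U y -> f y = F y].
  move=> Omx; have [U [K [oU Ux UK cK KOm]]] := open_compact_neighborhood oOm Omx.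
  have [chi hchi chi1] := cutoff K cK KOm.
  exists U, (fun y => chi y * f y); split => //; first exact: (mul_limit chi hchi).1.
  by move=> y Uy; rewrite chi1 ?mul1r//; exact: UK.
split; apply: smooth_real_local => x /loc[U [F [oU Ux hF fF]]].
- exists U, (fun y => complex.Re (F y)); split=> //; last by move=> y /fF ->.
  exact: (smooth_testfun hw setT hF).1.
- exists U, (fun y => complex.Im (F y)); split=> //; last by move=> y /fF ->.
  exact: (smooth_testfun hw setT hF).2.
Qed.

End Regularity.

Theorem theorem7p1 (R : realType) (d : nat) (Om : set 'rV[R]_d) (w : R -> R)
    (T : ('rV[R]_d -> R[i]) -> R[i]) (G : set (R -> 'rV[R]_d -> R[i])) :
  open Om ->
  weight_class w ->
  ultradistribution w Om T ->
  regular w Om G ->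
  strongly_associated w Om T G ->
  in_ultradiff w Om T.
Proof.
by move=> oOm hw _ rG aG; exact: (strongly_associated_regular hw oOm rG aG).
Qed.
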